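(* Let $n\ge2$. The congruences on the $0$-twisted partition monoid $\mathcal P^\Phi_{n,0}$ are precisely: (1) the Rees congruences $R_q:=\{(\alpha,\beta)\in\mathcal P^\Phi_{n,0}\times\mathcal P^\Phi_{n,0}:\alpha=\beta\text{ or }\operatorname{rank}\alpha,\operatorname{rank}\beta\le q\}$ for $q\in\{-\infty,0,1,\dots,n\}$, including the universal congruence $\nabla=R_n$ and the trivial congruence $\Delta=R_{-\infty}$; (2) the relations $R_N:=R_{q-1}\cup\nu_N$ for $q\in\{2,\dots,n\}$ and $\{\mathrm{id}_q\}\ne N\trianglelefteq\mathcal S_q$; (3) the relations $$\mu^\uparrow:=R_0\cup\{(\alpha,\beta)\in D_1\times D_1:\widehat\alpha=\widehat\beta,\ \alpha\,\mathscr R\,\beta\},\qquad \mu^\downarrow:=R_0\cup\{(\alpha,\beta)\in D_1\times D_1:\widehat\alpha=\widehat\beta,\ \alpha\,\mathscr L\,\beta\},$$ $$\mu:=R_0\cup\{(\alpha,\beta)\in D_1\times D_1:\widehat\alpha=\widehat\beta\},\qquad \mu_{\mathcal S_2}:=\mu\cup\nu_{\mathcal S_2}.$$ The congruence lattice (ordered by inclusion) has the following Hasse diagram: $\Delta$ is covered by $R_0$; $R_0$ is covered by exactly $\mu^\uparrow$ and $\mu^\downarrow$, each of which is covered exactly by $\mu$; $\mu$ is covered by exactly $R_1$ and $\mu_{\mathcal S_2}$, each of which is covered exactly by $R_{\mathcal S_2}$; and from $R_{\mathcal S_2}$ upwards the lattice is the chain $R_{\mathcal S_2}<R_2<R_{\mathcal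 A_3}<R_{\mathcal S_3}<R_3<\cdots<R_{\mathcal S_n}<R_n=\nabla$, in which, for each $q\in\{3,\dots,n\}$, the elements strictly between $R_{q-1}$ and $R_q$ are the $R_N$ with $\{\mathrm{id}_q\}\ne N\trianglelefteq\mathcal S_q$, ordered by inclusion of $N$.
   Context: **Partitions.** The partition monoid $\mathcal P_n$ consists of all set partitions of $X\cup X'$, where $X=\{1,\dots,n\}$, $X'=\{1',\dots,n'\}$. A partition is identified with any graph on $X\cup X'$ whose connected components are its blocks. For $\alpha,\beta\in\mathcal P_n$, let $X''=\{1'',\dots,n''\}$; rename each lower vertex $x'$ of $\alpha$ as $x''$ and each upper vertex $x$ of $\beta$ as $x''$, and let the product graph $\Gamma(\alpha,\beta)$ on $X\cup X''\cup X'$ be the union of the two resulting graphs. The product $\alpha\beta$ is the partition in which $x,y\in X\cup X'$ lie in the same block iff they lie in the same connected component of $\Gamma(\alpha,\beta)$. $\Phi(\alpha,\beta)$ is the number of connected components of $\Gamma(\alpha,\beta)$ contained in $X''$. A transversal of $\alpha$ is a block meeting both $X$ and $X'$; $\operatorname{rank}\alpha$ is the number of transversals; $D_q=\{\alpha\in\mathcal P_n:\operatorname{rank}\alpha=q\}$. $\widehat\alpha$ is the rank-$0$ partition obtained from $\alpha$ by splitting each transversal $A\cup B'$ into $A$ and $B'$. $\mathscr R,\mathscr L,\mathscr H=\mathscr R\cap\mathscr L$ are Green's relations on $\mathcal P_n$. If $\alpha\,\mathscr H\,\beta$ have rank $q$ and $\alpha$ has transversals $A_i\cup B_i'$ ($1\le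 i\le q$), then $\beta$ has transversals $A_i\cup B_{i\pi}'$ for some $\pi\in\mathcal S_q$ (symmetric group), and we put $\partial(\alpha,\beta)=\pi$, well defined up to conjugacy in $\mathcal S_q$. For $2\le q\le n$ and $N\trianglelefteq\mathcal S_q$, $\nu_N=\{(\alpha,\beta)\in D_q\times D_q:\alpha\,\mathscr H\,\beta,\ \partial(\alpha,\beta)\in N\}$. $\mathcal A_q$ is the alternating group. **$0$-twisted partition monoid.** $\mathcal P^\Phi_{n,0}=\mathcal P_n\cup\{\mathbf 0\}$, where the product of $\alpha,\beta\in\mathcal P_n$ is $\alpha\beta$ (the product in $\mathcal P_n$) if $\Phi(\alpha,\beta)=0$, and all other products equal $\mathbf 0$. By convention $\operatorname{rank}\mathbf 0=-\infty$. *)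

(* Defs.v *)
From HB Require Import structures.
From mathcomp Require Import all_boot all_fingroup.
From mathcomp Require Import alt.

Set Implicit Arguments.
Unset Strict Implicit.
Unset Printing Implicit Defensive.

(* X u X' is 'I_n + 'I_n, with X = {1..n} on the left and X' on the right. *)
Definition vertex (n : nat) : finType := ('I_n + 'I_n)%type.

Definition upper (n : nat) : {set vertex n} := [set inl x | x : 'I_n].
Definition lower (n : nat) : {set vertex n} := [set inr x | x : 'I_n].

Record part (n : nat) := Part {
  blocks : {set {set vertex n}};
  blocksP : partition blocks [set: vertex n] }.

HB.instance Definition _ (n : nat) := [isSub for @blocks n].
HB.instance Definition _ (n : nat) := [Finite of part n by <:].

Section Product.
Variables (n : nat) (a b : part n).

(* X u X'' u X' is ('I_n + 'I_n) + 'I_n, in this order. *)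
Definition gvertex : finType := ('I_n + 'I_n + 'I_n)%type.

Definition emb_left (v : vertex n) : gvertex := inl v.
Definition emb_right (v : vertex n) : gvertex :=
  match v with inl x => inl (inr x) | inr x => inr x end.
Definition emb_outer (v : vertex n) : gvertex :=
  match v with inl x => inl (inl x) | inr x => inr x end.
Definition middle : {set gvertex} := [set inl (inr x) | x : 'I_n].

(* The graph representing a partition is taken to be complete on each block. *)
Definition product_graph : rel gvertex := fun u v =>
  [exists A in blocks a, (u \in emb_left @: A) && (v \in emb_left @: A)]
  || [exists B in blocks b, (u \in emb_right @: B) && (v \in emb_right @: B)].

Definition components : {set {set gvertex}} :=
  equivalence_partition (connect product_graph) [set: gvertex].

Definition Phi : nat := #|[set C in components | C \subset middle]|.

Definition product_blocks : {set {set vertex n}} :=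
  equivalence_partition
    (fun x y => connect product_graph (emb_outer x) (emb_outer y))
    [set: vertex n].

Lemma product_graph_sym : symmetric product_graph.
Proof.
move=> u v; rewrite /product_graph.
by congr (_ || _); apply: eq_existsb => A; congr (_ && _); exact: andbC.
Qed.

Lemma product_blocksP : partition product_blocks [set: vertex n].
Proof.
apply: equivalence_partitionP => x y z _ _ _; split; first exact: connect0.
by move=> xy; apply: (same_connect (sym_connect_sym product_graph_sym) xy).
Qed.

Definition pmul : part n := Part product_blocksP.

End Product.

Section PartitionMonoid.
Variable n : nat.
Implicit Types (A : {set vertex n}) (a b : part n).

Definition transversal A : bool :=
  (A :&: upper n != set0) && (A :&: lower n != set0).

Definition transversals a : {set {set vertex n}} :=
  [set A in blocks a | transversal A].

Definition rank a : nat := #|transversals a|.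

Definition split_block A : {set {set vertex n}} :=
  if transversal A then [set A :&: upper n; A :&: lower n] else [set A].

Definition hat_blocks a : {set {set vertex n}} :=
  \bigcup_(A in blocks a) split_block A.

Lemma hat_blocksP a : partition (hat_blocks a) [set: vertex n].
Proof.
have upperP v : v \in upper n = ~~ (v \in lower n).
  have inl_inr (x y : 'I_n) : inl x <> inr y :> vertex n by [].
  rewrite /upper /lower; case: v => x.
    rewrite [LHS]imset_f //; apply/esym/negP => /imsetP[y _].
    exact: inl_inr.
  rewrite [X in ~~ X]imset_f //; apply/negbTE/negP => /imsetP[y _] /esym.
  exact: inl_inr.
have sub_split A B : B \in split_block A -> B \subset A.
  rewrite /split_block; case: ifP => _; last by rewrite inE => /eqP ->.
  by rewrite !inE => /orP[] /eqP ->; apply: subsetIl.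
have /andP[/eqP cov /andP[triv ne0]] : partition (blocks a) setT.
  exact: blocksP.
apply/and3P; split.
- apply/eqP/setP => v; rewrite inE; apply/bigcupP.
  have : v \in cover (blocks a) by rewrite cov inE.
  case/bigcupP => A aA Av.
  have [tA|ntA] := boolP (transversal A); last first.
    exists A => //; apply/bigcupP; exists A => //.
    by rewrite /split_block (negbTE ntA) inE.
  exists (A :&: if v \in upper n then upper n else lower n).
    apply/bigcupP; exists A => //.
    by rewrite /split_block tA !inE; case: ifP; rewrite eqxx ?orbT.
  by rewrite inE Av /=; case: ifP => //; rewrite upperP => /negbFE.
- apply/trivIsetP => B1 B2 /bigcupP[A1 aA1 sB1] /bigcupP[A2 aA2 sB2] neB.
  have [eA|neA] := eqVneq A1 A2; last first.
    apply: disjointWl (sub_split _ _ sB1) _.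
    apply: disjointWr (sub_split _ _ sB2) _.
    exact: (trivIsetP triv).
  move: sB1 sB2 neB; rewrite -eA /split_block.
  have dis : [disjoint A1 :&: upper n & A1 :&: lower n].
    apply/pred0P => v /=; rewrite !inE upperP.
    by case: (v \in lower n); rewrite ?andbF.
  case: ifP => _; last by rewrite !inE => /eqP -> /eqP ->; rewrite eqxx.
  rewrite !inE => /orP[] /eqP -> /orP[] /eqP ->; rewrite ?eqxx // => _.
  by rewrite disjoint_sym.
- apply/bigcupP => -[A aA]; rewrite /split_block.
  case: ifP => [/andP[neu nel]|_]; last first.
    by rewrite inE => /eqP e; rewrite e aA in ne0.
  rewrite !inE => /orP[] /eqP e.
  + by rewrite -e eqxx in neu.
  + by rewrite -e eqxx in nel.
Qed.

Definition hat a : part n := Part (hat_blocksP a).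

(* P_n has an identity, so the principal one-sided ideals are a P_n, P_n a. *)
Definition greenR a b : bool :=
  [set pmul a c | c : part n] == [set pmul b c | c : part n].
Definition greenL a b : bool :=
  [set pmul c a | c : part n] == [set pmul c b | c : part n].
Definition greenH a b : bool := greenR a b && greenL a b.

(* The block A u B'. *)
Definition glue (A B : {set 'I_n}) : {set vertex n} :=
  [set inl x | x in A] :|: [set inr x | x in B].

(* [diff_perm a b s]: s is a value of d(a, b) for some labelling A_i u B_i' of
   the transversals of a; the values for other labellings are its conjugates. *)
Definition diff_perm (q : nat) a b (s : 'S_q) : bool :=
  [exists A : {ffun 'I_q -> {set 'I_n}}, exists B : {ffun 'I_q -> {set 'I_n}},
    (transversals a == [set glue (A i) (B i) | i : 'I_q])
    && (transversals b == [set glue (A i) (B (s i)) | i : 'I_q])].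

Definition nu_rel (q : nat) (N : {set 'S_q}) : rel (part n) := fun a b =>
  [&& rank a == q, rank b == q, greenH a b & [exists s in N, diff_perm a b s]].

Definition mu_rel : rel (part n) := fun a b =>
  [&& rank a == 1, rank b == 1 & hat a == hat b].

End PartitionMonoid.

(* The 0-twisted monoid is P_n with a zero [None] adjoined. *)
Definition tpart (n : nat) : finType := option (part n).

Definition tmul (n : nat) (x y : tpart n) : tpart n :=
  match x, y with
  | Some a, Some b => if Phi a b == 0 then Some (pmul a b) else None
  | _, _ => None
  end.

Section Congruences.
Variables (T : finType) (mul : T -> T -> T).

Definition congruence (th : {set T * T}) : Prop :=
  equivalence_rel (fun x y => (x, y) \in th) /\
  forall x y z, (x, y) \in th ->
    (mul z x, mul z y) \in th /\ (mul x z, mul y z) \in th.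

Definition covered_by (th1 th2 : {set T * T}) : Prop :=
  [/\ congruence th1, congruence th2, th1 \proper th2 &
      forall th, congruence th -> ~ (th1 \proper th /\ th \proper th2)].

End Congruences.

(* Ranks of elements of the 0-twisted monoid; [None] stands for -oo. *)
Definition trank (n : nat) (x : tpart n) : option nat := omap (@rank n) x.

Definition le_rank (r s : option nat) : bool :=
  match r, s with
  | None, _ => true
  | Some _, None => false
  | Some i, Some j => i <= j
  end.

Section TwistedCongruences.
Variable n : nat.

Definition lift_rel (r : rel (part n)) : {set tpart n * tpart n} :=
  [set p | match p with (Some a, Some b) => r a b | _ => false end].

Definition Rees (q : option nat) : {set tpart n * tpart n} :=
  [set p | (p.1 == p.2) || (le_rank (trank p.1) q && le_rank (trank p.2) q)].

Definition nu (q : nat) (N : {set 'S_q}) : {set tpart n * tpart n} :=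
  lift_rel (nu_rel N).

(* Only meant for 2 <= q <= n. *)
Definition RN (q : nat) (N : {set 'S_q}) : {set tpart n * tpart n} :=
  Rees (Some q.-1) :|: nu N.

Definition mu_up : {set tpart n * tpart n} :=
  Rees (Some 0) :|: lift_rel (fun a b => mu_rel a b && greenR a b).
Definition mu_down : {set tpart n * tpart n} :=
  Rees (Some 0) :|: lift_rel (fun a b => mu_rel a b && greenL a b).
Definition mu : {set tpart n * tpart n} :=
  Rees (Some 0) :|: lift_rel (@mu_rel n).
Definition mu_S2 : {set tpart n * tpart n} := mu :|: nu ('Sym_('I_2))%g.

Definition Delta : {set tpart n * tpart n} := [set p | p.1 == p.2].
Definition Nabla : {set tpart n * tpart n} := [set: tpart n * tpart n].

End TwistedCongruences.

(* Main.v *)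
From Corelib Require Import Setoid.
Require Import Defs.
From mathcomp Require Import all_boot all_fingroup.
From mathcomp Require Import cyclic gseries alt.

Set Implicit Arguments.
Unset Strict Implicit.
Unset Printing Implicit Defensive.

(** A partition is studied through its upper and lower kernels and its
   transversals. In the product graph of [c] and [a] the lower blocks of [a]
   communicate with the rest only through the transversals of [a]; so the
   product is governed by the join of [c] with the upper kernel of [a] ([jc],
   [pmul_up], [pmul_ul], [pmul_lo], [Phi0_left]), whatever the lower parts to
   which the transversals of [a] are linked. This one fact has two uses.

   It makes the listed relations congruences: two partitions with the same
   kernels and the same upper ends of transversals react alike to a left factor,
   be it by floating components, by a drop of rank or by survival
   ([same_pattern_pmul], [mu_pmul]); the upside-down involution [flip] takes care
   of right factors.

   It also makes it easy to design multipliers. A map of vertices sending the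
   blocks of [a] into the blocks of [g], and reaching every transversal of [g],
   yields factors that turn [a] into [g] without floating components, and these
   factors depend on [g] through its kernels only; hence pairs of partitions
   can be moved simultaneously ([morph_mul], [th_morph]). Other multipliers merge
   two upper blocks or cut upper vertices off.

   Let [th] be a nontrivial congruence. Separating two related partitions by
   a cut turns one of them into zero ([separate]), so [th] contains [R_0]. If a
   partition of rank [r] is related to something of smaller rank, then [th]
   contains [R_r] ([ideal_of_drop], by induction on [r], merging transversals to
   lower the ranks). Let [q] be the largest rank with [R_q] inside [th]. A pair
   outside [R_q] has equal ranks; merging blocks shows that its kernels and the
   ends of its transversals agree if the rank is at least 2
   ([same_pattern_of_th]), that both members coincide if the rank is at least
   [q + 2] and at least 3 ([eq_of_th]), and that they have equal kernels if the
   rank is 1 ([mu_of_th]). If [q] is positive, only the permutations linking the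
   transversals of pairs of rank [q + 1] remain; they form a normal subgroup
   [N], and [th] is [R_N] ([RN_of_ideal]). If [q = 0], only pairs in [mu] of rank
   1 and pairs of rank 2 differing by the transposition remain, and inspecting
   which of them occur leaves five congruences ([small_congruences]).

   The order relations follow from this analysis: above each congruence of the
   diagram there are one or two least ones. That the congruences containing
   [R_S2] form a chain rests on the normal subgroups of a symmetric group
   forming a chain ([normal_chain]): this is the simplicity of the alternating
   group, except in degree 4, where the orders of the subgroups decide. *)

(** * Partitions as labellings of the vertices *)

Section Classes.
Variable n : nat.
Implicit Types (a b c : part n) (u v : vertex n).

(** Blocks enter as values of this map, so that belonging to the same block is an
   equality and chains of memberships are rewriting. *)
Definition cls a v : {set vertex n} := pblock (blocks a) v.
Definition up a (x : 'I_n) := cls a (inl x).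
Definition lo a (y : 'I_n) := cls a (inr y).

Lemma mem_cls a u v : (v \in cls a u) = (cls a u == cls a v).
Proof.
case/and3P: (blocksP a) => /eqP cov ti _.
by rewrite eq_pblock // cov inE.
Qed.

Lemma part_ext a b :
  (forall u v, cls a u = cls a v <-> cls b u = cls b v) -> a = b.
Proof.
move=> eab; apply: val_inj.
rewrite -[LHS](equivalence_partition_pblock (blocksP a)).
rewrite -[RHS](equivalence_partition_pblock (blocksP b)).
have eqc v w : (v \in cls a w) = (v \in cls b w).
  by rewrite !mem_cls; apply/eqP/eqP => /eab.
by apply: eq_imset => v; apply/setP => w; rewrite !inE eqc.
Qed.

Lemma part_ext3 a b :
    (forall x y, up a x = up a y <-> up b x = up b y) ->
    (forall x y, up a x = lo a y <-> up b x = lo b y) ->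
    (forall x y, lo a x = lo a y <-> lo b x = lo b y) ->
  a = b.
Proof.
move=> uu ul ll; apply: part_ext => -[x|x] [y|y]; [exact: uu|exact: ul| |exact: ll].
by split=> /esym/ul/esym.
Qed.

Lemma cls_equivalence_partition (R : rel (vertex n))
    (eqR : {in [set: vertex n] & &, equivalence_rel R}) u v :
  pblock (equivalence_partition R [set: vertex n]) u =
    pblock (equivalence_partition R [set: vertex n]) v <-> R u v.
Proof.
case/and3P: (equivalence_partitionP eqR) => /eqP cov ti _.
rewrite -(pblock_equivalence_partition eqR) ?inE // -eq_pblock ?cov ?inE //.
by split=> /eqP.
Qed.

(** All the partitions constructed below are given by such a labelling: no
   equivalence relation has then to be checked. *)
Definition of_lab (L : eqType) (f : vertex n -> L) : part n :=
  Part (preim_partitionP f [set: vertex n]).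

Lemma cls_of_lab (L : eqType) (f : vertex n -> L) u v :
  cls (of_lab f) u = cls (of_lab f) v <-> f u = f v.
Proof.
rewrite cls_equivalence_partition; first by split=> /eqP.
by move=> x y z _ _ _ /=; split=> // /eqP->.
Qed.

End Classes.

(** * The product seen from its left factor *)

Section ProductFormula.
Variable n : nat.
Implicit Types (a b c : part n) (u v : vertex n).

Lemma pgP a b (g h : gvertex n) :
  product_graph a b g h <->
    (exists u v, [/\ g = emb_left u, h = emb_left v & cls a u = cls a v]) \/
    (exists u v, [/\ g = emb_right u, h = emb_right v & cls b u = cls b v]).
Proof.
have blockP c u v A : A \in blocks c -> u \in A -> v \in A -> cls c u = cls c v.
  case/and3P: (blocksP c) => _ ti _ cA Au Av.
  by rewrite /cls !(def_pblock ti cA).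
have clsP c u : cls c u \in blocks c /\ u \in cls c u.
  case/and3P: (blocksP c) => /eqP cov ti _.
  by rewrite /cls pblock_mem ?mem_pblock cov inE.
rewrite /product_graph; split.
  case/orP=> /existsP[A /and3P[cA /imsetP[u Au ->] /imsetP[v Av ->]]].
    by left; exists u, v; split=> //; apply: blockP cA Au Av.
  by right; exists u, v; split=> //; apply: blockP cA Au Av.
case=> -[u [v [-> -> e]]]; apply/orP; [left|right].
  apply/existsP; exists (cls a u); case: (clsP a u) => -> uA.
  by rewrite !imset_f //= mem_cls e.
apply/existsP; exists (cls b u); case: (clsP b u) => -> uA.
by rewrite !imset_f //= mem_cls e.
Qed.

Definition gcon a b := connect (product_graph a b).

Lemma gcon_equiv a b : equivalence_rel (gcon a b).
Proof.
move=> x y z; split; first exact: connect0.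
by move=> xy; apply: (same_connect (sym_connect_sym (@product_graph_sym n a b)) xy).
Qed.

Lemma gcon_trans a b : transitive (gcon a b).
Proof. exact: connect_trans. Qed.

Lemma gcon_left a b u v : cls a u = cls a v -> gcon a b (emb_left u) (emb_left v).
Proof. by move=> e; apply/connect1/pgP; left; exists u, v. Qed.

Lemma gcon_right a b u v : cls b u = cls b v -> gcon a b (emb_right u) (emb_right v).
Proof. by move=> e; apply/connect1/pgP; right; exists u, v. Qed.

(** Components are separated by exhibiting a function constant on the blocks of
   both factors. *)
Lemma gcon_min a b (L : Type) (f : gvertex n -> L) :
    (forall u v, cls a u = cls a v -> f (emb_left u) = f (emb_left v)) ->
    (forall u v, cls b u = cls b v -> f (emb_right u) = f (emb_right v)) ->
  forall g h, gcon a b g h -> f g = f h.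
Proof.
move=> fa fb g h /connectP[p].
elim: p g => [|k p IH] g /=; first by move=> _ ->.
case/andP=> /pgP gk pth lst; rewrite -(IH _ pth lst).
by case: gk => -[u [v [-> -> e]]]; [apply: fa|apply: fb].
Qed.

Lemma cls_pmul a b u v :
  cls (pmul a b) u = cls (pmul a b) v <-> gcon a b (emb_outer u) (emb_outer v).
Proof.
rewrite /cls cls_equivalence_partition // => x y z _ _ _.
exact: (gcon_equiv a b (emb_outer x)).
Qed.

Lemma Phi0 a b :
  Phi a b == 0 <->
  forall z : 'I_n, exists u, gcon a b (inl (inr z)) (emb_outer u).
Proof.
pose C (g : gvertex n) := [set h in [set: gvertex n] | gcon a b g h].
rewrite cards_eq0; split=> [/eqP/setP e0 z | H].
  have := e0 (C (inl (inr z))); rewrite !inE imset_f ?inE //=.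
  move/negbT/subsetPn => [] [[x|x]|x]; rewrite !inE => czx notmid.
  - by exists (inl x).
  - by case/imsetP: notmid; exists x.
  - by exists (inr x).
apply/eqP/setP => D; rewrite !inE; apply/negbTE/negP => /andP[/imsetP[g _ ->]].
move/subsetP => sub.
have /imsetP[z _ eg] : g \in middle n by apply: sub; rewrite !inE /= connect0.
have [u zu] := H z; have /imsetP[w _] : emb_outer u \in middle n.
  by apply: sub; rewrite !inE /= eg.
by case: u {zu}.
Qed.

Definition jrel c a : rel (vertex n) := fun u v =>
  (cls c u == cls c v) ||
  (if (u, v) is (inr x, inr y) then up a x == up a y else false).

(** The join of [c] with the upper kernel of [a] read on the lower vertices of [c],
   i.e. the part of the product graph above the lower row: it depends on [a] only
   through its upper kernel. *)
Definition jc c a v : {set vertex n} := [set w | connect (jrel c a) v w].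

Lemma jrel_sym c a : symmetric (jrel c a).
Proof.
by move=> [u|u] [v|v]; rewrite /jrel eq_sym //; congr (_ || _); rewrite eq_sym.
Qed.

Lemma jcP c a u v : jc c a u = jc c a v <-> connect (jrel c a) u v.
Proof.
split=> [/setP/(_ v)|uv]; first by rewrite !inE connect0 => ->.
apply/setP=> w; rewrite !inE.
by apply: (same_connect (sym_connect_sym (jrel_sym c a)) uv).
Qed.

Lemma jc_cls c a u v : cls c u = cls c v -> jc c a u = jc c a v.
Proof. by move=> e; apply/jcP/connect1; rewrite /jrel e eqxx. Qed.

Lemma jc_up c a x y : up a x = up a y -> jc c a (inr x) = jc c a (inr y).
Proof. by move=> e; apply/jcP/connect1; rewrite /jrel e eqxx orbT. Qed.

Lemma jc_min c a (L : Type) (f : vertex n -> L) :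
    (forall u v, cls c u = cls c v -> f u = f v) ->
    (forall x y, up a x = up a y -> f (inr x) = f (inr y)) ->
  forall u v, jc c a u = jc c a v -> f u = f v.
Proof.
move=> fc fa u v /jcP/connectP[p].
elim: p u => [|w p IH] u /=; first by move=> _ ->.
case/andP=> /orP e pth lst; rewrite -(IH _ pth lst).
by case: e => [/eqP/fc//|]; case: u w {pth lst} => [x|x] [y|y] // /eqP/fa.
Qed.

Lemma eq_jc c a b u v : (forall x y, up a x = up a y <-> up b x = up b y) ->
  jc c a u = jc c a v <-> jc c b u = jc c b v.
Proof.
move=> e; split; apply: jc_min => *; by [apply: jc_cls|apply/jc_up/e].
Qed.

Lemma jc_gcon c a u v :
  jc c a u = jc c a v -> gcon c a (emb_left u) (emb_left v).
Proof.
case/jcP/connectP=> p; elim: p u => [|w p IH] u /=.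
  by move=> _ ->; apply: connect0.
case/andP=> /orP e pth lst; apply: gcon_trans (IH _ pth lst).
case: e => [/eqP|]; first exact: gcon_left.
by case: u w {pth lst} => [x|x] [y|y] // /eqP; apply: (@gcon_right _ _ (inl x) (inl y)).
Qed.

(** An invariant of the components of the product graph: a lower vertex lying in a
   transversal of [a] takes the label of the upper part of that transversal. The
   choice of [z] is immaterial, see [glab_ul]. *)
Definition glab c a (g : gvertex n) : {set vertex n} + {set vertex n} :=
  match g with
  | inl v => inl (jc c a v)
  | inr y => if [pick z | up a z == lo a y] is Some z
             then inl (jc c a (inr z)) else inr (lo a y)
  end.

Lemma glab_ul c a z y : up a z = lo a y -> glab c a (inr y) = inl (jc c a (inr z)).
Proof.
move=> e /=; case: pickP => [w /eqP e'|/(_ z)]; last by rewrite e eqxx.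
by congr inl; apply: jc_up; rewrite e.
Qed.

Lemma gcon_glab c a g h : gcon c a g h -> glab c a g = glab c a h.
Proof.
apply: gcon_min => [u v e | [x|x] [y|y] e].
- by rewrite /glab /=; congr inl; apply: jc_cls.
- by congr inl; apply: jc_up.
- exact/esym/glab_ul.
- exact/glab_ul/esym.
by rewrite /glab /= [lo a x]e.
Qed.

Section Left.
Variables c a : part n.
Let p := pmul c a.

Lemma pmul_up x y : up p x = up p y <-> jc c a (inl x) = jc c a (inl y).
Proof.
rewrite cls_pmul; split; first by move/gcon_glab => -[].
exact: (@jc_gcon _ _ (inl x) (inl y)).
Qed.

Lemma pmul_ul x y :
  up p x = lo p y <-> exists2 z, jc c a (inl x) = jc c a (inr z) & up a z = lo a y.
Proof.
rewrite cls_pmul; split.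
  move/gcon_glab => /=; case: pickP => // z /eqP e [e'].
  by exists z.
case=> z /jc_gcon xz zy; apply: gcon_trans xz _.
exact: (@gcon_right c a (inl z) (inr y)).
Qed.

Lemma pmul_lo x y :
  lo p x = lo p y <-> lo a x = lo a y \/
    exists z w, [/\ up a z = lo a x, up a w = lo a y
                  & jc c a (inr z) = jc c a (inr w)].
Proof.
rewrite cls_pmul; split.
  move/gcon_glab => /=; case: pickP => [z /eqP zx|_]; case: pickP => [w /eqP wy|_] //.
    by case=> e; right; exists z, w.
  by case=> e; left.
case; first exact: (@gcon_right c a (inr x) (inr y)).
case=> z [w [zx wy /jc_gcon zw]].
apply: gcon_trans (@gcon_right c a (inr x) (inl z) (esym zx)) _.
apply: gcon_trans zw _.
exact: (@gcon_right c a (inl w) (inr y)).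
Qed.

Lemma Phi0_left :
  Phi c a == 0 <->
  forall z, (exists x, jc c a (inr z) = jc c a (inl x)) \/
            (exists w y, jc c a (inr z) = jc c a (inr w) /\ up a w = lo a y).
Proof.
rewrite Phi0; split=> H z.
  have [[x|y] /gcon_glab /=] := H z; first by case; left; exists x.
  by case: pickP => // w /eqP wy [e]; right; exists w, y.
case: (H z) => [[x /jc_gcon zx]|[w [y [/jc_gcon zw wy]]]]; first by exists (inl x).
exists (inr y); apply: gcon_trans zw _.
exact: (@gcon_right c a (inl w) (inr y)).
Qed.

End Left.

End ProductFormula.

(** * The involution turning partitions upside down *)

Section Flip.
Variable n : nat.
Implicit Types (a b c : part n) (u v : vertex n).

Definition swap v : vertex n := match v with inl x => inr x | inr x => inl x end.

(** An anti-automorphism of the monoid that respects [Phi]: what is proved for left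
   factors holds for right factors. *)
Definition flip a : part n := of_lab (fun v => cls a (swap v)).

Lemma cls_flip a u v :
  cls (flip a) u = cls (flip a) v <-> cls a (swap u) = cls a (swap v).
Proof. exact: cls_of_lab. Qed.

Lemma up_flip a x y : up (flip a) x = up (flip a) y <-> lo a x = lo a y.
Proof. exact: cls_flip. Qed.

Lemma lo_flip a x y : lo (flip a) x = lo (flip a) y <-> up a x = up a y.
Proof. exact: cls_flip. Qed.

Lemma ul_flip a x y : up (flip a) x = lo (flip a) y <-> up a y = lo a x.
Proof. by rewrite cls_flip /=; split=> /esym. Qed.

Lemma flipK : involutive flip.
Proof. by move=> a; apply: part_ext => -[x|x] [y|y]; rewrite !cls_flip. Qed.

Definition gswap (g : gvertex n) : gvertex n :=
  match g with
  | inl (inl x) => inr x | inl (inr x) => inl (inr x) | inr x => inl (inl x)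
  end.

Lemma gswapK : involutive gswap. Proof. by case=> [[x|x]|x]. Qed.

Lemma gcon_flip a b g h : gcon (flip b) (flip a) (gswap g) (gswap h) = gcon a b g h.
Proof.
have sub a' b' g' h' : gcon a' b' g' h' -> gcon (flip b') (flip a') (gswap g') (gswap h').
  case/connectP=> p; elim: p g' => [|w p IH] g' /=.
    by move=> _ ->; apply: connect0.
  case/andP=> /pgP e pth lst; apply: gcon_trans (IH _ pth lst).
  case: e => -[u [v [-> -> e]]]; [case: u v e => u [] v e|case: u v e => u [] v e].
  - exact/(@gcon_right _ _ _ (inr _) (inr _))/lo_flip.
  - exact/(@gcon_right _ _ _ (inr _) (inl _))/cls_flip.
  - exact/(@gcon_right _ _ _ (inl _) (inr _))/cls_flip.
  - exact/(@gcon_right _ _ _ (inl _) (inl _))/cls_flip.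
  - exact/(@gcon_left _ _ _ (inr _) (inr _))/lo_flip.
  - exact/(@gcon_left _ _ _ (inr _) (inl _))/cls_flip.
  - exact/(@gcon_left _ _ _ (inl _) (inr _))/cls_flip.
  - exact/(@gcon_left _ _ _ (inl _) (inl _))/cls_flip.
apply/idP/idP; last exact: sub.
by move/sub; rewrite !gswapK !flipK.
Qed.

Lemma pmul_flip a b : pmul (flip b) (flip a) = flip (pmul a b).
Proof.
apply: part_ext => u v; rewrite cls_flip !cls_pmul -gcon_flip !flipK.
by case: u v => u [] v.
Qed.

Lemma Phi_flip a b : (Phi (flip b) (flip a) == 0) = (Phi a b == 0).
Proof.
have sub a' b' : Phi a' b' == 0 -> Phi (flip b') (flip a') == 0.
  move/Phi0 => H; apply/Phi0 => z; have [u zu] := H z.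
  exists (swap u); move: zu; rewrite -gcon_flip /=.
  by case: u.
by apply/idP/idP; [move/sub; rewrite !flipK|exact: sub].
Qed.

Definition tflip : tpart n -> tpart n := omap flip.

Lemma tflipK : involutive tflip. Proof. by case=> //= a; rewrite flipK. Qed.

Lemma tmul_flip (x y : tpart n) : tmul (tflip y) (tflip x) = tflip (tmul x y).
Proof.
case: x y => [a|] [b|] //=; rewrite Phi_flip pmul_flip.
by case: ifP.
Qed.

End Flip.

(** * Rank and systems of representatives of the transversals *)

Section Rank.
Variable n : nat.
Implicit Types (a b c : part n) (u v : vertex n).

Definition udom a x := [exists y, up a x == lo a y].

Lemma udomP a x : reflect (exists y, up a x = lo a y) (udom a x).
Proof. by apply: (iffP existsP) => -[y /eqP]; exists y => //; apply/eqP. Qed.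

Lemma dom_ul a x y : up a x = lo a y -> udom a x.
Proof. by move=> e; apply/udomP; exists y. Qed.

Lemma dom_up a x y : up a x = up a y -> udom a x = udom a y.
Proof. by move=> e; apply/udomP/udomP => -[z]; rewrite ?e; exists z; rewrite ?e. Qed.

Lemma cod_ul a x y : up a x = lo a y -> udom (flip a) y.
Proof. by move=> e; apply/udomP; exists x; apply/ul_flip. Qed.

Lemma codP a y : reflect (exists x, up a x = lo a y) (udom (flip a) y).
Proof. by apply: (iffP (udomP _ _)) => -[x /ul_flip e]; exists x. Qed.

Lemma cod_lo a x y : lo a x = lo a y -> udom (flip a) x = udom (flip a) y.
Proof. by move=> e; apply/codP/codP => -[z]; rewrite ?e; exists z; rewrite ?e. Qed.

Lemma transversalsE a : transversals a = [set up a x | x in udom a].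
Proof.
have /and3P[/eqP cov ti _] := blocksP a.
apply/setP=> A; rewrite !inE; apply/andP/imsetP.
  case=> aA /andP[/set0Pn[u /setIP[uA /imsetP[x _ eu]]] /set0Pn[v /setIP[vA /imsetP[y _ ev]]]].
  exists x; last by rewrite /up /cls (def_pblock ti aA) // -eu.
  by apply: (@dom_ul _ _ y); rewrite /up /lo /cls !(def_pblock ti aA) -?eu -?ev.
case=> x /udomP[y e] ->; rewrite /up /cls pblock_mem ?cov ?inE //; split=> //.
rewrite -/(cls a (inl x)); apply/andP; split; apply/set0Pn.
  by exists (inl x); rewrite inE mem_cls eqxx (imset_f inl).
by exists (inr y); rewrite inE mem_cls (imset_f inr) // andbT; apply/eqP.
Qed.

Lemma rank_ge a k (x : 'I_k -> 'I_n) :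
    (forall i, udom a (x i)) -> (forall i j, up a (x i) = up a (x j) -> i = j) ->
  k <= rank a.
Proof.
move=> dx injx; rewrite /rank transversalsE -[k]card_ord.
rewrite -(card_imset (f := fun i => up a (x i)) 'I_k) //.
apply/subset_leq_card/subsetP => A /imsetP[i _ ->].
exact: imset_f (dx i).
Qed.

Lemma rank_le a k (x : 'I_k -> 'I_n) :
  (forall z, udom a z -> exists i, up a z = up a (x i)) -> rank a <= k.
Proof.
move=> cov; rewrite /rank transversalsE.
apply: leq_trans (subset_leq_card (B := [set up a (x i) | i : 'I_k]) _) _.
  by apply/subsetP=> A /imsetP[z /cov[i ->] ->]; apply: (imset_f (fun i => up a (x i))).
by rewrite (leq_trans (leq_imset_card _ _)) // card_ord.
Qed.

(** Ranks are computed by producing such representatives of the transversals, so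
   that blocks never have to be counted. *)
Definition reps a k (x y : 'I_k -> 'I_n) :=
  [/\ forall i, up a (x i) = lo a (y i),
      forall i j, up a (x i) = up a (x j) -> i = j
    & forall z, udom a z -> exists i, up a z = up a (x i)].

Lemma reps_rank a k (x y : 'I_k -> 'I_n) : reps a x y -> rank a = k.
Proof.
case=> xy inj cov; apply/eqP; rewrite eqn_leq (rank_le cov) (rank_ge _ inj) // => i.
exact: dom_ul (xy i).
Qed.

Lemma reps_ex a k : rank a = k -> exists x y : 'I_k -> 'I_n, reps a x y.
Proof.
move=> <-; set T := transversals a.
have /fin_all_exists[x xP] (i : 'I_#|T|) : exists x, udom a x /\ enum_val i = up a x.
  by have := enum_valP i; rewrite {2}/T transversalsE => /imsetP[x]; exists x.
have /fin_all_exists[y yP] (i : 'I_#|T|) : exists y, up a (x i) = lo a y.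
  by apply/udomP; case: (xP i).
exists x, y; split=> // [i j e|z dz].
  by apply: enum_val_inj; case: (xP i) => _ ->; case: (xP j) => _ ->.
have Tz : up a z \in T by rewrite /T transversalsE (imset_f (up a)).
by exists (enum_rank_in Tz (up a z)); case: (xP (enum_rank_in Tz (up a z))) => _ <-; rewrite enum_rankK_in.
Qed.

Lemma reps_flip a k (x y : 'I_k -> 'I_n) : reps a x y -> reps (flip a) y x.
Proof.
case=> xy inj cov; split=> [i|i j|z /codP[w wz]].
- exact/ul_flip.
- by rewrite up_flip -!xy; apply: inj.
have [i e] := cov w (dom_ul wz).
by exists i; apply/up_flip; rewrite -wz e xy.
Qed.

Lemma rank_flip a : rank (flip a) = rank a.
Proof. by have [x [y /reps_flip/reps_rank]] := reps_ex (erefl (rank a)). Qed.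

Lemma rank0P a : rank a = 0 <-> forall x y, up a x <> lo a y.
Proof.
split=> [r0 x y e|H].
  have [w [z [_ _ cov]]] := reps_ex r0.
  by have [[]] := cov x (dom_ul e).
apply/eqP; rewrite cards_eq0 transversalsE; apply/eqP/setP=> A; rewrite inE.
by apply/imsetP=> -[x /udomP[y /H]].
Qed.

Lemma rank_gt0 a x y : up a x = lo a y -> 0 < rank a.
Proof. by rewrite lt0n => e; apply/eqP => /rank0P/(_ x y). Qed.

Lemma rank_gt0P a : 0 < rank a <-> exists x y, up a x = lo a y.
Proof.
split=> [r0|[x [y]]]; last exact: rank_gt0.
have [x [y [xy _ _]]] := reps_ex (erefl (rank a)).
by exists (x (Ordinal r0)), (y (Ordinal r0)).
Qed.

Lemma rank_le1 a x y x' y' :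
  rank a <= 1 -> up a x = lo a y -> up a x' = lo a y' -> up a x = up a x'.
Proof.
move=> r1 e e'; have [s [t [_ _ cov]]] := reps_ex (erefl (rank a)).
have [[i Hi] ->] := cov x (dom_ul e); have [[j Hj] ->] := cov x' (dom_ul e').
congr (up a (s _)); apply: ord_inj => /=.
by case: (rank a) r1 Hi Hj => [|[|]] //; case: i j => [|i] [|j].
Qed.

Lemma rank_leqn a : rank a <= n.
Proof. by apply: (@rank_le a n id) => z _; exists z. Qed.

Lemma rank_pmull c a : rank (pmul c a) <= rank a.
Proof.
have [x [y [xy inj _]]] := reps_ex (erefl (rank (pmul c a))).
have /fin_all_exists[z zP] i : exists z, up a z = lo a (y i).
  by have /pmul_ul[z] := xy i; exists z.
apply: (@rank_ge _ _ z) => [i|i j e]; first exact: dom_ul (zP i).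
by apply: inj; rewrite !xy; apply/pmul_lo; left; rewrite -!zP.
Qed.

(** Each transversal of a product uses up at least one transversal of [a]. If the
   rank is kept, none can get lost or be merged with another: all of them are
   prolonged to the top, in distinct blocks. *)
Lemma reps_pmull c a k (x y : 'I_k -> 'I_n) :
    reps a x y -> rank (pmul c a) = k ->
  [/\ forall i, exists w, jc c a (inl w) = jc c a (inr (x i))
    & forall i j, jc c a (inr (x i)) = jc c a (inr (x j)) -> i = j].
Proof.
case=> [xy inj cov] /reps_ex[x' [y' [xy' inj' cov']]].
have /fin_all_exists[f fP] i : exists j,
    jc c a (inl (x' i)) = jc c a (inr (x j)) /\ lo a (y' i) = lo a (y j).
  have /pmul_ul[z ez zy] := xy' i; have [j e] := cov z (dom_ul zy).
  by exists j; rewrite ez -zy e xy; split=> //; apply: jc_up.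
have injf : injective f.
  move=> i j e; apply: inj'; rewrite !xy'; apply/pmul_lo; left.
  by case: (fP i) (fP j) => _ -> [_ ->]; rewrite e.
have fK := f_finv injf; split=> [i|i j e].
  by exists (x' (finv f i)); case: (fP (finv f i)) => -> _; rewrite fK.
rewrite -[i]fK -[j]fK; congr f; apply: inj'; apply/pmul_up.
by case: (fP (finv f i)) (fP (finv f j)) => -> _ [-> _]; rewrite !fK.
Qed.

End Rank.

(** * Moving one partition into another *)

Section Transfer.
Variable n : nat.
Implicit Types (a b c g : part n) (X Y : tpart n).

Lemma tmul_some c a : Phi c a == 0 -> tmul (Some c) (Some a) = Some (pmul c a).
Proof. by move=> /= ->. Qed.

Lemma tmul_none c a : Phi c a != 0 -> tmul (Some c) (Some a) = None.
Proof. by move=> /= /negbTE ->. Qed.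

Lemma tmul_rflip X c : tmul X (Some (flip c)) = tflip (tmul (Some c) (tflip X)).
Proof. by rewrite -tmul_flip tflipK. Qed.

(** If the lower kernel of [c] is coarser than the upper kernel of [a], gluing [a]
   below [c] adds nothing to the blocks of [c]. *)
Lemma jc_absorb c a u v :
    (forall x y, up a x = up a y -> lo c x = lo c y) ->
  jc c a u = jc c a v <-> cls c u = cls c v.
Proof.
by move=> abs; split; [apply: jc_min|apply: jc_cls].
Qed.

(** The upper row keeps the kernel of [g], and the lower vertex [z] hangs from the
   upper vertex [phi z]. Every lower vertex being attached to an upper one,
   this left factor never creates floating components. *)
Definition hang g (phi : 'I_n -> 'I_n) : part n :=
  of_lab (fun v => match v with inl x => up g x | inr z => up g (phi z) end).

Lemma hang_ext g g' phi : (forall x y, up g x = up g y <-> up g' x = up g' y) ->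
  hang g phi = hang g' phi.
Proof.
by move=> e; apply: part_ext => -[x|x] [y|y]; rewrite !cls_of_lab.
Qed.

Section Hang.
Variables (g a : part n) (phi : 'I_n -> 'I_n).
Hypothesis phi_up : forall z w, up a z = up a w -> up g (phi z) = up g (phi w).
Let p := pmul (hang g phi) a.

Let abs u v : jc (hang g phi) a u = jc (hang g phi) a v <->
  cls (hang g phi) u = cls (hang g phi) v.
Proof. by apply: jc_absorb => z w /phi_up e; apply/cls_of_lab. Qed.

Lemma hang_mul : tmul (Some (hang g phi)) (Some a) = Some p.
Proof.
apply/tmul_some/Phi0_left => z; left; exists (phi z).
exact/abs/cls_of_lab.
Qed.

Lemma hang_up x y : up p x = up p y <-> up g x = up g y.
Proof. by rewrite pmul_up abs cls_of_lab. Qed.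

Lemma hang_ul x y :
  up p x = lo p y <-> exists2 z, up g x = up g (phi z) & up a z = lo a y.
Proof.
rewrite pmul_ul; split=> -[z e zy]; exists z => //.
  by move: e; rewrite abs cls_of_lab.
exact/abs/cls_of_lab.
Qed.

Lemma hang_lo x y : lo p x = lo p y <-> lo a x = lo a y \/
  exists z w, [/\ up a z = lo a x, up a w = lo a y & up g (phi z) = up g (phi w)].
Proof.
rewrite pmul_lo; split=> -[|[z [w [zx wy e]]]]; first by left.
- by right; exists z, w; split=> //; move: e; rewrite abs cls_of_lab.
- by left.
by right; exists z, w; split=> //; apply/abs/cls_of_lab.
Qed.

End Hang.

(** What a map of vertices has to satisfy for [a] to be multiplied into [g] along
   it. *)
Definition morph a g (phi psi : 'I_n -> 'I_n) :=
  [/\ forall z w, up a z = up a w -> up g (phi z) = up g (phi w),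
      forall z w, lo a z = lo a w -> lo g (psi z) = lo g (psi w),
      forall z w, up a z = lo a w -> up g (phi z) = lo g (psi w)
    & forall x, udom g x -> exists2 z, udom a z & up g x = up g (phi z)].

(** The left factor installs the upper kernel of [g], the right one its lower
   kernel, and the transversals of [a] provide those of [g]. Since the factors see
   only the kernels of [g], the same ones serve for every partition with
   these kernels: pairs can be moved simultaneously. *)
Lemma morph_mul a g phi psi : morph a g phi psi ->
  tmul (tmul (Some (hang g phi)) (Some a)) (Some (flip (hang (flip g) psi))) = Some g.
Proof.
case=> uu ll ul sur; rewrite (hang_mul uu) tmul_rflip.
set p := pmul _ a; rewrite -[tflip (Some p)]/(Some (flip p)).
have pl z w : lo p z = lo p w -> lo g (psi z) = lo g (psi w).
  case/(hang_lo uu) => [/ll//|[s [t [/ul sz /ul tw e]]]].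
  by rewrite -sz -tw.
have pl' z w : up (flip p) z = up (flip p) w -> up (flip g) (psi z) = up (flip g) (psi w).
  by move/up_flip/pl => ?; apply/up_flip.
rewrite (hang_mul pl') /=; congr Some; apply: part_ext3 => x y.
- rewrite up_flip (hang_lo pl') lo_flip (hang_up uu).
  split=> [[//|[z [w [/ul_flip zx /ul_flip wy /up_flip e]]]]|e]; last by left.
  case/(hang_ul uu): zx => s -> /ul ->; case/(hang_ul uu): wy => t -> /ul ->.
  by rewrite e.
- rewrite ul_flip (hang_ul pl'); split.
    by case=> z /up_flip yz /ul_flip/(hang_ul uu)[s -> /ul ->].
  move=> e; have [z /udomP[w zw] xz] := sur x (dom_ul e).
  exists w; first by apply/up_flip; rewrite -e xz; apply: ul.
  by apply/ul_flip/(hang_ul uu); exists z.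
by rewrite lo_flip (hang_up pl') up_flip.
Qed.

(** Zero has rank -oo, hence lies below every rank. *)
Definition low r X := if X is Some a then rank a < r else true.

Lemma low_flip r X : low r (tflip X) = low r X.
Proof. by case: X => //= a; rewrite rank_flip. Qed.

Lemma low_mull r X Y : low r X -> low r (tmul Y X).
Proof.
case: X Y => [a|] [c|] //=; case: ifP => //= _.
exact/leq_ltn_trans/rank_pmull.
Qed.

Lemma low_mulr r X Y : low r X -> low r (tmul X Y).
Proof. by rewrite -low_flip -[low r (tmul _ _)]low_flip -tmul_flip => /low_mull. Qed.

Lemma lowW r s X : r <= s -> low r X -> low s X.
Proof. by case: X => //= a rs ra; apply: leq_trans rs. Qed.

Lemma ReesE q X Y : ((X, Y) \in Rees n (Some q)) = (X == Y) || low q.+1 X && low q.+1 Y.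
Proof. by rewrite inE /=; case: X Y => [a|] [b|]. Qed.

End Transfer.

(** * Green's relations, splitting and [nu] through kernels and domains *)

Section Patterns.
Variable n : nat.
Implicit Types (a b c d : part n).

Definition upK a b := forall x y, up a x = up a y <-> up b x = up b y.
Definition loK a b := forall x y, lo a x = lo a y <-> lo b x = lo b y.

Lemma upK_flip a b : upK (flip a) (flip b) <-> loK a b.
Proof. by split=> H x y; have := H x y; rewrite !up_flip. Qed.

Lemma loK_flip a b : loK (flip a) (flip b) <-> upK a b.
Proof. by split=> H x y; have := H x y; rewrite !lo_flip. Qed.

Lemma upK_sym a b : upK a b -> upK b a. Proof. by move=> H x y; split=> /H. Qed.
Lemma loK_sym a b : loK a b -> loK b a. Proof. by move=> H x y; split=> /H. Qed.
Lemma upK_trans b a c : upK a b -> upK b c -> upK a c.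
Proof. by move=> H1 H2 x y; rewrite H1. Qed.
Lemma loK_trans b a c : loK a b -> loK b c -> loK a c.
Proof. by move=> H1 H2 x y; rewrite H1. Qed.

(** A left factor reaches the lower row of [b] only through the transversals of
   [b]: it can merge or detach lower ends of transversals, and nothing else.
   Conversely any such change is achieved by hanging the lower ends of the
   transversals of [b] from the blocks that [d] prescribes. *)
Lemma left_idealP b d : (exists c, d = pmul c b) <->
  [/\ forall x y, lo b x = lo b y -> lo d x = lo d y,
      forall x y, lo d x = lo d y ->
        lo b x = lo b y \/ udom (flip b) x /\ udom (flip b) y
    & forall y, udom (flip d) y -> udom (flip b) y].
Proof.
split=> [[c ->]|[lobd lodb cod]].
  split=> [x y e|x y|y /codP[x /pmul_ul[z _ /cod_ul //]]].
    by apply/pmul_lo; left.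
  case/pmul_lo; first by left.
  by case=> z [w [/cod_ul zx /cod_ul wy _]]; right.
(* Outside the domain of [b] any value constant on blocks will do. *)
pose f (v : vertex n) := match v with
  | inl x => up d x
  | inr z => if [pick y | up b z == lo b y] is Some y then lo d y else set0
  end.
have fE z y : up b z = lo b y -> f (inr z) = lo d y.
  move=> e /=; case: pickP => [w /eqP e'|/(_ y)]; last by rewrite e eqxx.
  by apply: lobd; rewrite -e'.
have abs u v : jc (of_lab f) b u = jc (of_lab f) b v <-> f u = f v.
  rewrite jc_absorb ?cls_of_lab // => x y e; apply/cls_of_lab.
  have [/udomP[w yw]|nd] := boolP (udom b y).
    by rewrite (fE _ _ yw); apply: fE; rewrite e.
  have nul z : ~~ udom b z -> f (inr z) = set0.
    move=> nz /=; case: pickP => // w /eqP e'.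
    by rewrite (dom_ul e') in nz.
  by rewrite !nul // (dom_up e).
exists (of_lab f); apply: part_ext3 => x y.
- by rewrite pmul_up abs.
- rewrite pmul_ul; split=> [e|[z /abs e /fE zy]]; last by rewrite -zy.
  have /codP[z zy] : udom (flip b) y by apply: cod; apply: cod_ul e.
  by exists z => //; apply/abs; rewrite (fE _ _ zy).
rewrite pmul_lo; split=> [/[dup] e /lodb[|[/codP[z zx] /codP[w wy]]]|]; first by left.
  by right; exists z, w; split=> //; apply/abs; rewrite (fE _ _ zx) (fE _ _ wy).
by case=> [/lobd//|[z [w [/fE zx /fE wy /abs]]]]; rewrite zx wy.
Qed.

Lemma greenLP a b : greenL a b <-> loK a b /\ udom (flip a) =1 udom (flip b).
Proof.
split=> [/eqP/setP H|[lk dk]].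
  have sub a' b' : (forall d, (exists c, d = pmul c a') -> exists c, d = pmul c b') ->
     (forall x y, lo b' x = lo b' y -> lo a' x = lo a' y) /\
     (forall y, udom (flip a') y -> udom (flip b') y).
    have /left_idealP aa : [/\ forall x y, lo a' x = lo a' y -> lo a' x = lo a' y,
      forall x y, lo a' x = lo a' y ->
        lo a' x = lo a' y \/ udom (flip a') x /\ udom (flip a') y
    & forall y, udom (flip a') y -> udom (flip a') y] by split=> //; left.
    by move/(_ _ aa)/left_idealP => [].
  have memP a' d : (exists c, d = pmul c a') <-> d \in [set pmul c a' | c : part n].
    by split=> [[c ->]|/imsetP[c _ ->]]; [apply: (imset_f (fun c => pmul c a'))|exists c].
  have [|ab1 ab2] := sub a b; first by move=> d /memP; rewrite H => /memP.
  have [|ba1 ba2] := sub b a; first by move=> d /memP; rewrite -H => /memP.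
  split=> [x y|y]; first by split; [apply: ba1|apply: ab1].
  by apply/idP/idP; [apply: ab2|apply: ba2].
apply/eqP/setP=> d; apply/imsetP/imsetP => -[c _ ->].
  have /left_idealP[H1 H2 H3] : exists c', pmul c a = pmul c' a by exists c.
  have [c' ->] : exists c', pmul c a = pmul c' b; last by exists c'.
  apply/left_idealP; split=> [x y /lk/H1//|x y /H2|y /H3]; rewrite ?dk //.
  by case=> [/lk|]; [left|right].
have /left_idealP[H1 H2 H3] : exists c', pmul c b = pmul c' b by exists c.
have [c' ->] : exists c', pmul c b = pmul c' a; last by exists c'.
apply/left_idealP; split=> [x y /lk/H1//|x y /H2|y /H3]; rewrite -?dk //.
by case=> [/lk|]; [left|right].
Qed.

Lemma greenR_flip a b : greenR a b = greenL (flip a) (flip b).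
Proof.
have imE a' : [set pmul a' c | c : part n] = @flip n @: [set pmul c (flip a') | c : part n].
  apply/setP=> d; apply/imsetP/imsetP => [[c _ ->]|[e /imsetP[c _ ->] ->]].
    exists (pmul (flip c) (flip a')); last by rewrite pmul_flip flipK.
    exact: (imset_f (fun c => pmul c _)).
  by exists (flip c) => //; rewrite -pmul_flip flipK.
rewrite /greenR (imE a) (imE b); apply/eqP/eqP => [|e]; last by rewrite e.
exact: (imset_inj (inv_inj (@flipK n))).
Qed.

Lemma greenRP a b : greenR a b <-> upK a b /\ udom a =1 udom b.
Proof. by rewrite greenR_flip greenLP loK_flip !flipK. Qed.

Definition side (v : vertex n) := if v is inl _ then true else false.

Lemma cls_hat a u v :
  cls (hat a) u = cls (hat a) v <-> cls a u = cls a v /\ side u = side v.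
Proof.
have /and3P[/eqP cov ti _] := blocksP a.
have /and3P[/eqP hcov hti _] := blocksP (hat a).
have sideE w : (w \in upper n) = side w /\ (w \in lower n) = ~~ side w.
  by case: w => x; split=> //=; first [exact: (imset_f inl) | exact: (imset_f inr)
     | apply/imsetP=> -[]].
have clsE w : cls (hat a) w = cls a w :&: [set w' | side w' == side w].
  apply: def_pblock => //; last by rewrite !inE mem_cls !eqxx.
  apply/bigcupP; exists (cls a w); first by rewrite pblock_mem // cov inE.
  have sidI : cls a w :&: [set w' | side w' == side w] =
     cls a w :&: if side w then upper n else lower n.
    apply/setP=> w'; rewrite !inE; case: (sideE w') => eu el.
    by case: (side w); rewrite ?eu ?el; case: (side w').
  rewrite sidI /split_block; have [_|] := boolP (Defs.transversal _).
    by case: (side w); rewrite !inE eqxx ?orbT.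
  rewrite /Defs.transversal negb_and !negbK inE => nt.
  rewrite eq_sym; apply/eqP/esym/setIidPl/subsetP=> w' ww'.
  case: (sideE w') (sideE w) => eu el [eu' el'].
  by case/orP: nt => /eqP/setP e; move: (e w) (e w'); case: (side w) in eu' el' *;
    rewrite !inE ww' mem_cls eqxx /= ?eu ?el ?eu' ?el' //; case: (side w').
rewrite !clsE; split=> [/setP/(_ v)|[-> ->]] //.
by rewrite !inE !mem_cls !eqxx /= => /andP[/eqP-> /eqP->].
Qed.

Lemma hatP a b : hat a = hat b <-> upK a b /\ loK a b.
Proof.
split=> [e|[uk lk]].
  split=> x y; have := cls_hat a; have := cls_hat b; rewrite e => Hb Ha.
    have := Ha (inl x) (inl y); rewrite Hb /= => -[H1 H2].
    by split=> h; [case: H2|case: H1].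
  have := Ha (inr x) (inr y); rewrite Hb /= => -[H1 H2].
  by split=> h; [case: H2|case: H1].
apply: part_ext => u v; rewrite !cls_hat.
by case: u v => [x|x] [y|y] /=; split=> -[e sd] //; split=> //; [exact/uk|exact/uk|exact/lk|exact/lk].
Qed.

(** Fixing representatives of the transversals of [a] replaces the labelled blocks
   in the definition of the difference permutation, so that the effect of a
   product can be followed vertex by vertex. *)
Definition twisted q (s : 'S_q) a b (x y : 'I_q -> 'I_n) :=
  reps a x y /\ forall i, up b (x i) = lo b (y (s i)).

Definition same_pattern a b :=
  [/\ upK a b, loK a b, udom a =1 udom b & udom (flip a) =1 udom (flip b)].

Lemma same_patternP a b : greenH a b <-> same_pattern a b.
Proof.
rewrite /greenH; split=> [/andP[/greenRP[uk du] /greenLP[lk dl]]|[uk lk du dl]].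
  by split.
apply/andP; split.
  exact/greenRP.
exact/greenLP.
Qed.

Lemma same_pattern_sym a b : same_pattern a b -> same_pattern b a.
Proof.
by case=> uk lk d d'; split; [exact: upK_sym|exact: loK_sym|move=> x; rewrite d|move=> x; rewrite d'].
Qed.

Lemma same_pattern_trans b a c : same_pattern a b -> same_pattern b c -> same_pattern a c.
Proof.
case=> uk lk d d' [uk2 lk2 d2 d2']; split.
- exact: upK_trans uk uk2.
- exact: loK_trans lk lk2.
- by move=> x; rewrite d.
- by move=> x; rewrite d'.
Qed.

Lemma same_pattern_flip a b : same_pattern a b -> same_pattern (flip a) (flip b).
Proof.
case=> uk lk d d'; split; rewrite ?flipK //; first exact/upK_flip.
exact/loK_flip.
Qed.

Lemma twisted_reps q (s : 'S_q) a b x y : same_pattern a b -> twisted s a b x y ->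
  reps b x (y \o s).
Proof.
case=> uk _ dk _ [[xy inj cov] xys]; split=> // [i j /uk/inj//|z].
by rewrite -dk => /cov[i /uk]; exists i.
Qed.

Lemma glue_inl A B (x : 'I_n) : (inl x \in glue A B) = (x \in A).
Proof.
rewrite inE; apply/orP/idP => [[|] /imsetP[y yA] //|xA]; first by case=> ->.
by left; rewrite (imset_f inl).
Qed.

Lemma glue_inr A B (x : 'I_n) : (inr x \in glue A B) = (x \in B).
Proof.
rewrite inE; apply/orP/idP => [[|] /imsetP[y yA] //|xA]; first by case=> ->.
by right; rewrite (imset_f inr).
Qed.

(** The labelled blocks are the classes of the representatives; conversely each
   labelled block, being a transversal, has an upper and a lower vertex. *)
Lemma nuP q (N : {set 'S_q}) a b :
  nu_rel N a b <->
  same_pattern a b /\ exists2 s, s \in N & exists x y, twisted s a b x y.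
Proof.
have clsT c A u : A \in transversals c -> u \in A -> cls c u = A.
  case/and3P: (blocksP c) => _ ti _.
  by rewrite inE => /andP[cA _]; apply: def_pblock.
split.
  case/and4P=> /eqP ra rb /same_patternP pab /existsP[s /andP[sN]].
  case/existsP=> A /existsP[B /andP[/eqP Ta /eqP Tb]]; split=> //; exists s => //.
  pose g i := glue (A i) (B i).
  have injg : {in 'I_q &, injective g}.
    by apply/imset_injP; rewrite -Ta card_ord; apply/eqP.
  have gT i : g i \in transversals a by rewrite Ta (imset_f g).
  have /fin_all_exists2[x xA x_] i : exists2 x, x \in A i & up a x = g i.
    have := gT i; rewrite transversalsE => /imsetP[x _ e]; exists x => //.
    by rewrite -(glue_inl _ (B i)) -/(g i) e mem_cls.
  have /fin_all_exists2[y yB y_] i : exists2 y, y \in B i & lo a y = g i.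
    have := gT i; rewrite transversalsE => /imsetP[z /udomP[y zy] e]; exists y.
      by rewrite -(glue_inr (A i)) -/(g i) e zy mem_cls.
    by rewrite -zy -e.
  exists x, y; split; last first.
    move=> i; have hT : glue (A i) (B (s i)) \in transversals b.
      by rewrite Tb (imset_f (fun i => glue (A i) (B (s i)))).
    by rewrite /up /lo !(clsT _ _ _ hT) ?glue_inl ?glue_inr.
  split=> [i|i j|z dz]; first by rewrite x_ y_.
    by rewrite !x_ => /injg; apply.
  have : up a z \in transversals a by rewrite transversalsE (imset_f (up a)).
  by rewrite Ta => /imsetP[i _ ->]; exists i; rewrite x_.
case=> pab [s sN [x [y tw]]].
have ry := twisted_reps pab tw; case: tw => rxy xys.
have [uk lk dk _] := pab.
rewrite /nu_rel (reps_rank rxy) (reps_rank ry) eqxx /=.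
apply/andP; split; first exact/same_patternP.
apply/existsP; exists s; rewrite sN /=.
apply/existsP; exists [ffun i => [set z | up a z == up a (x i)]].
apply/existsP; exists [ffun i => [set z | lo a z == lo a (y i)]].
have glueE c x' y' : upK a c -> loK a c -> up c x' = lo c y' ->
   glue [set z | up a z == up a x'] [set z | lo a z == lo a y'] = up c x'.
  move=> uk' lk' e; apply/setP=> -[z|z]; rewrite ?glue_inl ?glue_inr inE mem_cls.
    by apply/eqP/eqP => [/uk'|/esym/uk'].
  by rewrite -/(up c x') e; apply/eqP/eqP => [/lk'|/esym/lk'].
have [xy _ cov] := rxy.
apply/andP; split; apply/eqP/setP=> A; rewrite transversalsE; apply/imsetP/imsetP.
- case=> z /cov[i ->] ->; exists i => //; rewrite !ffunE (glueE a) //.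
- by case=> i _ ->; exists (x i); [exact: dom_ul (xy i)|rewrite !ffunE (glueE a)].
- have [_ _ covb] := ry.
  by case=> z /covb[i ->] ->; exists i => //; rewrite !ffunE (glueE b).
- case=> i _ ->; exists (x i); last by rewrite !ffunE (glueE b).
  exact: dom_ul (xys i).
Qed.

End Patterns.

(** * The listed relations are congruences *)

Section Congruence.
Variable n : nat.
Implicit Types (a b c d : part n) (X Y Z : tpart n) (th : {set tpart n * tpart n}).

Lemma congruenceI th :
    (forall X, (X, X) \in th) ->
    (forall X Y, (X, Y) \in th -> (Y, X) \in th) ->
    (forall X Y Z, (X, Y) \in th -> (Y, Z) \in th -> (X, Z) \in th) ->
    (forall c X Y, (X, Y) \in th -> (tmul (Some c) X, tmul (Some c) Y) \in th) ->
    (forall c X Y, (X, Y) \in th -> (tmul X (Some c), tmul Y (Some c)) \in th) ->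
  congruence (@tmul n) th.
Proof.
move=> re sy tr ml mr; split=> [X Y Z|X Y Z XY].
  split=> // XY; apply/idP/idP => [XZ|]; first exact: tr (sy _ _ XY) XZ.
  exact: tr.
have nr W : tmul W None = None :> tpart n by case: W.
case: Z => [c|]; last by rewrite !nr.
by split; [apply: ml|apply: mr].
Qed.

Section Elim.
Variable th : {set tpart n * tpart n}.
Hypothesis cth : congruence (@tmul n) th.

Lemma crefl X : (X, X) \in th. Proof. by case: cth => /(_ X X X)[]. Qed.

Lemma csym X Y : (X, Y) \in th -> (Y, X) \in th.
Proof. by case: cth => /(_ X Y X)[Xx H] _ /H <-. Qed.

Lemma ctrans X Y Z : (X, Y) \in th -> (Y, Z) \in th -> (X, Z) \in th.
Proof. by case: cth => /(_ X Y Z)[_ H] _ /H <-. Qed.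

Lemma cmull Z X Y : (X, Y) \in th -> (tmul Z X, tmul Z Y) \in th.
Proof. by case: cth => _ H /(H _ _ Z)[]. Qed.

Lemma cmulr Z X Y : (X, Y) \in th -> (tmul X Z, tmul Y Z) \in th.
Proof. by case: cth => _ H /(H _ _ Z)[]. Qed.

Lemma ctrans_zero X Y : (X, None) \in th -> (Y, None) \in th -> (X, Y) \in th.
Proof. by move=> Xz /csym; apply: ctrans. Qed.

End Elim.

Definition flips th : {set tpart n * tpart n} := [set p | (tflip p.1, tflip p.2) \in th].

Lemma flipsE th X Y : ((X, Y) \in flips th) = ((tflip X, tflip Y) \in th).
Proof. by rewrite inE. Qed.

Lemma congruence_flips th : congruence (@tmul n) th -> congruence (@tmul n) (flips th).
Proof.
move=> cth; apply: congruenceI => [X|X Y|X Y Z|c X Y|c X Y]; rewrite !flipsE.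
- exact: crefl.
- exact: csym.
- exact: ctrans.
- by rewrite -!tmul_flip => /(cmulr cth (tflip (Some c))).
- by rewrite -!tmul_flip => /(cmull cth (tflip (Some c))).
Qed.

Lemma lift_relE (r : rel (part n)) a b : ((Some a, Some b) \in lift_rel r) = r a b.
Proof. by rewrite inE. Qed.

Lemma lift_relP (r : rel (part n)) X Y :
  (X, Y) \in lift_rel r -> exists a b, [/\ X = Some a, Y = Some b & r a b].
Proof. by rewrite inE; case: X Y => [a|] [b|] // ab; exists a, b. Qed.

(** The shape of all the nontrivial congruences to be classified. *)
Definition extR q (r : rel (part n)) := Rees n (Some q) :|: lift_rel r.

Lemma extRP q (r : rel (part n)) X Y : reflect
  [\/ X = Y, low q.+1 X /\ low q.+1 Y | (X, Y) \in lift_rel r] ((X, Y) \in extR q r).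
Proof.
rewrite in_setU ReesE; apply: (iffP orP).
  case=> [/orP[/eqP->|/andP[lX lY]]|XY]; [by constructor 1|by constructor 2|by constructor 3].
case=> [->|[-> ->]|XY]; [by left; rewrite eqxx|by left; rewrite orbT|by right].
Qed.

Lemma extR_low q r X Y : low q.+1 X -> low q.+1 Y -> (X, Y) \in extR q r.
Proof. by move=> lX lY; apply/extRP; constructor 2. Qed.

(** The elements of rank at most [q] form an ideal and are identified with one
   another, so compatibility has to be checked on the pairs of [r] only. *)
Lemma extR_congruence q (r : rel (part n)) :
    (forall a b, r a b -> q < rank a) ->
    symmetric r -> transitive r ->
    (forall c a b, r a b -> (tmul (Some c) (Some a), tmul (Some c) (Some b)) \in extR q r) ->
    (forall c a b, r a b -> (tmul (Some a) (Some c), tmul (Some b) (Some c)) \in extR q r) ->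
  congruence (@tmul n) (extR q r).
Proof.
move=> supp sy tr ml mr.
have supp2 X Y : (X, Y) \in lift_rel r -> ~~ low q.+1 X /\ ~~ low q.+1 Y.
  case/lift_relP=> a [b [-> -> ab]]; rewrite /= -!leqNgt (supp _ _ ab).
  by rewrite (supp b a) // sy.
apply: congruenceI => [X|X Y|X Y Z|c X Y|c X Y].
- by apply/extRP; constructor 1.
- case/extRP=> [->|[lX lY]|/lift_relP[a [b [-> -> ab]]]]; apply/extRP.
  + by constructor 1.
  + by constructor 2.
  + by constructor 3; rewrite lift_relE sy.
- case/extRP=> [->//|[lX lY]|XY]; case/extRP=> [<-|[lY' lZ]|YZ].
  + exact: extR_low.
  + exact: extR_low.
  + by case: (supp2 _ _ YZ) => /negP.
  + by apply/extRP; constructor 3.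
  + by case: (supp2 _ _ XY) => _ /negP.
  apply/extRP; constructor 3.
  case/lift_relP: XY YZ => a [b [-> -> ab]] /lift_relP[_ [d [[<-] -> bd]]].
  by rewrite lift_relE; apply: tr ab bd.
- case/extRP=> [->|[lX lY]|/lift_relP[a [b [-> -> ab]]]]; last exact: ml.
    by apply/extRP; constructor 1.
  by apply: extR_low; apply: low_mull.
- case/extRP=> [->|[lX lY]|/lift_relP[a [b [-> -> ab]]]]; last exact: mr.
    by apply/extRP; constructor 1.
  by apply: extR_low; apply: low_mulr.
Qed.

Lemma Rees_extR q : Rees n (Some q) = extR q (fun _ _ => false).
Proof.
by apply/setP=> -[[a|] [b|]]; rewrite /extR in_setU [X in _ || X]inE orbF.
Qed.

Lemma Rees_congruence q : congruence (@tmul n) (Rees n (Some q)).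
Proof. by rewrite Rees_extR; apply: extR_congruence. Qed.

Lemma ReesNone : Rees n None = Delta n.
Proof. by apply/setP=> -[[a|] [b|]]; rewrite !inE /= ?orbF ?eqxx. Qed.

Lemma Delta_congruence : congruence (@tmul n) (Delta n).
Proof.
by apply: congruenceI => [X|X Y|X Y Z|c X Y|c X Y]; rewrite !inE //= => /eqP ->.
Qed.

(** ** Left multiples of partitions with the same upper kernel *)

Lemma dom_pmul c a x : udom (pmul c a) x <->
  exists2 z, jc c a (inl x) = jc c a (inr z) & udom a z.
Proof.
split=> [/udomP[y /pmul_ul[z e /dom_ul]]|[z e /udomP[y zy]]]; first by exists z.
by apply: (@dom_ul _ _ _ y); apply/pmul_ul; exists z.
Qed.

Lemma dom_pmul_eq c a b : upK a b -> udom a =1 udom b ->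
  udom (pmul c a) =1 udom (pmul c b).
Proof.
move=> uk dk.
have sub a' b' : upK a' b' -> udom a' =1 udom b' ->
    forall x, udom (pmul c a') x -> udom (pmul c b') x.
  move=> uk' dk' x /dom_pmul[z /(eq_jc _ _ _ uk') e dz].
  by apply/dom_pmul; exists z; rewrite -?dk'.
move=> x; apply/idP/idP; apply: sub => //; exact: upK_sym.
Qed.

Lemma upK_pmul c a b : upK a b -> upK (pmul c a) (pmul c b).
Proof. by move=> uk x y; rewrite !pmul_up; apply: eq_jc. Qed.

Lemma Phi0_same_pattern c a b : upK a b -> udom a =1 udom b ->
  Phi c a == 0 -> Phi c b == 0.
Proof.
move=> uk dk /Phi0_left H; apply/Phi0_left=> z.
have [[x /(eq_jc _ _ _ uk) e]|[w [y [/(eq_jc _ _ _ uk) e /dom_ul]]]] := H z.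
  by left; exists x.
by rewrite dk => /udomP[y' wy]; right; exists w, y'.
Qed.

Lemma cod_pmul c a y : udom (flip (pmul c a)) y -> udom (flip a) y.
Proof. by case/codP=> x /pmul_ul[z _ /cod_ul]. Qed.

Lemma lo_pmul c a x y : lo a x = lo a y -> lo (pmul c a) x = lo (pmul c a) y.
Proof. by move=> e; apply/pmul_lo; left. Qed.

(** *** The relations [nu] *)

Lemma twisted_sym q (s : 'S_q) a b x y :
  same_pattern a b -> twisted s a b x y -> twisted (s^-1)%g b a x (y \o s).
Proof.
move=> pab tw; split; first exact: twisted_reps tw.
by case: tw => -[xy _ _] _ i; rewrite /= permKV.
Qed.

(** The representatives chosen for [(b, c)] and those for [(a, b)] number the same
   transversals of [b] in two ways; [u] compares the numberings, whence the
   conjugate. *)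
Lemma twisted_trans q (s t : 'S_q) a b c x y x2 y2 :
    same_pattern a b -> same_pattern b c -> twisted s a b x y -> twisted t b c x2 y2 ->
  exists u : 'S_q, twisted (t ^ u * s)%g a c x y.
Proof.
move=> pab pbc tw1 [[e2 inj2 _] tw2].
have [bxy binj bcov] := twisted_reps pab tw1.
have [ukc lkc _ _] := pbc.
have /fin_all_exists[f fP] i : exists j, up b (x2 i) = up b (x j).
  by apply: bcov; apply: dom_ul (e2 i).
have injf : injective f by move=> i j e; apply: inj2; rewrite !fP e.
exists (perm injf); split; first by case: tw1.
move=> j; set u := perm injf.
have uP i : up b (x2 i) = up b (x (u i)) by rewrite permE.
rewrite !permM; set i := (u^-1)%g j.
have /ukc <- : up b (x2 i) = up b (x j) by rewrite uP permKV.
rewrite tw2; apply/lkc; rewrite -e2 uP; exact: bxy.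
Qed.

Lemma nu_sym q (N : {group 'S_q}) a b : nu_rel N a b -> nu_rel N b a.
Proof.
case/nuP=> pab [s sN [x [y tw]]]; apply/nuP; split; first exact: same_pattern_sym.
by exists (s^-1)%g; [rewrite groupV|exists x, (y \o s); apply: twisted_sym].
Qed.

Lemma nu_trans q (N : {group 'S_q}) : (N <| 'Sym_('I_q))%g ->
  transitive (@nu_rel n q N).
Proof.
move=> /andP[_ nN] b a c /nuP[pab [s sN [x [y tw]]]] /nuP[pbc [t tN [x2 [y2 tw2]]]].
apply/nuP; split; first exact: same_pattern_trans pab pbc.
have [u tw3] := twisted_trans pab pbc tw tw2.
exists (t ^ u * s)%g; last by exists x, y.
by rewrite groupM // memJ_norm // (subsetP nN) ?inE.
Qed.

Lemma nu_flip q (N : {group 'S_q}) a b : nu_rel N a b -> nu_rel N (flip a) (flip b).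
Proof.
case/nuP=> pab [s sN [x [y [rxy tw]]]]; apply/nuP; split; first exact: same_pattern_flip.
exists (s^-1)%g; first by rewrite groupV.
exists y, x; split=> [|i]; first exact: reps_flip.
by apply/ul_flip; rewrite tw permKV.
Qed.

Lemma nu_rank q (N : {set 'S_q}) a b : nu_rel N a b -> rank a = q.
Proof. by case/and4P=> /eqP. Qed.

Lemma nu_rankr q (N : {set 'S_q}) a b : nu_rel N a b -> rank b = q.
Proof. by case/and4P=> _ /eqP. Qed.

(** If the product by [c] keeps the rank then each transversal of [a] is prolonged
   upwards by [c] in a way that ignores its lower part, so the permutation linking
   [a] and [b] links the products as well. *)
Lemma same_pattern_pmul c a b : same_pattern a b -> rank (pmul c a) = rank a ->
  same_pattern (pmul c a) (pmul c b) /\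
  forall (s : 'S_(rank a)) x y, twisted s a b x y ->
    exists w, twisted s (pmul c a) (pmul c b) w y.
Proof.
move=> pab rp; have [uk lk dk ck] := pab.
have [x0 [y0 rxy0]] := reps_ex (erefl (rank a)).
have codE : udom (flip (pmul c a)) =1 udom (flip a).
  move=> y; apply/idP/idP; first exact: cod_pmul.
  have [_ _ cov] := reps_flip rxy0; case/cov=> i /up_flip e.
  have [/(_ i)[w ew] _] := reps_pmull rxy0 rp.
  have [/(_ i) xyi _ _] := rxy0.
  apply: (@cod_ul _ _ w); apply/pmul_ul; exists (x0 i) => //.
  by rewrite xyi e.
have loE u v : lo (pmul c a) u = lo (pmul c a) v <-> lo a u = lo a v.
  rewrite pmul_lo; split; last by left.
  case=> // -[z [w [zu wv e]]].
  have [_ inj] := reps_pmull rxy0 rp; have [xy _ cov] := rxy0.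
  have [i ei] := cov z (dom_ul zu); have [j ej] := cov w (dom_ul wv).
  have ij : i = j.
    by apply: inj; rewrite -(jc_up c ei) -(jc_up c ej).
  by rewrite -zu -wv ei ej ij.
have tws (s : 'S_(rank a)) x y : twisted s a b x y ->
    exists w, (forall i, jc c a (inl (w i)) = jc c a (inr (x i))) /\
              twisted s (pmul c a) (pmul c b) w y.
  case=> rxy tw; have [/fin_all_exists[w wP] inj] := reps_pmull rxy rp.
  exists w; split=> //; split=> [|i]; last first.
    by apply/pmul_ul; exists (x i); [exact/(eq_jc _ _ _ uk)|].
  have [xy _ cov] := rxy; split=> [i|i j /pmul_up|z].
  - by apply/pmul_ul; exists (x i).
  - by rewrite !wP; apply: inj.
  case/dom_pmul=> z' e /cov[i /(jc_up c) e']; exists i; apply/pmul_up.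
  by rewrite e e' wP.
split; last by move=> s x y /tws[w [_ tw]]; exists w.
split=> [|u v|u|y].
- exact: upK_pmul.
- rewrite loE lk; split; first exact: lo_pmul.
  case/pmul_lo=> // -[z [w [zu wv /(eq_jc _ _ _ uk) e]]].
  have : up a z = up a w.
    have [_ inj] := reps_pmull rxy0 rp; have [xy _ cov] := rxy0.
    have [|i ei] := cov z; first by rewrite dk; apply: dom_ul zu.
    have [|j ej] := cov w; first by rewrite dk; apply: dom_ul wv.
    by rewrite ei ej; congr (up a (x0 _)); apply: inj; rewrite -(jc_up c ei) -(jc_up c ej).
  by move/uk; rewrite zu wv.
- exact: dom_pmul_eq.
rewrite codE; apply/idP/idP => [|/cod_pmul]; last by rewrite ck.
rewrite ck; have [_ _ cov] := reps_flip rxy0; rewrite -ck => /[dup] cy /cov[i /up_flip ei].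
have /codP[t ty] : udom (flip b) y by rewrite -ck.
have [j ej] : exists i, up a t = up a (x0 i).
  by have [_ _] := rxy0; apply; rewrite dk; apply: dom_ul ty.
have [/(_ j)[w ew] _] := reps_pmull rxy0 rp.
apply: (@cod_ul _ _ w); apply/pmul_ul; exists t; last exact: ty.
by apply/(eq_jc _ _ _ uk); rewrite ew; apply/esym/jc_up.
Qed.

(** Either both products drop in rank, and then they are identified, or one of
   them keeps its rank and so does the other. *)
Lemma nu_mull q (N : {group 'S_q}) c a b : 0 < q -> nu_rel N a b ->
  (tmul (Some c) (Some a), tmul (Some c) (Some b)) \in extR q.-1 (nu_rel N).
Proof.
case: q N => // q N _ ab; have ba := nu_sym ab.
have [pab _] := proj1 (nuP _ _ _) ab; have [uk _ dk _] := pab.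
have [Pa|Pa] := boolP (Phi c a == 0); last first.
  rewrite !tmul_none //; first by apply: extR_low.
  apply: contra Pa; apply: Phi0_same_pattern (upK_sym uk) _ => x; exact/esym.
have Pb := Phi0_same_pattern uk dk Pa; rewrite !tmul_some //.
have key a' b' : nu_rel N a' b' -> rank (pmul c a') = q.+1 -> nu_rel N (pmul c a') (pmul c b').
  move=> ab' r1; have r2 := nu_rank ab'.
  case/nuP: ab' => pab' [s sN [x [y tw]]].
  have [pp tws] := same_pattern_pmul pab' (etrans r1 (esym r2)).
  apply/nuP; split=> //; exists s => //.
  case: _ / r2 N s {sN ab ba r1} x y tw tws => N s x y tw tws.
  by have [w tw'] := tws s x y tw; exists w, y.
have [ra rb] := (nu_rank ab, nu_rank ba).
have := rank_pmull c a; have := rank_pmull c b; rewrite ra rb.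
rewrite leq_eqVlt => /orP[/eqP e _|lb]; last rewrite leq_eqVlt => /orP[/eqP e|la].
- apply/extRP; constructor 3; rewrite lift_relE.
  exact/nu_sym/key.
- by apply/extRP; constructor 3; rewrite lift_relE; apply: key.
- exact: extR_low.
Qed.

Lemma extR_flip q (r r' : rel (part n)) X Y :
    (forall a b, r a b -> r' (flip a) (flip b)) ->
  (X, Y) \in extR q r -> (tflip X, tflip Y) \in extR q r'.
Proof.
move=> rr /extRP[->|[lX lY]|/lift_relP[a [b [-> -> ab]]]]; apply/extRP.
- by constructor 1.
- by constructor 2; rewrite !low_flip.
by constructor 3; rewrite lift_relE; apply: rr.
Qed.

(** Compatibility on the right is compatibility on the left upside down. *)
Lemma mulr_of_mull q (r r' : rel (part n)) :
    (forall a b, r a b -> r' (flip a) (flip b)) ->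
    (forall a b, r' a b -> r (flip a) (flip b)) ->
    (forall c a b, r' a b -> (tmul (Some c) (Some a), tmul (Some c) (Some b)) \in extR q r') ->
  forall c a b, r a b -> (tmul (Some a) (Some c), tmul (Some b) (Some c)) \in extR q r.
Proof.
move=> rr rr' ml c a b /rr/(ml (flip c))/(extR_flip rr').
by rewrite -!tmul_flip /= !flipK.
Qed.

Lemma RN_congruence q (N : {group 'S_q}) : 0 < q -> (N <| 'Sym_('I_q))%g ->
  congruence (@tmul n) (RN n N).
Proof.
move=> q0 nN; apply: extR_congruence => [a b /nu_rank->|a b|||].
- by case: q q0 {N nN}.
- by apply/idP/idP; apply: nu_sym.
- exact: nu_trans.
- by move=> c a b; apply: nu_mull.
apply: (@mulr_of_mull _ _ (nu_rel N)); try by move=> a b; apply: nu_flip.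
by move=> c a b; apply: nu_mull.
Qed.

(** *** The relations [mu] *)

Lemma muP a b : mu_rel a b <-> [/\ rank a = 1, rank b = 1, upK a b & loK a b].
Proof.
split=> [/and3P[/eqP ra /eqP rb /eqP/hatP[]]|[ra rb uk lk]] //.
by rewrite /mu_rel ra rb !eqxx /=; apply/eqP/hatP.
Qed.

Lemma mu_sym a b : mu_rel a b -> mu_rel b a.
Proof. by case/muP=> ra rb uk lk; apply/muP; split=> //; [apply: upK_sym|apply: loK_sym]. Qed.

Lemma mu_trans : transitive (@mu_rel n).
Proof.
move=> b a c /muP[ra _ uk lk] /muP[_ rc uk' lk']; apply/muP; split=> //.
  exact: upK_trans uk uk'.
exact: loK_trans lk lk'.
Qed.

Lemma mu_flip a b : mu_rel a b -> mu_rel (flip a) (flip b).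
Proof.
case/muP=> ra rb uk lk; apply/muP; rewrite !rank_flip; split=> //.
  exact/upK_flip.
exact/loK_flip.
Qed.

Lemma loK_pmul1 c a : rank a = 1 -> loK (pmul c a) a.
Proof.
move=> ra x y; split; last exact: lo_pmul.
case/pmul_lo=> // -[z [w [zx wy _]]]; rewrite -zx -wy.
by apply: rank_le1 zx wy; rewrite ra.
Qed.

(** In a product of positive rank with no floating component, every component above
   the lower row meets the top: it could avoid it only by containing the upper
   end of the single transversal, which is linked to the top. Hence it does not
   matter which block is the transversal. *)
Lemma mu_pmul c a b : mu_rel a b -> Phi c a == 0 -> 0 < rank (pmul c a) ->
  Phi c b == 0 /\ mu_rel (pmul c a) (pmul c b).
Proof.
case/muP=> ra rb uk lk /Phi0_left P0 /rank_gt0P[x [y /pmul_ul[z e zy]]].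
have top t : exists s, jc c a (inr t) = jc c a (inl s).
  have [//|[w [v [e' wv]]]] := P0 t; exists x.
  by rewrite e' e; apply/jc_up/(rank_le1 _ wv zy); rewrite ra.
split; first by apply/Phi0_left=> t; have [s] := top t; left; exists s; apply/(eq_jc _ _ _ uk).
have r1 d : rank d = 1 -> 0 < rank (pmul c d) -> rank (pmul c d) = 1.
  by move=> rd ?; apply/eqP; rewrite eqn_leq -{1}rd rank_pmull.
apply/muP; split.
- by apply: r1 => //; apply/rank_gt0P; exists x, y; apply/pmul_ul; exists z.
- apply: r1 => //; have /rank_gt0P[s [t st]] : 0 < rank b by rewrite rb.
  have [u eu] := top s; apply/rank_gt0P; exists u, t; apply/pmul_ul; exists s => //.
  exact/esym/(eq_jc _ _ _ uk).
- exact: upK_pmul.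
apply: loK_trans (loK_pmul1 _ ra) _; apply: loK_trans lk _.
exact/loK_sym/loK_pmul1.
Qed.

Lemma mu_mull_gen (r : rel (part n)) c a b :
    (forall a b, r a b -> mu_rel a b) -> (forall a b, r a b -> r b a) ->
    (forall a b, r a b -> mu_rel (pmul c a) (pmul c b) -> r (pmul c a) (pmul c b)) ->
  r a b -> (tmul (Some c) (Some a), tmul (Some c) (Some b)) \in extR 0 r.
Proof.
move=> rmu rsym rmul ab.
have key a' b' : r a' b' -> ~~ low 1 (tmul (Some c) (Some a')) ->
    (tmul (Some c) (Some a'), tmul (Some c) (Some b')) \in extR 0 r.
  move=> ab'; have [P0|P0] := boolP (Phi c a' == 0); last by rewrite tmul_none.
  rewrite tmul_some //= -leqNgt => r0.
  have [Pb mab] := mu_pmul (rmu _ _ ab') P0 r0.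
  rewrite Pb; apply/extRP; constructor 3; rewrite lift_relE.
  exact: rmul.
have [la|/key] := boolP (low 1 (tmul (Some c) (Some a))); last exact.
have [lb|/(key b a (rsym _ _ ab))] := boolP (low 1 (tmul (Some c) (Some b))).
  exact: extR_low.
case/extRP=> [->|[lb _]|/lift_relP[a' [b' [-> -> ab']]]]; apply/extRP.
- by constructor 1.
- by constructor 2.
by constructor 3; rewrite lift_relE; apply: rsym.
Qed.

Definition mu_greenR a b := mu_rel a b && greenR a b.
Definition mu_greenL a b := mu_rel a b && greenL a b.

Lemma mu_greenRP a b : mu_greenR a b <-> mu_rel a b /\ udom a =1 udom b.
Proof.
split=> [/andP[mab /greenRP[_ dk]]|[mab dk]]; first by split.
have [_ _ uk _] := proj1 (muP a b) mab.
by rewrite /mu_greenR mab; apply/greenRP; split.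
Qed.

Lemma mu_greenLP a b : mu_greenL a b <-> mu_rel a b /\ udom (flip a) =1 udom (flip b).
Proof.
split=> [/andP[mab /greenLP[_ dk]]|[mab dk]]; first by split.
have [_ _ _ lk] := proj1 (muP a b) mab.
by rewrite /mu_greenL mab; apply/greenLP; split.
Qed.

Lemma muR_flip a b : mu_greenR a b -> mu_greenL (flip a) (flip b).
Proof. by case/mu_greenRP=> mab dk; apply/mu_greenLP; rewrite !flipK; split=> //; apply: mu_flip. Qed.

Lemma muL_flip a b : mu_greenL a b -> mu_greenR (flip a) (flip b).
Proof. by case/mu_greenLP=> mab dk; apply/mu_greenRP; split=> //; apply: mu_flip. Qed.

Lemma muR_sym a b : mu_greenR a b -> mu_greenR b a.
Proof. by case/mu_greenRP=> /mu_sym mab dk; apply/mu_greenRP; split; [exact: mab|move=> x; rewrite dk]. Qed.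

Lemma muL_sym a b : mu_greenL a b -> mu_greenL b a.
Proof. by case/mu_greenLP=> /mu_sym mab dk; apply/mu_greenLP; split; [exact: mab|move=> x; rewrite dk]. Qed.

Lemma muR_trans : transitive mu_greenR.
Proof.
move=> b a c /mu_greenRP[ab dab] /mu_greenRP[bc dbc]; apply/mu_greenRP; split; first exact: mu_trans ab bc.
by move=> x; rewrite dab.
Qed.

Lemma muL_trans : transitive mu_greenL.
Proof.
move=> b a c /mu_greenLP[ab dab] /mu_greenLP[bc dbc]; apply/mu_greenLP; split; first exact: mu_trans ab bc.
by move=> x; rewrite dab.
Qed.

Lemma cod_pmul1 c a : rank a = 1 -> 0 < rank (pmul c a) ->
  udom (flip (pmul c a)) =1 udom (flip a).
Proof.
move=> ra /rank_gt0P[x [y xy]] z; apply/idP/idP; first exact: cod_pmul.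
case/codP=> w wz; apply: (@cod_ul _ _ x); rewrite xy.
case/pmul_ul: xy => t _ ty; apply: lo_pmul; rewrite -ty -wz.
by apply: rank_le1 ty wz; rewrite ra.
Qed.

Lemma mu_mull c a b : mu_rel a b ->
  (tmul (Some c) (Some a), tmul (Some c) (Some b)) \in extR 0 (@mu_rel n).
Proof. by apply: mu_mull_gen => // a' b'; apply: mu_sym. Qed.

Lemma muR_mull c a b : mu_greenR a b ->
  (tmul (Some c) (Some a), tmul (Some c) (Some b)) \in extR 0 mu_greenR.
Proof.
apply: mu_mull_gen => [a' b' /andP[]||a' b' /mu_greenRP[/muP[_ _ uk _] dk] mab] //.
  exact: muR_sym.
by apply/mu_greenRP; split; [exact: mab|exact: dom_pmul_eq].
Qed.

Lemma muL_mull c a b : mu_greenL a b ->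
  (tmul (Some c) (Some a), tmul (Some c) (Some b)) \in extR 0 mu_greenL.
Proof.
apply: mu_mull_gen => [a' b' /andP[]||a' b' /mu_greenLP[/muP[ra rb _ _] dk] mab] //.
  exact: muL_sym.
apply/mu_greenLP; split; first exact: mab.
case/muP: mab => r1 r2 _ _ y.
have [p1 p2] : 0 < rank (pmul c a') /\ 0 < rank (pmul c b') by rewrite r1 r2.
rewrite (cod_pmul1 ra p1) (cod_pmul1 rb p2); exact: dk.
Qed.

Lemma mu_rank1 a b : mu_rel a b -> 0 < rank a.
Proof. by case/muP=> ->. Qed.

Lemma mu_congruence : congruence (@tmul n) (mu n).
Proof.
apply: extR_congruence => [a b /mu_rank1 //|a b|||].
- by apply/idP/idP; apply: mu_sym.
- exact: mu_trans.
- exact: mu_mull.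
by apply: (@mulr_of_mull _ _ (@mu_rel n)) => [a b|a b|]; [apply: mu_flip|apply: mu_flip|apply: mu_mull].
Qed.

Lemma mu_up_congruence : congruence (@tmul n) (mu_up n).
Proof.
apply: (@extR_congruence _ mu_greenR) => [a b /andP[/mu_rank1 //]|a b|||].
- by apply/idP/idP; apply: muR_sym.
- exact: muR_trans.
- exact: muR_mull.
by apply: (@mulr_of_mull _ _ mu_greenL) => [a b|a b|]; [apply: muR_flip|apply: muL_flip|apply: muL_mull].
Qed.

Lemma mu_down_congruence : congruence (@tmul n) (mu_down n).
Proof.
apply: (@extR_congruence _ mu_greenL) => [a b /andP[/mu_rank1 //]|a b|||].
- by apply/idP/idP; apply: muL_sym.
- exact: muL_trans.
- exact: muL_mull.
by apply: (@mulr_of_mull _ _ mu_greenR) => [a b|a b|]; [apply: muL_flip|apply: muR_flip|apply: muR_mull].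
Qed.

(** *** The relation [mu_S2] *)

Definition muS2 : rel (part n) := fun a b => mu_rel a b || nu_rel ('Sym_('I_2))%g a b.

Lemma mu_S2E : mu_S2 n = extR 0 muS2.
Proof.
apply/setP=> -[X Y]; rewrite /mu_S2 /mu /extR !in_setU -orbA.
by congr (_ || _); rewrite !inE; case: X Y => [a|] [b|].
Qed.

Lemma rank2_dom a z w t : rank a = 2 -> udom a z -> udom a w -> udom a t ->
  up a z <> up a w -> up a t = up a z \/ up a t = up a w.
Proof.
move=> ra dz dw dt zw; have [x [y [_ _ cov]]] := reps_ex ra.
have [i ei] := cov z dz; have [j ej] := cov w dw; have [k ek] := cov t dt.
have [e|nki] := eqVneq k i; first by left; rewrite ei ek e.
have [e|nkj] := eqVneq k j; first by right; rewrite ej ek e.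
case: zw; rewrite ei ej; congr (up a (x _)).
by move: i j k nki nkj {ei ej ek} => [[|[|i]] Hi] [[|[|j]] Hj] [[|[|k]] Hk] //= ? ?; apply: ord_inj.
Qed.

(** New identifications of lower vertices arise when [c] joins the two transversals
   of [a]; it then joins their upper ends, which are also those of [b]. *)
Lemma loK_pmul2 c a b : same_pattern a b -> rank a = 2 -> forall u v,
  lo (pmul c a) u = lo (pmul c a) v -> lo (pmul c b) u = lo (pmul c b) v.
Proof.
case=> uk lk dk ck ra u v /pmul_lo[/lk e|[z [w [zu wv e]]]]; first exact: lo_pmul.
have [euv|nuv] := eqVneq (lo a u) (lo a v); first exact/lo_pmul/lk.
have nzw : up a z <> up a w by rewrite zu wv; apply/eqP.
have /codP[z' zu'] : udom (flip b) u by rewrite -ck; apply: cod_ul zu.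
have /codP[w' wv'] : udom (flip b) v by rewrite -ck; apply: cod_ul wv.
apply/pmul_lo; right; exists z', w'; split=> //; apply/(eq_jc _ _ _ uk).
have all t s : up b t = lo b s -> jc c a (inr t) = jc c a (inr z).
  move=> ts; have dt : udom a t by rewrite dk; apply: dom_ul ts.
  have [//|/(jc_up c)//|/(jc_up c) ->] := rank2_dom ra (dom_ul zu) (dom_ul wv) dt.
  by rewrite e.
by rewrite (all _ _ zu') (all _ _ wv').
Qed.

Lemma nu_mull2 c a b : nu_rel ('Sym_('I_2))%g a b ->
  (tmul (Some c) (Some a), tmul (Some c) (Some b)) \in extR 0 muS2.
Proof.
move=> ab; have := @nu_mull 2 'Sym_('I_2)%G c a b isT ab.
case/extRP=> [->|[l2a l2b]|/lift_relP[a' [b' [-> -> ab']]]]; apply/extRP.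
- by constructor 1.
- have [pab _] := proj1 (nuP _ _ _) ab; have pba := same_pattern_sym pab.
  have [uk lk dk ck] := pab; have [uk' _ dk' _] := pba.
  have [ra rb] := (nu_rank ab, nu_rankr ab).
  have [Pa|Pa] := boolP (Phi c a == 0); last first.
    rewrite !tmul_none //; first by constructor 1.
    by apply: contra Pa; apply: Phi0_same_pattern uk' _.
  have Pb := Phi0_same_pattern uk dk Pa; move: l2a l2b; rewrite !tmul_some //= => l2a l2b.
  have r01 d : rank d < 2 -> rank d = 0 \/ rank d = 1.
    by case: (rank d) => [|[|]]; [left|right|].
  have gt0 a' b' : upK a' b' -> udom a' =1 udom b' -> 
      rank (pmul c a') = 1 -> rank (pmul c b') <> 0.
    move=> uk2 dk2 r1 /rank0P H; have /rank_gt0P[x [y /dom_ul]] : 0 < rank (pmul c a') by rewrite r1.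
    by rewrite (dom_pmul_eq c uk2 dk2) => /udomP[z /H].
  have [a0|a1] := r01 _ l2a; have [b0|b1] := r01 _ l2b.
  + by constructor 2; rewrite a0 b0.
  + by case: (gt0 b a).
  + by case: (gt0 a b).
  constructor 3; rewrite lift_relE; apply/orP; left; apply/muP; split=> //.
    exact: upK_pmul.
  by move=> u v; split; apply: loK_pmul2.
by constructor 3; rewrite lift_relE /muS2 ab' orbT.
Qed.

Lemma extR_sub q (r r' : rel (part n)) : subrel r r' -> extR q r \subset extR q r'.
Proof.
move=> sub; apply/subsetP=> -[X Y] /extRP[->|[lX lY]|/lift_relP[a [b [-> -> ab]]]]; apply/extRP.
- by constructor 1.
- by constructor 2.
by constructor 3; rewrite lift_relE; apply: sub.
Qed.

Lemma muS2_mull c a b : muS2 a b ->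
  (tmul (Some c) (Some a), tmul (Some c) (Some b)) \in extR 0 muS2.
Proof.
case/orP=> [/(mu_mull c)|]; last exact: nu_mull2.
by apply/subsetP/extR_sub => x y xy; rewrite /muS2 xy.
Qed.

Lemma muS2_sym a b : muS2 a b -> muS2 b a.
Proof. by case/orP=> [/mu_sym|/nu_sym] ba; rewrite /muS2 ba ?orbT. Qed.

Lemma muS2_flip a b : muS2 a b -> muS2 (flip a) (flip b).
Proof. by case/orP=> [/mu_flip|/nu_flip] ba; rewrite /muS2 ba ?orbT. Qed.

Lemma mu_S2_congruence : congruence (@tmul n) (mu_S2 n).
Proof.
rewrite mu_S2E; apply: extR_congruence.
- by move=> a b /orP[/mu_rank1|/nu_rank ->].
- by move=> a b; apply/idP/idP; apply: muS2_sym.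
- move=> b a c /orP[ab|ab] /orP[bc|bc]; apply/orP.
  + by left; apply: mu_trans ab bc.
  + by case/muP: ab (nu_rank bc) => _ -> _ _.
  + by case/muP: bc (nu_rankr ab) => -> _ _ _.
  + by right; apply: nu_trans ab bc; apply: normal_refl.
- exact: muS2_mull.
by apply: (@mulr_of_mull _ _ muS2) => [a b|a b|]; [apply: muS2_flip|apply: muS2_flip|apply: muS2_mull].
Qed.

End Congruence.

(** * Two kinds of multipliers: cutting and merging *)

Section Multipliers.
Variable n : nat.
Implicit Types (a b c d g : part n) (X Y Z : tpart n).

Definition under (v : vertex n) : 'I_n := match v with inl x => x | inr x => x end.

(** The upper kernel of [g], copied on both rows, with the lower vertices of [S]
   detached from the top: as a left factor it cuts the blocks inside [S] off. *)
Definition cut g (S : {set 'I_n}) : part n :=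
  of_lab (fun v => match v with
    | inl x => (up g x, false) | inr z => (up g z, z \in S) end).

Section Cut.
Variables (g a : part n) (S : {set 'I_n}).

Lemma cut_top z : z \notin S -> jc (cut g S) a (inl z) = jc (cut g S) a (inr z).
Proof. by move=> zS; apply/jc_cls/cls_of_lab; rewrite (negbTE zS). Qed.

Lemma cut_in z w : up g z = up g w -> z \in S -> w \in S ->
  jc (cut g S) a (inr z) = jc (cut g S) a (inr w).
Proof. by move=> e zS wS; apply/jc_cls/cls_of_lab; rewrite e zS wS. Qed.

End Cut.

Lemma cut_abs g (S : {set 'I_n}) u v :
    (forall z w, up g z = up g w -> (z \in S) = (w \in S)) ->
  jc (cut g S) g u = jc (cut g S) g v <-> cls (cut g S) u = cls (cut g S) v.
Proof.
move=> sat; apply: jc_absorb => z w e; apply/cls_of_lab.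
by rewrite e (sat _ _ e).
Qed.

(** The identity with the blocks of [x] and [z] merged: as a left factor it merges
   two upper blocks, and never creates floating components. *)
Definition merger (x z : 'I_n) : part n :=
  of_lab (fun v => if under v == x then z else under v).

Section Merge.
Variables (x z : 'I_n) (a : part n).
Let m := merger x z.
Let r w := if up a w == up a x then z else w.

Lemma merge_jc u v : jc m a u = jc m a v <->
  up a (r (under u)) = up a (r (under v)).
Proof.
have topE w : jc m a w = jc m a (inr (under w)) by apply/jc_cls/cls_of_lab.
have xz : jc m a (inr x) = jc m a (inr z).
  by apply/jc_cls/cls_of_lab => /=; rewrite eqxx; case: eqP.
have rE w : jc m a (inr w) = jc m a (inr (r w)).
  by rewrite /r; case: eqP => // /(jc_up m) ->.
split; last by rewrite (topE u) (topE v) (rE (under u)) (rE (under v)); apply: jc_up.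
apply: (@jc_min n m a _ (fun w => up a (r (under w)))) => {u v} [u v /cls_of_lab e|s t e].
  have rx : up a (r x) = up a z by rewrite /r eqxx.
  have rz : up a (r z) = up a z by rewrite /r; case: eqP.
  have rm w : up a (r w) = up a (r (if w == x then z else w)).
    by case: eqP => [->|]; rewrite ?rx ?rz.
  by rewrite (rm (under u)) e -rm.
by rewrite /= /r e; case: eqP.
Qed.

Lemma merge_mul : tmul (Some m) (Some a) = Some (pmul m a).
Proof.
apply/tmul_some/Phi0_left => t; left; exists t.
exact/jc_cls/cls_of_lab.
Qed.

Lemma merge_dom t : udom a t -> udom (pmul m a) t.
Proof. by move=> dt; apply/dom_pmul; exists t => //; apply/jc_cls/cls_of_lab. Qed.

Lemma merge_cod y : udom (flip a) y -> udom (flip (pmul m a)) y.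
Proof.
case/codP=> t ty; apply: (@cod_ul _ _ t); apply/pmul_ul; exists t => //.
exact/jc_cls/cls_of_lab.
Qed.

Lemma merge_up s t :
  up (pmul m a) s = up (pmul m a) t <-> up a (r s) = up a (r t).
Proof. by rewrite pmul_up merge_jc. Qed.

Lemma merge_lo s t : lo (pmul m a) s = lo (pmul m a) t <-> lo a s = lo a t \/
  exists p q, [/\ up a p = lo a s, up a q = lo a t & up a (r p) = up a (r q)].
Proof.
rewrite pmul_lo; split=> -[|[p [q [ps qt e]]]]; [by left| |by left|].
  by right; exists p, q; split=> //; move: e; rewrite merge_jc.
by right; exists p, q; split=> //; apply/merge_jc.
Qed.

Lemma merge_rank_keep : ~~ udom a x \/ up a x = up a z -> rank (pmul m a) = rank a.
Proof.
move=> h; apply/eqP; rewrite eqn_leq rank_pmull /=.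
have [X [Y [XY inj _]]] := reps_ex (erefl (rank a)).
apply: (@rank_ge _ _ _ X) => [i|i j /merge_up]; first exact/merge_dom/dom_ul/XY.
have rX k : up a (r (X k)) = up a (X k).
  rewrite /r; case: eqP => // e; case: h => [|<-] //.
  by rewrite -(dom_up e) (dom_ul (XY k)).
by rewrite !rX => /inj.
Qed.

(** Only the transversal through [x] can be lost. *)
Lemma merge_rank_lb : rank a <= (rank (pmul m a)).+1.
Proof.
have [X [Y rXY]] := reps_ex (erefl (rank a)); have [XY inj cov] := rXY.
have [dx|dx] := boolP (udom a x); last by rewrite merge_rank_keep //; left.
have [i0 e0] := cov x dx; case: (rank a) X Y i0 e0 XY inj {cov rXY} => // k X Y i0 e0 XY inj.
rewrite ltnS; apply: (@rank_ge _ _ _ (X \o lift i0)) => [i|i j /merge_up].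
  exact/merge_dom/dom_ul/XY.
have rX l : up a (r (X (lift i0 l))) = up a (X (lift i0 l)).
  rewrite /r; case: eqP => //; rewrite e0 => /inj/eqP.
  by rewrite eq_sym (negbTE (neq_lift _ _)).
by rewrite /= !rX => /inj/lift_inj.
Qed.

Lemma merge_rank_lt : udom a x -> udom a z -> up a x <> up a z ->
  rank (pmul m a) < rank a.
Proof.
move=> dx dz xz; rewrite ltn_neqAle rank_pmull andbT; apply/eqP => e.
have [X [Y rXY]] := reps_ex (erefl (rank a)); have [_ inj] := reps_pmull rXY e.
have [_ _ cov] := rXY; have [i ei] := cov x dx; have [j ej] := cov z dz.
case: xz; rewrite ei ej; congr (up a (X _)); apply: inj.
rewrite -(jc_up m ei) -(jc_up m ej); apply/merge_jc.
by rewrite /r /= eqxx; case: eqP.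
Qed.

End Merge.

(** ** Labelling the transversals *)

(** [inord] sends the indices beyond [r] to 0, so that surplus transversals join the
   first one, as do all the other blocks. *)
Lemma reps_label a k (x y : 'I_k -> 'I_n) r : reps a x y -> r.+1 <= k ->
  exists f : vertex n -> 'I_r.+1,
    [/\ forall u v, cls a u = cls a v -> f u = f v,
        forall i, f (inl (x i)) = inord i & forall i, f (inr (y i)) = inord i].
Proof.
case=> xy inj cov rk.
exists (fun v => if [pick i | cls a v == up a (x i)] is Some i then inord i else ord0).
split=> [u v -> //|i|i]; case: pickP => [j /eqP e|/(_ i)].
- by congr inord; congr val; apply: inj.
- by rewrite eqxx.
- by congr inord; congr val; apply: inj; rewrite -e xy.
- by rewrite xy eqxx.
Qed.

(** Number the transversals of both partitions and send the surplus ones of [a] to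
   the first one of [g]. *)
Lemma morph_rank a g r : rank g = r.+1 -> r < rank a ->
  exists phi psi, morph a g phi psi.
Proof.
move=> /reps_ex[u [v [uv _ cov]]] ra.
have [x [y rxy]] := reps_ex (erefl (rank a)).
have [f [fc fx fy]] := reps_label rxy ra.
exists (fun z => u (f (inl z))), (fun w => v (f (inr w))).
split=> [z w e|z w e|z w e|z /cov[i ->]].
- by rewrite (fc (inl z) (inl w)).
- by rewrite (fc (inr z) (inr w)).
- by rewrite (fc (inl z) (inr w)).
have [xy _ _] := rxy; exists (x (widen_ord ra i)); first exact: dom_ul (xy _).
by rewrite fx inord_val.
Qed.

(** A map matching the representatives of [a] with those of [g] also matches [b]
   with [g'], as the same permutation links the two pairs. *)
Lemma morph_twisted q (s : 'S_q) a b g g' x y u v : 0 < q ->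
    same_pattern a b -> same_pattern g g' -> twisted s a b x y -> twisted s g g' u v ->
  exists phi psi, morph a g phi psi /\ morph b g' phi psi.
Proof.
case: q s x y u v => // q s x y u v _ [uk lk dk _] [uk' lk' dk' _] [rxy xys] [ruv uvs].
have [f [fc fx fy]] := reps_label rxy (leqnn _).
have [xy _ cov] := rxy; have [uv _ cov'] := ruv.
exists (fun z => u (f (inl z))), (fun w => v (f (inr w))); split.
  split=> [z w e|z w e|z w e|z /cov'[i ->]].
  - by rewrite (fc (inl z) (inl w)).
  - by rewrite (fc (inr z) (inr w)).
  - by rewrite (fc (inl z) (inr w)).
  by exists (x i); [exact: dom_ul (xy _)|rewrite fx inord_val].
split=> [z w /uk e|z w /lk e|z w e|z].
- by rewrite (fc (inl z) (inl w)).
- by rewrite (fc (inr z) (inr w)).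
- have [|i ei] := cov z; first by rewrite dk; apply: dom_ul e.
  have /lk ew : lo b w = lo b (y (s i)) by rewrite -e -xys; apply/uk.
  by rewrite (fc (inl z) (inl (x i))) // (fc (inr w) (inr (y (s i)))) // fx fy !inord_val.
rewrite -dk' => /cov'[i /uk' ei]; exists (x i); first exact: dom_ul (xys _).
by rewrite fx inord_val.
Qed.

End Multipliers.

(** * What a congruence must contain *)

Section Generation.
Variables (n : nat) (th : {set tpart n * tpart n}).
Implicit Types (a b c d g : part n) (X Y Z : tpart n).
Hypothesis cth : congruence (@tmul n) th.

(** Membership of the Rees congruence of rank [r], in a form that needs a single
   element: everything below is related to zero. *)
Definition ideal_in r := forall X, low r.+1 X -> (X, None) \in th.

Lemma ideal_in_Rees r : ideal_in r <-> Rees n (Some r) \subset th.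
Proof.
split=> [Zr|/subsetP sub X lX]; last by apply: sub; rewrite ReesE lX orbT.
apply/subsetP=> -[X Y]; rewrite ReesE => /orP[/eqP->|/andP[/Zr Xz /Zr Yz]].
  exact: crefl cth _.
exact: ctrans_zero cth _ _ Xz Yz.
Qed.

Lemma ideal_inW r s : s <= r -> ideal_in r -> ideal_in s.
Proof. by move=> sr Zr X lX; apply: Zr; apply: lowW lX. Qed.

Lemma th_morph a b g g' phi psi : (Some a, Some b) \in th ->
    morph a g phi psi -> morph b g' phi psi -> upK g g' -> loK g g' ->
  (Some g, Some g') \in th.
Proof.
move=> ab /morph_mul Hg /morph_mul Hg' uk lk; rewrite -Hg -Hg'.
rewrite -(hang_ext _ uk) -(@hang_ext _ (flip g) (flip g')); last exact/upK_flip.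
exact/(cmulr cth)/(cmull cth).
Qed.

Lemma th_morph0 a g phi psi : (Some a, None) \in th -> morph a g phi psi ->
  (Some g, None) \in th.
Proof. by move=> az /morph_mul <-; apply: (cmulr cth _ (cmull cth _ az)). Qed.

Lemma th_twisted q (s : 'S_q) a b g g' x y u v : 0 < q -> (Some a, Some b) \in th ->
    same_pattern a b -> same_pattern g g' -> twisted s a b x y -> twisted s g g' u v ->
  (Some g, Some g') \in th.
Proof.
move=> q0 ab pab pgg tab tgg.
have [phi [psi [m1 m2]]] := morph_twisted q0 pab pgg tab tgg.
by have [uk lk _ _] := pgg; apply: th_morph ab m1 m2 uk lk.
Qed.

(** Merging the block [P] of [p] in [b] and cutting it off leaves [b] with a floating
   component. In [a] the merged block also contains [v], which is not cut off, so
   nothing floats; if [v] is an upper vertex, the transversals of [a] passing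
   through [P] survive through it. *)
Lemma isolate a b p v : (Some a, Some b) \in th ->
    cls a (inl p) = cls a v -> cls b (inl p) <> cls b v ->
    (forall y, up b p <> lo b y) ->
  exists2 c, (Some c, None) \in th & side v -> 0 < rank a -> 0 < rank c.
Proof.
move=> ab av bv nt; pose P := [set z | up b z == up b p].
have inP z : (z \in P) = (up b z == up b p) by rewrite inE.
have /(cmull cth (Some (cut b P))) := ab.
have pP : p \in P by rewrite inP.
have dead : Phi (cut b P) b != 0.
  apply/negP => /Phi0_left/(_ p).
  have sat z w : up b z = up b w -> (z \in P) = (w \in P) by rewrite !inP => ->.
  case=> [[x]|[w [y [+ wy]]]]; rewrite (cut_abs _ _ sat) cls_of_lab pP; first by [].
  by case=> e _; apply: (nt y); rewrite e.
have alive : Phi (cut b P) a == 0.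
  apply/Phi0_left=> z; have [zP|zP] := boolP (z \in P); last first.
    by left; exists z; rewrite cut_top.
  have -> : jc (cut b P) a (inr z) = jc (cut b P) a (inr p).
    by apply: cut_in => //; apply/eqP; rewrite -inP.
  case: v av bv => [q|y] av bv; last by right; exists p, y.
  left; exists q; rewrite cut_top; first exact: jc_up.
  by rewrite inP; apply/negP => /eqP/esym.
rewrite (tmul_none dead) (tmul_some alive); exists (pmul (cut b P) a) => //.
case: v av bv => // q av bv _ /rank_gt0P[s [t st]].
have qP : q \notin P by rewrite inP; apply/negP => /eqP/esym.
have [sP|sP] := boolP (s \in P); last first.
  by apply/rank_gt0P; exists s, t; apply/pmul_ul; exists s; rewrite // cut_top.
apply/rank_gt0P; exists q, t; apply/pmul_ul; exists s; last exact: st.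
rewrite (cut_top _ _ qP) -(jc_up _ av); apply: cut_in => //.
by apply/eqP; rewrite eq_sym -inP.
Qed.

End Generation.

Section Bottom.
Variable n : nat.
Implicit Types (a b c d g : part n) (X Y Z : tpart n) (th : {set tpart n * tpart n}).

Lemma flips_zero th a : (Some (flip a), None) \in flips th -> (Some a, None) \in th.
Proof. by rewrite flipsE /= flipK. Qed.

Lemma ideal_in_flips th r : ideal_in (flips th) r <-> ideal_in th r.
Proof.
split=> H X lX; last by rewrite flipsE; apply: (H (tflip X)); rewrite low_flip.
have := H (tflip X); rewrite low_flip => /(_ lX).
by rewrite flipsE tflipK.
Qed.

(** Cut first the lower part of the block of [p] in [b]. This cannot make
   a component of [b] float; if one floats in [a], zero has been reached, and
   otherwise the block of [p] in [b] has become an upper one, to be isolated. *)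
Lemma separate th a b p v : congruence (@tmul n) th -> (Some a, Some b) \in th ->
    cls a (inl p) = cls a v -> cls b (inl p) <> cls b v ->
  exists c, (Some c, None) \in th.
Proof.
move=> cth ab av bv; have cth' := congruence_flips cth.
pose b' := flip b; pose a' := flip a; pose R := [set z | lo b z == up b p].
have inR z : (z \in R) = (lo b z == up b p) by rewrite inE.
pose E := cut b' R.
have sat z w : up b' z = up b' w -> (z \in R) = (w \in R).
  by rewrite !inR => /up_flip ->.
have Pb : Phi E b' == 0.
  apply/Phi0_left=> z; have [zR|zR] := boolP (z \in R); last first.
    by left; exists z; rewrite cut_top.
  by right; exists z, p; split=> //; apply/ul_flip/esym/eqP; rewrite -inR.
have : (tmul (Some E) (Some a'), tmul (Some E) (Some b')) \in flips th.
  by apply: cmull cth' _ _ _ _; rewrite flipsE /= !flipK.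
rewrite (tmul_some Pb); have [Pa|Pa] := boolP (Phi E a' == 0); last first.
  rewrite (tmul_none Pa) => /(csym cth') h.
  by exists (flip (pmul E b')); apply: flips_zero; rewrite flipK.
rewrite (tmul_some Pa) flipsE /=; set a1 := flip _; set b1 := flip _ => ab1.
have nt y : up b1 p <> lo b1 y.
  move/ul_flip/pmul_ul => [z]; rewrite (cut_abs _ _ sat) cls_of_lab => -[_ zR] /ul_flip zp.
  by move: zR; rewrite inR zp eqxx.
have av1 : cls a1 (inl p) = cls a1 v.
  case: v av bv => [q|y] av bv.
    exact/up_flip/lo_pmul/lo_flip.
  apply/ul_flip/pmul_ul; exists y; last exact/ul_flip.
  by apply: cut_top; rewrite inR; apply/negP => /eqP/esym.
have bv1 : cls b1 (inl p) <> cls b1 v.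
  case: v av bv {av1} => [q|y] av bv; last exact: nt.
  move/up_flip/pmul_lo => [/lo_flip//|[z [w [/ul_flip zp /ul_flip wq]]]].
  rewrite (cut_abs _ _ sat) cls_of_lab => -[/up_flip e _].
  by apply: bv; rewrite -/(up b p) -/(up b q) zp wq.
by have [c cz _] := isolate cth ab1 av1 bv1 nt; exists c.
Qed.

Lemma nonDelta_zero th : congruence (@tmul n) th -> th <> Delta n ->
  exists c, (Some c, None) \in th.
Proof.
move=> cth nD.
have [X [Y [XY nXY]]] : exists X Y, (X, Y) \in th /\ X <> Y.
  have [/existsP[[X Y] /andP[XY /eqP nXY]]|none] :=
    boolP [exists p : tpart n * tpart n, (p \in th) && (p.1 != p.2)].
    by exists X, Y.
  case: nD; apply/setP=> -[X Y]; rewrite inE /=; apply/idP/eqP => [XY|->].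
    by apply/eqP; apply: contraNT none => nXY; apply/existsP; exists (X, Y); rewrite XY.
  exact: crefl cth _.
case: X Y XY nXY => [a|] [b|] ab nab //; last 2 first.
- by exists a.
- by exists b; apply: csym cth _ _ ab.
have sep a' b' u v : (Some a', Some b') \in th ->
    cls a' u = cls a' v -> cls b' u <> cls b' v -> exists c, (Some c, None) \in th.
  move=> ab'; case: u v => [p|p] v av bv; first exact: separate cth ab' av bv.
  case: v av bv => [q|q] av bv.
    by apply: (separate cth ab' (esym av)) => /esym.
  have [||||c] := @separate (flips th) (flip a') (flip b') p (inl q).
  - exact: congruence_flips.
  - by rewrite flipsE /= !flipK.
  - exact/cls_flip.
  - by move/cls_flip.
  by rewrite flipsE; exists (flip c).
have [/forallP H|] := boolP [forall u, forall v, (cls a u == cls a v) == (cls b u == cls b v)].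
  case: nab; congr Some; apply: part_ext => u v.
  have /forallP/(_ v)/eqP e := H u.
  by split=> /eqP h; apply/eqP; [rewrite -e|rewrite e].
rewrite negb_forall => /existsP[u]; rewrite negb_forall => /existsP[v].
have [au|au] := eqVneq (cls a u) (cls a v); have [bu|bu] := eqVneq (cls b u) (cls b v) => // _.
  by apply: sep ab au _; apply/eqP.
by apply: sep (csym cth ab) bu _; apply/eqP.
Qed.

(** Splitting the upper row from the lower one turns an element of positive rank
   related to zero into one of rank 0; constant maps then reach all the others. *)
Lemma nonDelta_ideal0 th : 0 < n -> congruence (@tmul n) th -> th <> Delta n ->
  ideal_in th 0.
Proof.
move=> n0 cth /(nonDelta_zero cth)[c cz].
have [w wz w0] : exists2 w, (Some w, None) \in th & rank w = 0.
  have [c0|/rank_gt0P[x [y xy]]] := posnP (rank c); first by exists c.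
  have /(cmull cth (Some (of_lab (@side n)))) := cz.
  have abs u v : jc (of_lab (@side n)) c u = jc (of_lab (@side n)) c v <-> side u = side v.
    by rewrite jc_absorb ?cls_of_lab // => *; apply/cls_of_lab.
  rewrite tmul_some; last by apply/Phi0_left=> z; right; exists x, y; split=> //; apply/abs.
  exists (pmul (of_lab (@side n)) c) => //.
  by apply/rank0P=> s t /pmul_ul[z /abs].
case=> [g|] lg; last exact: crefl cth _.
have g0 : rank g = 0 by apply/eqP; rewrite -leqn0 -ltnS.
apply: (@th_morph0 _ _ cth w g (fun _ => Ordinal n0) (fun _ => Ordinal n0) wz).
split=> // [z t /(proj1 (rank0P w) w0)//|z /udomP[t /(proj1 (rank0P g) g0)]] //.
Qed.

Section Climb.
Variable th : {set tpart n * tpart n}.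
Hypotheses (cth : congruence (@tmul n) th) (Z0 : ideal_in th 0).

Lemma low_zero X : low 1 X -> (X, None) \in th. Proof. exact: Z0. Qed.

(** A partition of rank above [r] can be moved to every one of rank [r.+1], taking
   its relation to zero along. *)
Lemma ideal_step a r : (Some a, None) \in th -> r < rank a ->
  ideal_in th r -> ideal_in th r.+1.
Proof.
move=> az ra Zr [g|] lg; last exact: crefl cth _.
have [rg|rg] := leqP (rank g) r; first exact: Zr.
have rg' : rank g = r.+1 by apply/eqP; rewrite eqn_leq rg andbT.
by have [phi [psi m]] := morph_rank rg' ra; exact: (th_morph0 cth az m).
Qed.

Lemma ideal1 a Y : (Some a, Y) \in th -> 0 < rank a -> low 1 Y -> ideal_in th 1.
Proof.
move=> aY ra lY; apply: ideal_step ra Z0.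
exact: ctrans cth _ _ _ aY (low_zero lY).
Qed.

End Climb.

(** Cutting the domain of [b] leaves no transversal in [b], while the one of [a]
   through [x] survives. Nothing floats in [a], since the part cut off contains
   the end [w] of a transversal of [a]. *)
Lemma drop_dom th a b x w : congruence (@tmul n) th -> ideal_in th 0 ->
    (Some a, Some b) \in th -> rank b = 1 ->
    udom a x -> ~~ udom b x -> udom a w -> udom b w ->
  ideal_in th 1.
Proof.
move=> cth Z0 ab rb dax dbx daw dbw; pose S := [set z | udom b z].
have inS z : (z \in S) = udom b z by rewrite inE.
have sat z t : up b z = up b t -> (z \in S) = (t \in S) by rewrite !inS; apply: dom_up.
have Pa : Phi (cut b S) a == 0.
  apply/Phi0_left=> z; have [zS|zS] := boolP (z \in S); last by left; exists z; rewrite cut_top.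
  have /udomP[y wy] := daw; right; exists w, y; split; last exact: wy.
  apply: cut_in; rewrite // ?inS //.
  have [/udomP[t zt] /udomP[s ws]] : udom b z /\ udom b w by rewrite -inS.
  by apply: rank_le1 zt ws; rewrite rb.
have /udomP[y xy] := dax.
have := cmull cth (Some (cut b S)) ab; rewrite (tmul_some Pa) => h.
apply: (ideal1 cth Z0 h).
  apply/rank_gt0P; exists x, y; apply/pmul_ul; exists x; last exact: xy.
  by apply: cut_top; rewrite inS.
rewrite /tmul; case: ifP => // _; rewrite /= ltnS leqn0; apply/eqP/rank0P=> s t.
by case/pmul_ul=> z; rewrite (cut_abs _ _ sat) cls_of_lab inS => -[_ zS] /dom_ul; rewrite -zS.
Qed.

(** If no upper vertex lies in transversals of both, merging an end [w] of the
   transversal of [b] into a transversal of [a] provides one. *)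
Lemma meet_dom th a b : congruence (@tmul n) th -> ideal_in th 0 ->
    (Some a, Some b) \in th -> 1 < rank a -> rank b = 1 ->
  ideal_in th 1 \/ exists a' b', [/\ (Some a', Some b') \in th, 1 < rank a', rank b' = 1,
    exists2 w, udom a' w & udom b' w
    & forall y, (udom (flip a) y -> udom (flip a') y) /\ (udom (flip b) y -> udom (flip b') y)].
Proof.
move=> cth Z0 ab ra rb.
have [/existsP[w /andP[daw dbw]]|dis] := boolP [exists w, udom a w && udom b w].
  by right; exists a, b; split=> //; exists w.
have /rank_gt0P[w [t wt]] : 0 < rank b by rewrite rb.
have /rank_gt0P[x [y xy]] := ltnW ra.
have naw : ~~ udom a w.
  by apply: contra dis => daw; apply/existsP; exists w; rewrite daw (dom_ul wt).
have := cmull cth (Some (merger w x)) ab; rewrite !merge_mul => ab'.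
have ra' : rank (pmul (merger w x) a) = rank a by apply: merge_rank_keep; left.
have [rb'|rb'] := posnP (rank (pmul (merger w x) b)).
  by left; apply: (ideal1 cth Z0 ab'); rewrite ?ra' ?(ltnW ra) //= rb'.
right; exists (pmul (merger w x) a), (pmul (merger w x) b); split=> //.
- by rewrite ra'.
- by apply/eqP; rewrite eqn_leq rb' -{1}rb rank_pmull.
- exists w; last exact/merge_dom/(dom_ul wt).
  apply/dom_pmul; exists x; last exact: dom_ul xy.
  by apply/merge_jc; rewrite /= eqxx; case: eqP.
by move=> z; split; apply: merge_cod.
Qed.

(** All ends of transversals of [a] lie in the single transversal of [b]. Cutting
   all transversals of [a] but one above, and all but another one below,
   destroys every transversal of [a] and keeps that of [b]. *)
Lemma drop_inside th a b : congruence (@tmul n) th -> ideal_in th 0 ->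
    (Some a, Some b) \in th -> 1 < rank a -> rank b = 1 ->
    (forall x, udom a x -> udom b x) ->
    (forall y, udom (flip a) y -> udom (flip b) y) ->
  ideal_in th 1.
Proof.
move=> cth Z0 ab ra rb db cb.
have [X [Y [XY inj _]]] := reps_ex (erefl (rank a)).
pose x1 := X (Ordinal (ltnW ra)); pose x2 := X (Ordinal ra); pose y1 := Y (Ordinal (ltnW ra)).
have e1 : up a x1 = lo a y1 by apply: XY.
have e2 : up a x2 = lo a (Y (Ordinal ra)) by apply: XY.
have n12 : up a x2 <> up a x1 by move/inj.
have one x y : udom b x -> udom (flip b) y -> up b x = lo b y.
  move=> /udomP[s xs] /codP[t ty]; rewrite -ty.
  by apply: rank_le1 xs ty; rewrite rb.
pose S := [set z | udom a z && (up a z != up a x2)].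
have satS z w : up a z = up a w -> (z \in S) = (w \in S).
  by move=> e; rewrite !inE (dom_up e) e.
pose T := [set z | udom (flip a) z && (lo a z != lo a y1)].
have satT z w : lo a z = lo a w -> (z \in T) = (w \in T).
  by move=> e; rewrite !inE (cod_lo e) e.
have x2S : x2 \notin S by rewrite inE eqxx andbF.
have y1T : y1 \notin T by rewrite inE eqxx andbF.
have jx2 d : jc (cut a S) d (inl x2) = jc (cut a S) d (inr x2) by apply: cut_top.
have dx2 : udom b x2 by apply: db; apply: dom_ul e2.
pose b1 := pmul (cut a S) b.
have b1ul y : udom (flip b) y -> up b1 x2 = lo b1 y.
  by move=> dy; apply/pmul_ul; exists x2; [exact: jx2|exact: one].
have mb1 : tmul (Some (cut a S)) (Some b) = Some b1.
  apply/tmul_some/Phi0_left=> z; have [zS|zS] := boolP (z \in S).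
    right; have : udom b z by apply: db; move: zS; rewrite inE => /andP[].
    by case/udomP=> y zy; exists z, y.
  by left; exists z; rewrite cut_top.
pose E := cut (flip a) T.
have mb2 : exists2 b2, tmul (Some b1) (Some (flip E)) = Some b2 & 0 < rank b2.
  rewrite tmul_rflip -[tflip (Some b1)]/(Some (flip b1)) tmul_some; last first.
    apply/Phi0_left=> z; have [zT|zT] := boolP (z \in T).
      right; exists z, x2; split=> //; apply/ul_flip/b1ul/cb.
      by move: zT; rewrite inE => /andP[].
    by left; exists z; rewrite cut_top.
  exists (flip (pmul E (flip b1))) => //; rewrite rank_flip.
  apply/rank_gt0P; exists y1, x2; apply/pmul_ul; exists y1; first exact: cut_top.
  by apply/ul_flip/b1ul/cb; apply: cod_ul e1.
have [b2 b2E r2] := mb2.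
have := cmulr cth (Some (flip E)) (cmull cth (Some (cut a S)) ab).
rewrite mb1 b2E => /(csym cth) h; apply: (ideal1 cth Z0 h r2).
rewrite {h}/(tmul (Some _) (Some a)); case: ifP => // _.
rewrite tmul_rflip low_flip -[tflip (Some _)]/(Some (flip (pmul (cut a S) a))).
set a1 := pmul _ a; rewrite /tmul; case: ifP => // _; rewrite /= ltnS leqn0.
have abs u v : jc E (flip a1) u = jc E (flip a1) v <-> cls E u = cls E v.
  apply: jc_absorb => z w /up_flip/pmul_lo e; apply/cls_of_lab.
  have {}e : lo a z = lo a w.
    case: e => // -[s [t [sz tw]]]; rewrite (cut_abs _ _ satS) cls_of_lab => -[+ _].
    by rewrite sz tw.
  by rewrite (satT _ _ e); congr pair; apply/up_flip.
apply/eqP/rank0P=> s t /pmul_ul[z /abs/cls_of_lab[_ zT]] /ul_flip/pmul_ul[w].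
rewrite (cut_abs _ _ satS) cls_of_lab => -[_ wS] wz.
move: wS zT; rewrite !inE (dom_ul wz) (cod_ul wz) /= => /esym/negbFE/eqP e /esym/negbFE/eqP e'.
by apply: n12; rewrite -e wz e' e1.
Qed.

Lemma drop2 th a b : congruence (@tmul n) th -> ideal_in th 0 ->
    (Some a, Some b) \in th -> 1 < rank a -> rank b = 1 -> ideal_in th 1.
Proof.
move=> cth Z0 ab ra rb; have cth' := congruence_flips cth.
have Z0' : ideal_in (flips th) 0 by apply/ideal_in_flips.
(* Make the domains meet, and then the codomains without losing the former. *)
have [//|[a1 [b1 [ab1 ra1 rb1 [w wa wb] _]]]] := meet_dom cth Z0 ab ra rb.
have ab1' : (Some (flip a1), Some (flip b1)) \in flips th by rewrite flipsE /= !flipK.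
have [||/ideal_in_flips//|] := meet_dom cth' Z0' ab1'; rewrite ?rank_flip //.
case=> a2 [b2 [ab2 ra2 rb2 [w' wa' wb']]] H.
have {}wa : udom (flip a2) w by apply: (proj1 (H w)); rewrite flipK.
have {}wb : udom (flip b2) w by apply: (proj2 (H w)); rewrite flipK.
have ab2' : (Some (flip a2), Some (flip b2)) \in th by move: ab2; rewrite flipsE.
have [/existsP[x /andP[dax dbx]]|ndom] := boolP [exists x, udom a2 x && ~~ udom b2 x].
  by apply/ideal_in_flips; apply: drop_dom cth' Z0' ab2 rb2 dax dbx wa' wb'.
have [/existsP[x /andP[dax dbx]]|ncod] := boolP [exists x, udom (flip a2) x && ~~ udom (flip b2) x].
  by apply: drop_dom cth Z0 ab2' _ dax dbx wa wb; rewrite rank_flip.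
apply: drop_inside cth Z0 ab2' _ _ _ _; rewrite ?rank_flip ?flipK // => x dx.
  by apply: contraNT ncod => nx; apply/existsP; exists x; rewrite dx.
by apply: contraNT ndom => nx; apply/existsP; exists x; rewrite dx.
Qed.

(** By induction on [r]. When [b] has rank [r - 1] at least 2, merging two of its
   transversals lowers its rank, and lowers the rank of [a] by at most 1: this
   gives the ideal of rank [r - 1], to which [b] belongs. Rank 1 has no two
   transversals to merge, and is treated by cutting ([drop2]). *)
Lemma ideal_of_drop th a Y r : congruence (@tmul n) th -> ideal_in th 0 ->
    (Some a, Y) \in th -> r <= rank a -> low r Y -> ideal_in th r.
Proof.
move=> cth Z0; elim: r a Y => [//|r IH] a Y aY ra lY.
have [r0|r0] := posnP r; first by move: ra lY; rewrite r0 => ra lY; apply: ideal1 aY ra lY.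
suff Zr : ideal_in th r.
  by apply: (ideal_step cth _ ra Zr); apply: ctrans cth _ _ _ aY (Zr _ lY).
have [lY'|] := boolP (low r Y); first exact: IH aY (ltnW ra) lY'.
case: Y aY lY => // b ab; rewrite /= ltnS -leqNgt => rb1 rb2.
have rb : rank b = r by apply/eqP; rewrite eqn_leq rb1.
case: r r0 {rb1 rb2} rb IH ra => // -[|r] _ rb IH ra; first exact: drop2 cth Z0 ab ra rb.
have [X [Y [XY inj _]]] := reps_ex rb.
have [x1 [x2 [d1 d2 n12]]] : exists x1 x2, [/\ udom b x1, udom b x2 & up b x1 <> up b x2].
  exists (X ord0), (X ord_max); split=> [||/inj]; [exact: dom_ul (XY _)|exact: dom_ul (XY _)|by []].
have := cmull cth (Some (merger x1 x2)) ab; rewrite !merge_mul => ab'.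
apply: IH ab' _ _; last by rewrite /= -rb; apply: merge_rank_lt.
by rewrite -ltnS (leq_trans ra) // merge_rank_lb.
Qed.

End Bottom.

(** * What the pairs of a congruence look like above its ideal *)

Section Pairs.
Variable n : nat.
Implicit Types (a b c d g : part n) (X Y Z : tpart n) (th : {set tpart n * tpart n}).

Lemma same_rank th a Y : congruence (@tmul n) th -> ideal_in th 0 ->
    ~ ideal_in th (rank a) -> (Some a, Y) \in th ->
  exists2 b, Y = Some b & rank b = rank a.
Proof.
move=> cth Z0 nZ aY; have [lY|] := boolP (low (rank a) Y).
  by case: nZ; apply: ideal_of_drop cth Z0 aY _ lY.
case: Y aY => // b ab /=; rewrite -leqNgt leq_eqVlt => /orP[/eqP e|ltab].
  by exists b.
case: nZ; apply: (ideal_inW (ltnW ltab)).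
by apply: (@ideal_of_drop n th b (Some a)) => //; apply: csym cth _ _ ab.
Qed.

Lemma other_class a x k : rank a = k.+2 -> exists2 z, udom a z & up a x <> up a z.
Proof.
move=> ra; have [X [Y [XY inj _]]] := reps_ex ra.
have [e|ne] := eqVneq (up a x) (up a (X ord0)); last first.
  by exists (X ord0); [exact: dom_ul (XY _)|exact/eqP].
exists (X ord_max); first exact: dom_ul (XY _).
by rewrite e => /inj.
Qed.

Lemma other_class2 a x t k : rank a = k.+3 ->
  exists2 z, udom a z & up a x <> up a z /\ up a t <> up a z.
Proof.
move=> ra; have [X [Y [XY inj _]]] := reps_ex ra.
have [/forallP all|] := boolP [forall i, (up a (X i) == up a x) || (up a (X i) == up a t)]; last first.
  rewrite negb_forall => /existsP[i]; rewrite negb_or => /andP[/eqP nx /eqP nt].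
  by exists (X i); [exact: dom_ul (XY _)|split=> /esym].
pose i0 : 'I_k.+3 := ord0; pose i1 := lift i0 (ord0 : 'I_k.+2); pose i2 : 'I_k.+3 := ord_max.
have [n01 [n02 n12]] : i0 <> i1 /\ i0 <> i2 /\ i1 <> i2 by [].
have diff i j : i <> j -> up a (X i) <> up a (X j) by move=> nij /inj.
by case/orP: (all i0) => /eqP e0; case/orP: (all i1) => /eqP e1; case/orP: (all i2) => /eqP e2;
  first [by case: (diff _ _ n01); rewrite e0 e1 | by case: (diff _ _ n02); rewrite e0 e2
       | by case: (diff _ _ n12); rewrite e1 e2].
Qed.

Section Th.
Variable th : {set tpart n * tpart n}.
Hypotheses (cth : congruence (@tmul n) th) (Z0 : ideal_in th 0).

(** Merging an upper end [x] of a transversal of [a] into another transversal lowers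
   the rank of [a]; it does not lower that of [b] if [x] is no end there. *)
Lemma dom_sub a b : (Some a, Some b) \in th -> rank b = rank a -> 1 < rank a ->
  ~ ideal_in th (rank a) -> forall x, udom a x -> udom b x.
Proof.
move=> ab rb ra nZ x dx; apply: contra_notT nZ => nx.
have [k rk] : exists k, rank a = k.+2 by case: (rank a) ra => [|[|k]] // _; exists k.
have [z dz nxz] := other_class x rk.
have := cmull cth (Some (merger x z)) ab; rewrite !merge_mul => /(csym cth) ba'.
have rb' : rank (pmul (merger x z) b) = rank b by apply: merge_rank_keep; left.
apply: (ideal_of_drop cth Z0 ba'); first by rewrite rb' rb.
exact: merge_rank_lt.
Qed.

Lemma dom_eq a b : (Some a, Some b) \in th -> rank b = rank a -> 1 < rank a ->
  ~ ideal_in th (rank a) -> udom a =1 udom b.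
Proof.
move=> ab rb ra nZ x; apply/idP/idP; first exact: dom_sub.
by apply: dom_sub; rewrite ?rb //; apply: csym cth _ _ ab.
Qed.

(** If [x] and [y] lie in different transversals of [b], merging them lowers the rank
   of [b] only. Otherwise neither lies in a transversal of [a] or [b]; merging [x]
   into one takes [y] along in [a] only, against [dom_sub]. *)
Lemma up_sub a b : (Some a, Some b) \in th -> rank b = rank a -> 1 < rank a ->
  ~ ideal_in th (rank a) -> forall x y, up a x = up a y -> up b x = up b y.
Proof.
move=> ab rb ra nZ x y axy; apply/eqP/negPn/negP => /eqP bxy; apply: (nZ).
have dab := dom_eq ab rb ra nZ.
have [dbx|dbx] := boolP (udom b x).
  have dby : udom b y by rewrite -dab -(dom_up axy) dab.
  have := cmull cth (Some (merger x y)) ab; rewrite !merge_mul => ab'.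
  have ra' : rank (pmul (merger x y) a) = rank a by apply: merge_rank_keep; right.
  by apply: (ideal_of_drop cth Z0 ab'); rewrite ?ra' //= -rb; apply: merge_rank_lt.
have [w daw] : exists w, udom a w.
  by have /rank_gt0P[w [t /dom_ul]] := ltnW ra; exists w.
have dbw : udom b w by rewrite -dab.
have ndax : ~~ udom a x by rewrite dab.
have := cmull cth (Some (merger x w)) ab; rewrite !merge_mul => ab'.
have ra' : rank (pmul (merger x w) a) = rank a by apply: merge_rank_keep; left.
have rb' : rank (pmul (merger x w) b) = rank b by apply: merge_rank_keep; left.
have : udom (pmul (merger x w) b) y.
  apply: (dom_sub ab'); rewrite ?ra' ?rb' //.
  apply/dom_pmul; exists w => //; apply/merge_jc => /=.
  by rewrite axy eqxx; case: eqP.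
case/dom_pmul=> z /merge_jc /=.
have -> : (up b y == up b x) = false by apply/eqP => /esym.
case: eqP => [ezx _|_ e] dz; first by move: dbx; rewrite -(dom_up ezx) dz.
by move: dz; rewrite -(dom_up e) -dab -(dom_up axy) dab (negbTE dbx).
Qed.

(** Otherwise a block of [b] without lower part could be isolated, while [a] keeps
   rank 1. *)
Lemma up_sub1 a b : (Some a, Some b) \in th -> rank b = 1 -> rank a = 1 ->
  ~ ideal_in th 1 -> forall x y, up a x = up a y -> up b x = up b y.
Proof.
move=> ab rb ra nZ x y axy; apply/eqP/negPn/negP => /eqP bxy; apply: nZ.
have iso p q : up a p = up a q -> up b p <> up b q -> ~~ udom b p -> ideal_in th 1.
  move=> apq bpq dp; have [|c cz rc] := @isolate n th cth a b p (inl q) ab apq bpq.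
    by move=> t /dom_ul e; rewrite e in dp.
  apply: (ideal1 cth Z0 cz) => //.
  by apply: rc => //; rewrite ra.
have [dx|] := boolP (udom b x); last exact: iso axy bxy.
have [dy|] := boolP (udom b y); last by apply: (iso y x (esym axy)) => /esym.
have [/udomP[s xs] /udomP[t yt]] : udom b x /\ udom b y by [].
by case: bxy; apply: rank_le1 xs yt; rewrite rb.
Qed.

End Th.

Lemma same_pattern_of_th th a b : congruence (@tmul n) th -> ideal_in th 0 ->
    (Some a, Some b) \in th -> rank b = rank a -> 1 < rank a ->
    ~ ideal_in th (rank a) ->
  same_pattern a b.
Proof.
move=> cth Z0 ab rb ra nZ; have ba := csym cth ab.
have cth' := congruence_flips cth.
have Z0' : ideal_in (flips th) 0 by apply/ideal_in_flips.
have ab' : (Some (flip a), Some (flip b)) \in flips th by rewrite flipsE /= !flipK.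
have ba' := csym cth' ab'.
have nZ' : ~ ideal_in (flips th) (rank a) by move/ideal_in_flips.
split.
- by move=> x y; split; [apply: (up_sub cth Z0 ab)|apply: (up_sub cth Z0 ba)]; rewrite ?rb.
- apply/upK_flip => x y.
  by split; [apply: (up_sub cth' Z0' ab')|apply: (up_sub cth' Z0' ba')]; rewrite ?rank_flip ?rb.
- exact: (dom_eq cth Z0 ab rb ra nZ).
apply: (dom_eq cth' Z0' ab'); rewrite ?rank_flip ?rb //.
Qed.

Lemma mu_of_th th a b : congruence (@tmul n) th -> ideal_in th 0 ->
    (Some a, Some b) \in th -> rank b = 1 -> rank a = 1 -> ~ ideal_in th 1 ->
  mu_rel a b.
Proof.
move=> cth Z0 ab rb ra nZ; have ba := csym cth ab.
have cth' := congruence_flips cth.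
have Z0' : ideal_in (flips th) 0 by apply/ideal_in_flips.
have ab' : (Some (flip a), Some (flip b)) \in flips th by rewrite flipsE /= !flipK.
have ba' := csym cth' ab'.
have nZ' : ~ ideal_in (flips th) 1 by move/ideal_in_flips.
apply/muP; split=> [//|//||].
  by move=> x y; split; [apply: (up_sub1 cth Z0 ab)|apply: (up_sub1 cth Z0 ba)].
apply/upK_flip => x y.
by split; [apply: (up_sub1 cth' Z0' ab')|apply: (up_sub1 cth' Z0' ba')]; rewrite ?rank_flip.
Qed.

Lemma same_pattern_ext a b : same_pattern a b -> (forall x y, up a x = lo a y -> up b x = lo b y) -> a = b.
Proof.
case=> uk lk dk _ sub; apply: part_ext3 => // x y; split; first exact: sub.
move=> e; have /udomP[z xz] : udom a x by rewrite dk; apply: dom_ul e.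
by rewrite xz; apply/lk; rewrite -(sub _ _ xz).
Qed.

(** If [a] and [b] link [x] to different lower blocks, merging the transversal through
   [x] with a third one produces different lower kernels, in ranks at least
   2. *)
Lemma eq_of_th th a b r : congruence (@tmul n) th -> ideal_in th 0 ->
    (Some a, Some b) \in th -> rank a = r.+3 -> ~ ideal_in th r.+2 ->
  a = b.
Proof.
move=> cth Z0 ab ra nZ.
have nZ' : ~ ideal_in th (rank a) by rewrite ra => /(ideal_inW (leqnSn _)).
have [_ [<-] rb] := same_rank cth Z0 nZ' ab.
have pab : same_pattern a b by apply: same_pattern_of_th cth Z0 ab rb _ nZ'; rewrite ra.
apply: same_pattern_ext (pab) _ => x y axy; apply/eqP/negPn/negP => /eqP bxy.
have [uk lk dk ck] := pab.
have /udomP[z bxz] : udom b x by rewrite -dk; apply: dom_ul axy.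
have /codP[t atz] : udom (flip a) z by rewrite ck; apply: cod_ul bxz.
have [w daw [nxw ntw]] := other_class2 x t ra.
have /udomP[y2 wy2] := daw.
have := cmull cth (Some (merger x w)) ab; rewrite !merge_mul.
set a' := pmul _ a; set b' := pmul _ b => ab'.
have ra' : rank a' = r.+2.
  apply/eqP; rewrite eqn_leq; apply/andP; split.
    by rewrite -ltnS -ra; apply: merge_rank_lt => //; apply: dom_ul axy.
  by rewrite -ltnS -ra; apply: merge_rank_lb.
have nZ2 : ~ ideal_in th (rank a') by rewrite ra'.
have [_ [<-] rb'] := same_rank cth Z0 nZ2 ab'.
have [|_ lk' _ _] := same_pattern_of_th cth Z0 ab' rb' _ nZ2; first by rewrite ra'.
have : lo a' y = lo a' y2.
  apply/merge_lo; right; exists x, w; split=> //.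
  by rewrite eqxx; case: eqP.
move/lk'/merge_lo => [|[p [q [py qy2]]]].
  by move/lk=> e; case: nxw; rewrite axy wy2.
have -> : (up b p == up b x) = false by apply/eqP => e; apply: bxy; rewrite -e.
case: eqP => [eqx _|_ e].
  by case: ntw; rewrite atz wy2; apply/lk; rewrite -qy2 eqx.
by case: nxw; rewrite axy wy2; apply/lk; rewrite -py e.
Qed.

End Pairs.

(** * Classification of the congruences *)

Section Classification.
Variable n : nat.
Implicit Types (a b c d g : part n) (X Y Z : tpart n) (th : {set tpart n * tpart n}).

Lemma same_pattern_twisted a b q : same_pattern a b -> rank a = q ->
  exists (s : 'S_q) x y, twisted s a b x y.
Proof.
move=> [uk lk dk ck] /reps_ex[x [y rxy]]; have [xy inj _] := rxy.
have [_ _ cov] := reps_flip rxy.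
have /fin_all_exists[f fP] i : exists j, up b (x i) = lo b (y j).
  have /udomP[z bz] : udom b (x i) by rewrite -dk; apply: dom_ul (xy i).
  have [|j /up_flip/lk ej] := cov z; first by rewrite ck; apply: cod_ul bz.
  by exists j; rewrite bz.
have injf : injective f by move=> i j e; apply/inj/uk; rewrite !fP e.
by exists (perm injf), x, y; split=> // i; rewrite permE.
Qed.

Lemma twisted1 a b q (s : 'S_q) x y : same_pattern a b -> twisted s a b x y -> s = 1%g -> a = b.
Proof.
move=> pab [[xy inj cov] tw] s1; apply: (same_pattern_ext pab) => u v e.
have [uk lk _ _] := pab; have [i ei] := cov u (dom_ul e).
have /uk -> := ei; rewrite tw s1 perm1; apply/lk.
by rewrite -xy -ei.
Qed.

(** ** Model elements of each positive rank *)

Section Std.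
Variable q : nat.
Hypothesis qn : q < n.

Definition squeeze (x : 'I_n) : 'I_q.+1 := inord (minn x q).
Definition unsqueeze : 'I_q.+1 -> 'I_n := widen_ord qn.

Lemma unsqueezeK : cancel unsqueeze squeeze.
Proof.
move=> i; apply: val_inj; rewrite /squeeze /= inordK ?ltnS ?geq_minr //.
by apply/minn_idPl; rewrite -ltnS ltn_ord.
Qed.

(** A model with [q.+1] transversals permuted by [s]; all these models share their
   kernels, so each of them is a twist of each other. *)
Definition std (s : 'S_q.+1) : part n :=
  of_lab (fun v => match v with inl x => s (squeeze x) | inr y => squeeze y end).

Lemma std_up s x y : up (std s) x = up (std s) y <-> squeeze x = squeeze y.
Proof. by rewrite cls_of_lab; split=> [/perm_inj|->]. Qed.

Lemma std_lo s x y : lo (std s) x = lo (std s) y <-> squeeze x = squeeze y.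
Proof. exact: cls_of_lab. Qed.

Lemma std_ul s x y : up (std s) x = lo (std s) y <-> s (squeeze x) = squeeze y.
Proof. exact: cls_of_lab. Qed.

Lemma std_dom s x : udom (std s) x.
Proof. by apply: (@dom_ul _ _ _ (unsqueeze (s (squeeze x)))); apply/std_ul; rewrite unsqueezeK. Qed.

Lemma std_cod s y : udom (flip (std s)) y.
Proof.
apply: (@cod_ul _ _ (unsqueeze ((s^-1)%g (squeeze y)))); apply/std_ul.
by rewrite unsqueezeK permKV.
Qed.

Lemma std_pat s t : same_pattern (std s) (std t).
Proof.
split=> [x y|x y|x|y]; first by rewrite !std_up.
- by rewrite !std_lo.
- by rewrite !std_dom.
by rewrite !std_cod.
Qed.

(** The parameters [t] and [u] shift and renumber the model pair linked by [s]: this is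
   what closes [link_perms] under products and conjugation. *)
Lemma std_twisted (s t u : 'S_q.+1) :
  twisted (s ^ (u^-1))%g (std t) (std (s * t)%g) (unsqueeze \o u) (unsqueeze \o t \o u).
Proof.
split=> [|i]; last first.
  by apply/std_ul; rewrite /= !unsqueezeK conjgE invgK !permM permKV.
split=> [i|i j /std_up|z _] /=.
- by apply/std_ul; rewrite !unsqueezeK.
- by rewrite !unsqueezeK => /perm_inj.
by exists ((u^-1)%g (squeeze z)); apply/std_up; rewrite permKV unsqueezeK.
Qed.

Lemma std_twisted1 (s : 'S_q.+1) : twisted s (std 1) (std s) unsqueeze unsqueeze.
Proof.
split=> [|i]; last by apply/std_ul; rewrite !unsqueezeK.
split=> [i|i j /std_up|z _].
- by apply/std_ul; rewrite !unsqueezeK perm1.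
- by rewrite !unsqueezeK.
by exists (squeeze z); apply/std_up; rewrite unsqueezeK.
Qed.

Lemma std_rank s : rank (std s) = q.+1.
Proof. by have [/reps_rank] := std_twisted 1 s 1. Qed.

Lemma nu_std (N : {set 'S_q.+1}) s : s \in N -> nu_rel N (std 1) (std s).
Proof.
move=> sN; apply/nuP; split; first exact: std_pat.
by exists s => //; exists unsqueeze, unsqueeze; apply: std_twisted1.
Qed.

(** *** The normal subgroup attached to a congruence *)

Section Ngroup.
Variable th : {set tpart n * tpart n}.
Hypotheses (cth : congruence (@tmul n) th).

(** By [th_twisted], whether a pair of rank [q.+1] with common pattern belongs to
   [th] depends only on the permutation linking its transversals; the models
   collect these permutations. *)
Definition link_perms : {set 'S_q.+1} := [set s | (Some (std 1), Some (std s)) \in th].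

Lemma mem_link_perms s a b x y : same_pattern a b -> twisted s a b x y ->
  (Some a, Some b) \in th <-> s \in link_perms.
Proof.
move=> pab tab; have p1 := std_pat 1 s; have t1 := std_twisted1 s.
by rewrite inE; split=> h; [apply: th_twisted h pab p1 tab t1|apply: th_twisted h p1 pab t1 tab].
Qed.

Lemma link_perms_group : group_set link_perms.
Proof.
apply/group_setP; split; first by rewrite inE; apply: crefl cth _.
move=> s t sN tN; rewrite inE.
have := @mem_link_perms (s ^ (1^-1))%g (std t) (std (s * t)%g) _ _ (std_pat _ _) (std_twisted s t 1).
rewrite invg1 conjg1 => -[_ /(_ sN)]; move: tN; rewrite inE.
exact: ctrans cth _ _ _.
Qed.

Lemma link_perms_normal : ('Sym_('I_q.+1) \subset 'N(link_perms))%g.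
Proof.
apply/subsetP=> u _; rewrite inE; apply/subsetP=> _ /imsetP[s sN ->].
rewrite -[u]invgK; apply/(mem_link_perms (std_pat _ _) (std_twisted s 1 u^-1)).
by move: sN; rewrite inE mulg1.
Qed.

End Ngroup.

End Std.

Lemma ideal_dec th r : decidable (ideal_in th r).
Proof.
have [/forallP H|/negP H] := boolP [forall X : tpart n, low r.+1 X ==> ((X, None) \in th)].
  by left=> X; apply/implyP.
by right=> Z; apply: H; apply/forallP=> X; apply/implyP => /Z.
Qed.

(** Above the ideal only pairs of rank [q.+1] are left, up to equal elements, and
   these are described by their linking permutations. *)
Lemma RN_of_ideal th q : congruence (@tmul n) th -> 0 < q -> ideal_in th q ->
    ~ ideal_in th q.+1 ->
  exists2 N : {group 'S_q.+1}, (N <| 'Sym_('I_q.+1))%g & th = RN n N.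
Proof.
move=> cth q0 Zq nZ; have Z0 : ideal_in th 0 by apply: ideal_inW Zq.
have qn : q < n.
  rewrite ltnNge; apply/negP => nq; apply: nZ; case=> [a|] _; last exact: crefl cth _.
  by apply: Zq; rewrite /= ltnS (leq_trans (rank_leqn a)).
pose N := Group (link_perms_group qn cth); exists N.
  by apply/andP; split; [apply/subsetP=> s _; rewrite inE|apply: link_perms_normal].
apply/setP=> -[X Y]; apply/idP/extRP => [XY|]; last first.
  case=> [->|[lX lY]|/lift_relP[a [b [-> -> /nuP[pab [s sN [x [y tab]]]]]]]].
  - exact: crefl cth _.
  - exact: ctrans_zero cth _ _ (Zq _ lX) (Zq _ lY).
  exact/(mem_link_perms qn cth pab tab).
have big a Z : (Some a, Z) \in th -> q < rank a ->
    Some a = Z \/ exists2 b, Z = Some b & nu_rel N a b.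
  move=> aZ ra.
  have nZa : ~ ideal_in th (rank a) by move/(ideal_inW ra).
  have [b Zb rb] := same_rank cth Z0 nZa aZ; rewrite Zb in aZ *.
  have ra1 : 1 < rank a by apply: leq_trans ra.
  have pab := same_pattern_of_th cth Z0 aZ rb ra1 nZa.
  have [ra'|ra'] := eqVneq (rank a) q.+1.
    right; exists b => //; apply/nuP; split=> //.
    have [s [x [y tab]]] := same_pattern_twisted pab ra'; exists s; last by exists x, y.
    exact/(mem_link_perms qn cth pab tab).
  left; congr Some; have q2a : q.+1 < rank a by rewrite ltn_neqAle eq_sym ra' ra.
  have [r er] : exists r, rank a = r.+3.
    by exists (rank a - 3); rewrite -addn3 subnK // (leq_trans _ q2a) // !ltnS.
  apply: (eq_of_th cth Z0 aZ er) => /(ideal_inW _) H; apply: nZ; apply: H.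
  by rewrite -ltnS -er.
have [lX|] := boolP (low q.+1 X).
  have [lY|] := boolP (low q.+1 Y); first by constructor 2.
  case: Y XY => // b /(csym cth) ba /=; rewrite -leqNgt => rb.
  case: (big _ _ ba rb) => [<-|[a Xa /nu_sym ab]]; first by constructor 1.
  by constructor 3; rewrite Xa lift_relE.
case: X XY => // a aY /=; rewrite -leqNgt => ra.
case: (big _ _ aY ra) => [<-|[b Yb ab]]; first by constructor 1.
by constructor 3; rewrite Yb lift_relE.
Qed.

Lemma RN1 q : RN n (1%G : {group 'S_q.+1}) = Rees n (Some q).
Proof.
apply/setP=> -[X Y]; apply/extRP/idP => [|]; rewrite ReesE.
  case=> [->|[-> ->]|/lift_relP[a [b [-> -> /nuP[pab [s + [x [y tab]]]]]]]].
  - by rewrite eqxx.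
  - by rewrite orbT.
  by rewrite inE => /eqP s1; rewrite (twisted1 pab tab s1) eqxx.
by case/orP=> [/eqP->|/andP[lX lY]]; [constructor 1|constructor 2].
Qed.

Lemma ideal_n th : ideal_in th n -> congruence (@tmul n) th -> th = Rees n (Some n).
Proof.
move=> Zn cth; have low_n X : low n.+1 X by case: X => //= a; rewrite ltnS rank_leqn.
apply/setP=> -[X Y]; rewrite ReesE !low_n orbT.
exact: ctrans_zero cth _ _ (Zn _ (low_n _)) (Zn _ (low_n _)).
Qed.

(** ** Congruences containing only the ideal of rank 0 *)

Lemma mu_ext_dom a b : mu_rel a b -> udom a =1 udom b -> udom (flip a) =1 udom (flip b) ->
  a = b.
Proof.
case/muP=> ra rb uk lk dk ck; apply: same_pattern_ext => [//|x y e].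
have /udomP[t xt] : udom b x by rewrite -dk; apply: dom_ul e.
have /codP[s sy] : udom (flip b) y by rewrite -ck; apply: cod_ul e.
by rewrite -sy; apply: rank_le1 xt sy; rewrite rb.
Qed.

(** Mapping the transversal of [a] to that of [g], that of [b] to that of [g'], and
   all lower vertices to the common lower end, one moves [(a, b)] to [(g, g')]. *)
Lemma mu_down_in th a b : congruence (@tmul n) th -> (Some a, Some b) \in th ->
    mu_rel a b -> ~ udom a =1 udom b -> ideal_in th 0 ->
  mu_down n \subset th.
Proof.
move=> cth ab /muP[ra rb uk lk] nd Z0.
have /rank_gt0P[x [y xy]] : 0 < rank a by rewrite ra.
have /rank_gt0P[x' [y' xy']] : 0 < rank b by rewrite rb.
have oneb z w : up b z = lo b w -> up a z = up a x'.
  by move=> e; apply/uk/(rank_le1 _ e xy'); rewrite rb.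
have onea z w : up a z = lo a w -> up a z = up a x.
  by move=> e; apply: rank_le1 e xy; rewrite ra.
have nxx : up a x <> up a x'.
  move=> e; case: nd => z; apply/udomP/udomP => -[t zt].
    by exists y'; rewrite -xy'; apply/uk; rewrite (onea _ _ zt).
  by exists y; rewrite -xy e; apply: oneb zt.
apply/subsetP=> -[X Y] /extRP[->|[lX lY]|/lift_relP[g [g' [-> -> /mu_greenLP[/muP[rg rg' gk hk] dg]]]]].
- exact: crefl cth _.
- exact: ctrans_zero cth _ _ (Z0 _ lX) (Z0 _ lY).
have /rank_gt0P[e [v ev]] : 0 < rank g by rewrite rg.
have /codP[e' ev'] : udom (flip g') v by rewrite -dg; apply: cod_ul ev.
pose phi z := if up a z == up a x' then e' else e.
apply: (@th_morph _ _ cth a b g g' phi (fun _ => v)) => //; split=> //.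
- by move=> z w ezw; rewrite /phi ezw.
- move=> z w /onea ez; rewrite /phi ez; case: eqP => // _.
- move=> z /udomP[t zt]; exists x; first exact: dom_ul xy.
  by rewrite /phi; case: eqP => // _; apply: rank_le1 zt ev; rewrite rg.
- by move=> z w /uk ezw; rewrite /phi ezw.
- by move=> z w /oneb ez; rewrite /phi ez eqxx.
- move=> z /udomP[t zt]; exists x'; first exact: dom_ul xy'.
  by rewrite /phi eqxx; apply: rank_le1 zt ev'; rewrite rg'.
Qed.

Lemma mu_flips_sub th : mu_down n \subset flips th -> mu_up n \subset th.
Proof.
move=> /subsetP sub; apply/subsetP=> -[X Y] XY.
have := sub (tflip X, tflip Y); rewrite flipsE !tflipK; apply.
by apply: (extR_flip (r := @mu_greenR n)) XY => a b; apply: muR_flip.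
Qed.

Lemma mu_up_in th a b : congruence (@tmul n) th -> (Some a, Some b) \in th ->
    mu_rel a b -> ~ udom (flip a) =1 udom (flip b) -> ideal_in th 0 ->
  mu_up n \subset th.
Proof.
move=> cth ab mab nd Z0; apply: mu_flips_sub.
apply: (@mu_down_in (flips th) (flip a) (flip b) _ _ _ nd).
- exact: congruence_flips.
- by rewrite flipsE /= !flipK.
- exact: mu_flip.
exact/ideal_in_flips.
Qed.

(** Take the upper end of the transversal of [a] and the lower end of that of
   [b]. *)
Lemma mu_between a b : mu_rel a b -> exists2 c, mu_greenR a c & mu_greenL c b.
Proof.
case/muP=> ra rb uk lk.
have /rank_gt0P[x [y xy]] : 0 < rank a by rewrite ra.
have /rank_gt0P[x' [y' xy']] : 0 < rank b by rewrite rb.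
(* [None] is the label of the single transversal. *)
pose f (v : vertex n) : option ({set vertex n} + {set vertex n}) := match v with
  | inl z => if up a z == up a x then None else Some (inl (up a z))
  | inr w => if lo a w == lo a y' then None else Some (inr (lo a w)) end.
pose c := of_lab f.
have ck : upK a c.
  move=> z w; rewrite cls_of_lab /=; split=> [->//|].
  by case: eqP => [->|_]; case: eqP => [->|_] // [].
have cl : loK a c.
  move=> z w; rewrite cls_of_lab /=; split=> [->//|].
  by case: eqP => [->|_]; case: eqP => [->|_] // [].
have cul z w : up c z = lo c w <-> up a z = up a x /\ lo a w = lo a y'.
  rewrite cls_of_lab /=; split=> [|[-> ->]]; last by rewrite !eqxx.
  by case: eqP => [->|_]; case: eqP => [->|_].
have cxy : up c x = lo c y' by apply/cul.
have rc : rank c = 1.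
  apply/eqP; rewrite eqn_leq (rank_gt0 cxy) andbT.
  apply: (@rank_le _ _ _ (fun _ => x)) => z /udomP[w /cul[/ck e _]].
  by exists ord0.
exists c.
  apply/mu_greenRP; split; first by apply/muP.
  move=> z; apply/udomP/udomP => -[w e].
    by exists y'; apply/cul; split=> //; apply: rank_le1 e xy; rewrite ra.
  by exists y; case/cul: e => -> _.
apply/mu_greenLP; split.
  by apply/muP; split=> //; [apply: upK_trans (upK_sym ck) uk|apply: loK_trans (loK_sym cl) lk].
move=> w; apply/codP/codP => -[z e].
  by exists x'; rewrite xy'; apply/lk; case/cul: e => _ ->.
exists x; apply/cul; split=> //; apply/lk.
by rewrite -e -xy'; apply/esym/(rank_le1 _ xy' e); rewrite rb.
Qed.

Lemma mu_join th : congruence (@tmul n) th -> mu_up n \subset th -> mu_down n \subset th ->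
  mu n \subset th.
Proof.
move=> cth /subsetP su /subsetP sd; apply/subsetP=> -[X Y] XY.
case/extRP: (XY) => [->|[lX lY]|/lift_relP[a [b [-> -> /mu_between[c ac cb]]]]].
- exact: crefl cth _.
- by apply: su; apply: extR_low.
apply: (@ctrans _ th cth _ (Some c)).
  by apply: su; apply/extRP; constructor 3; rewrite lift_relE.
by apply: sd; apply/extRP; constructor 3; rewrite lift_relE.
Qed.

(** Keeping of all transversals only the one of [a] through [x] turns a difference in
   linking into a difference of lower ends. *)
Lemma cod_differ th a b x y : congruence (@tmul n) th -> (Some a, Some b) \in th ->
    same_pattern a b -> up a x = lo a y -> up b x <> lo b y ->
  exists a' b', [/\ (Some a', Some b') \in th, up a' x = lo a' y,
    ~~ udom (flip b') y & rank a' <= rank a].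
Proof.
move=> cth ab [uk lk dk ck] e nb.
pose S := [set z | udom a z && (up a z != up a x)].
have satS z w : up a z = up a w -> (z \in S) = (w \in S).
  by move=> ezw; rewrite !inE (dom_up ezw) ezw.
have abs u v : jc (cut a S) b u = jc (cut a S) b v <-> cls (cut a S) u = cls (cut a S) v.
  by apply: jc_absorb => z w /uk ezw; apply/cls_of_lab; rewrite ezw (satS _ _ ezw).
have Pa c : (forall z, udom a z -> udom c z) -> Phi (cut a S) c == 0.
  move=> dc; apply/Phi0_left=> z; have [zS|zS] := boolP (z \in S).
    have /udomP[t zt] : udom c z by apply: dc; move: zS; rewrite inE => /andP[].
    by right; exists z, t.
  by left; exists z; rewrite cut_top.
have := cmull cth (Some (cut a S)) ab.
rewrite !tmul_some ?Pa // => [ab'|z]; last by rewrite dk.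
exists (pmul (cut a S) a), (pmul (cut a S) b); split=> //; last exact: rank_pmull.
  apply/pmul_ul; exists x => //; apply: cut_top.
  by rewrite inE eqxx andbF.
apply/codP => -[s /pmul_ul[z]]; rewrite abs cls_of_lab => -[_ zS] zy.
move: zS; rewrite inE dk (dom_ul zy) /= => /esym/negbFE/eqP/uk exz.
by apply: nb; rewrite -exz.
Qed.

Lemma cod_differ1 th a b : congruence (@tmul n) th -> ideal_in th 0 -> ~ ideal_in th 1 ->
    (Some a, Some b) \in th -> rank a = 2 -> a <> b ->
  mu_up n \subset th.
Proof.
move=> cth Z0 nZ ab ra nab.
have nZa : ~ ideal_in th (rank a) by rewrite ra => /(ideal_inW (leqnSn _)).
have [_ [<-] rb] := same_rank cth Z0 nZa ab.
have pab : same_pattern a b by apply: (same_pattern_of_th cth Z0 ab rb _ nZa); rewrite ra.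
have [/existsP[x /existsP[y /andP[/eqP axy /eqP bxy]]]|none] :=
  boolP [exists x, exists y, (up a x == lo a y) && (up b x != lo b y)]; last first.
  case: nab; apply: (same_pattern_ext pab) => x y /eqP axy; apply/eqP; apply: contraNT none => bxy.
  by apply/existsP; exists x; apply/existsP; exists y; rewrite axy.
have [a' [b' [ab' axy' nby ra']]] := cod_differ cth ab pab axy bxy.
have r0 := rank_gt0 axy'.
have nZa' : ~ ideal_in th (rank a') by move/(ideal_inW r0).
have [_ [<-] rb'] := same_rank cth Z0 nZa' ab'.
have cod_ne : ~ udom (flip a') =1 udom (flip b').
  by move=> H; move: nby; rewrite -H (cod_ul axy').
have ra1 : rank a' = 1.
  apply/eqP; rewrite eqn_leq r0 andbT leqNgt; apply/negP => r1.
  by case: (same_pattern_of_th cth Z0 ab' rb' r1 nZa').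
apply: (mu_up_in cth ab' _ cod_ne Z0).
by apply: (mu_of_th cth Z0 ab' _ ra1 nZ); rewrite rb'.
Qed.

Lemma perm_I2 (s t : 'S_2) : s != 1%g -> t != 1%g -> s = t.
Proof.
have val2 (i : 'I_2) : i = ord0 \/ i = lift ord0 ord0.
  by case: i => [[|[|i]] Hi] //; [left|right]; apply: val_inj.
have key (u : 'S_2) : u != 1%g -> u ord0 = lift ord0 ord0 /\ u (lift ord0 ord0) = ord0.
  move=> nu; case: (val2 (u ord0)) => e0; case: (val2 (u (lift ord0 ord0))) => e1.
  - by have := perm_inj (etrans e0 (esym e1)).
  - by case/eqP: nu; apply/permP=> i; rewrite perm1; case: (val2 i) => ->.
  - by [].
  - by have := perm_inj (etrans e0 (esym e1)).
move=> /key[s0 s1] /key[t0 t1]; apply/permP=> i.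
by case: (val2 i) => ->; rewrite ?s0 ?s1 ?t0 ?t1.
Qed.

(** Pairs of distinct elements outside the ideal have rank 1 and lie in [mu], or have
   rank 2 and are linked by the transposition. One pair of rank 2 with distinct members
   brings everything along ([cod_differ1] and its dual). Without such a pair it
   remains to see whether the domains, and whether the codomains, of related
   elements of rank 1 can differ. *)
Lemma small_congruences th : congruence (@tmul n) th -> ideal_in th 0 -> ~ ideal_in th 1 ->
  [\/ th = Rees n (Some 0), th = mu_up n \/ th = mu_down n, th = mu n | th = mu_S2 n].
Proof.
move=> cth Z0 nZ.
have R0 : Rees n (Some 0) \subset th by apply/(ideal_in_Rees cth).
have big a Y : (Some a, Y) \in th -> 0 < rank a ->
    Some a = Y \/ exists2 b, Y = Some b & muS2 a b.
  move=> aY ra; have nZa : ~ ideal_in th (rank a) by move/(ideal_inW ra).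
  have [b Yb rb] := same_rank cth Z0 nZa aY; rewrite Yb in aY *.
  case era : (rank a) ra => [|[|[|r]]] // _.
  - right; exists b => //; apply/orP; left; apply: (mu_of_th cth Z0 aY _ era nZ).
    by rewrite rb era.
  - right; exists b => //; apply/orP; right.
    have pab : same_pattern a b by apply: (same_pattern_of_th cth Z0 aY rb _ nZa); rewrite era.
    have [s [x [y tab]]] := same_pattern_twisted pab era.
    by apply/nuP; split=> //; exists s; rewrite ?inE //; exists x, y.
  left; congr Some; apply: (eq_of_th cth Z0 aY era).
  by move/(@ideal_inW _ _ r.+2 1 isT)/nZ.
have th_sub : th \subset mu_S2 n.
  rewrite mu_S2E; apply/subsetP=> -[X Y] XY; apply/extRP.
  have [lX|] := boolP (low 1 X).
    have [lY|] := boolP (low 1 Y); first by constructor 2.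
    case: Y XY => // b /(csym cth) ba /=; rewrite -leqNgt => rb.
    case: (big _ _ ba rb) => [<-|[a Xa /muS2_sym ab]]; first by constructor 1.
    by constructor 3; rewrite Xa lift_relE.
  case: X XY => // a aY /=; rewrite -leqNgt => ra.
  case: (big _ _ aY ra) => [<-|[b Yb ab]]; first by constructor 1.
  by constructor 3; rewrite Yb lift_relE.
have [/existsP[a /existsP[b /and3P[ab /eqP ra /eqP nab]]]|no2] :=
  boolP [exists a, exists b, [&& (Some a, Some b) \in th, rank a == 2 & a != b]].
  constructor 4; apply/eqP; rewrite eqEsubset th_sub /=.
  have su := cod_differ1 cth Z0 nZ ab ra nab.
  have sd : mu_down n \subset th.
    have cth' := congruence_flips cth.
    have : mu_up n \subset flips th.
      apply: (@cod_differ1 (flips th) (flip a) (flip b)) => //.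
      - exact/ideal_in_flips.
      - by move/ideal_in_flips.
      - by rewrite flipsE /= !flipK.
      - by rewrite rank_flip.
      by move/(congr1 (@flip n)); rewrite !flipK.
    move/subsetP=> sub; apply/subsetP=> -[X Y] XY.
    have := sub (tflip X, tflip Y); rewrite flipsE !tflipK; apply.
    by apply: (extR_flip (r := @mu_greenL n)) XY => c d; apply: muL_flip.
  have sm := mu_join cth su sd; rewrite subUset sm /=.
  apply/subsetP=> -[X Y] /lift_relP[g [g' [-> -> /nuP[pgg [s _ [u [v tgg]]]]]]].
  have [s1|ns] := eqVneq s 1%g; first by rewrite (twisted1 pgg tgg s1); apply: crefl cth _.
  have nZa : ~ ideal_in th (rank a) by rewrite ra => /(ideal_inW (leqnSn _)).
  have [_ [<-] rb] := same_rank cth Z0 nZa ab.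
  have pab : same_pattern a b by apply: (same_pattern_of_th cth Z0 ab rb _ nZa); rewrite ra.
  have [t [x [y tab]]] := same_pattern_twisted pab ra.
  have nt : t != 1%g by apply/eqP => /(twisted1 pab tab).
  rewrite (perm_I2 ns nt) in tgg.
  exact: (th_twisted cth _ ab pab pgg tab tgg).
have th_mu X Y : (X, Y) \in th -> [\/ X = Y, low 1 X /\ low 1 Y | 
    exists a b, [/\ X = Some a, Y = Some b & mu_rel a b]].
  move=> XY; have := subsetP th_sub _ XY; rewrite mu_S2E.
  case/extRP=> [->|[lX lY]|/lift_relP[a [b [Xa Yb /orP[ab|ab]]]]].
  - by constructor 1.
  - by constructor 2.
  - by constructor 3; exists a, b.
  constructor 1; rewrite Xa Yb in XY *; congr Some; apply/eqP.
  apply: contraNT no2 => nab; apply/existsP; exists a; apply/existsP; exists b.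
  by rewrite XY nab (nu_rank ab) eqxx.
have sub_of (r : rel (part n)) :
    (forall a b, (Some a, Some b) \in th -> mu_rel a b -> a <> b -> r a b) ->
    th \subset extR 0 r.
  move=> H; apply/subsetP=> -[X Y] XY; apply/extRP.
  have [<-|nXY] := eqVneq X Y; first by constructor 1.
  case: (th_mu _ _ XY) => [->|lXY|[a [b [Xa Yb ab]]]]; [by constructor 1|by constructor 2|].
  constructor 3; rewrite Xa Yb in XY nXY *; rewrite lift_relE; apply: H => // e.
  by rewrite e eqxx in nXY.
have dec (P : part n -> pred 'I_n) : 
   (exists a b, [/\ (Some a, Some b) \in th, mu_rel a b & ~ P a =1 P b]) \/
   (forall a b, (Some a, Some b) \in th -> mu_rel a b -> P a =1 P b).
  have [/existsP[a /existsP[b /and3P[ab mab /existsP[x /eqP nP]]]]|none] := boolP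
     [exists a, exists b, [&& (Some a, Some b) \in th, mu_rel a b & [exists x, P a x != P b x]]].
    by left; exists a, b; split=> // /(_ x).
  right=> a b ab mab x; apply/eqP; apply: contraNT none => nP.
  by apply/existsP; exists a; apply/existsP; exists b; rewrite ab mab; apply/existsP; exists x.
have [[a [b [ab mab nd]]]|domE] := dec (@udom n).
  have sd := mu_down_in cth ab mab nd Z0.
  have [[a2 [b2 [ab2 mab2 nd2]]]|codE] := dec (fun a => udom (flip a)).
    have su := mu_up_in cth ab2 mab2 nd2 Z0.
    constructor 3; apply/eqP; rewrite eqEsubset (mu_join cth su sd) andbT.
    by apply: (sub_of (@mu_rel n)).
  constructor 2; right; apply/eqP; rewrite eqEsubset sd andbT.
  by apply: (sub_of (@mu_greenL n)) => a2 b2 ab2 mab2 _; apply/mu_greenLP; split=> //; apply: codE.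
have [[a2 [b2 [ab2 mab2 nd2]]]|codE] := dec (fun a => udom (flip a)).
  have su := mu_up_in cth ab2 mab2 nd2 Z0.
  constructor 2; left; apply/eqP; rewrite eqEsubset su andbT.
  by apply: (sub_of (@mu_greenR n)) => a b ab mab _; apply/mu_greenRP; split=> //; apply: domE.
constructor 1; apply/eqP; rewrite eqEsubset R0 andbT Rees_extR.
apply: sub_of => a b ab mab nab; case: nab; apply: mu_ext_dom => //.
  exact: domE.
exact: codE.
Qed.

End Classification.

(** * The normal subgroups of a symmetric group form a chain *)

Section NormalChain.
Local Open Scope group_scope.

(** The order of the coset of [x] divides both coprime numbers. *)
Lemma coprime_index_mem (gT : finGroupType) (G N : {group gT}) x :
  N <| G -> x \in G -> coprime #[x] #|G : N| -> x \in N.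
Proof.
move=> nNG xG cop; have /subsetP/(_ _ xG) nx := normal_norm nNG.
apply: coset_idr => //; apply/eqP; rewrite -order_eq1 -dvdn1 -(eqnP cop) dvdn_gcd.
rewrite order_dvdn -morphX // expg_order morph1 eqxx /=.
by rewrite -card_quotient ?normal_norm // order_dvdG // mem_quotient.
Qed.

Variable m : nat.
Hypothesis m3 : 2 < m.
Implicit Types N M : {group 'S_m}.
Local Notation S := 'Sym_('I_m).
Local Notation A := 'Alt_('I_m).

Lemma third_point (x y : 'I_m) : exists z, z != x /\ z != y.
Proof.
have [/existsP[z /andP[zx zy]]|] := boolP [exists z, (z != x) && (z != y)]; first by exists z.
rewrite negb_exists => /forallP all.
have : #|[set: 'I_m]| <= #|[set x; y]|.
  apply/subset_leq_card/subsetP=> z _; rewrite !inE.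
  by have := all z; rewrite negb_and !negbK.
by rewrite cardsT card_ord cards2 leqNgt; case: eqP; rewrite ?(ltnW m3) ?m3.
Qed.

(** A nontrivial element of a normal subgroup of order at most 2 is central, but
   conjugating it by a transposition that moves the image of a moved point
   changes it. *)
Lemma small_normal N : N <| S -> #|N| <= 2 -> N = 1%G.
Proof.
move=> /normal_norm/subsetP nN N2; apply/trivGP/subsetP=> s sN; rewrite inE.
apply/negPn/negP => s1.
have [x sx] : exists x, s x != x.
  apply/existsP; apply: contraNT s1; rewrite negb_exists => /forallP all.
  by apply/eqP/permP=> x; rewrite perm1; apply/eqP; rewrite -[_ == _]negbK.
have [z [zx zy]] := third_point x (s x); pose t := tperm (s x) z.
have tN : s ^ t \in N by rewrite memJ_norm // nN ?inE.
have : #|[set 1; s; s ^ t]| <= 2.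
  by apply: leq_trans (subset_leq_card _) N2; rewrite !subUset !sub1set group1 sN tN.
have nt : s ^ t != s.
  apply/eqP => /permP/(_ x); rewrite conjgE !permM tpermV tpermD //.
  by rewrite tpermL => e; rewrite e eqxx in zy.
have n1 : s ^ t != 1 by rewrite conjg_eq1.
by rewrite -setUA cardsU1 cards2 !inE negb_or eq_sym s1 eq_sym n1 eq_sym nt.
Qed.

Lemma over_Alt N : A \subset N -> N = A :> {set _} \/ N = S :> {set _}.
Proof.
move=> sAN; have [e|nAN] := eqVneq (N : {set _}) A; [by left|right].
have sNS : N \subset S by apply/subsetP=> s _; rewrite inE.
apply/eqP; rewrite eqEsubset sNS /= -indexg_eq1.
move: (Lagrange_index sNS sAN); rewrite Alt_index ?card_ord ?(ltnW m3) // => e2.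
have nNA2 : 1 < #|N : A| by rewrite indexg_gt1; apply: contra nAN => sNA; rewrite eqEsubset sNA.
rewrite eqn_leq indexg_gt0 andbT -(leq_pmul2r (isT : 0 < 2)) mul1n.
by rewrite -[leqRHS]e2 leq_mul2l nNA2 orbT.
Qed.

Lemma cycle3_cube (x y z : 'I_m) : x != y -> y != z -> x != z ->
  (tperm x y * tperm y z) ^+ 3 = 1.
Proof.
move=> xy yz xz; set c := _ * _.
have cx : c x = z by rewrite permM tpermL tpermL.
have cy : c y = x by rewrite permM tpermR tpermD // eq_sym.
have cz : c z = y by rewrite permM [tperm x y z]tpermD // tpermR.
have cid i : i != x -> i != y -> i != z -> c i = i.
  by move=> ix iy iz; rewrite permM [tperm x y i]tpermD 1?eq_sym // tpermD 1?eq_sym.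
move: c cx cy cz cid => c cx cy cz cid.
apply/permP=> i; rewrite !expgS expg0 mulg1 !permM perm1.
have [->|ix] := eqVneq i x; first by rewrite cx cz cy.
have [->|iy] := eqVneq i y; first by rewrite cy cx cz.
have [->|iz] := eqVneq i z; first by rewrite cz cy cx.
by rewrite !cid.
Qed.

(** An even permutation is a product of pairs of transpositions, and inserting
   the square of the transposition of [y] and [z] makes each pair a product of
   two 3-cycles. *)
Lemma Alt_sub_of_cycle3 N :
    (forall x y z : 'I_m, x != y -> y != z -> x != z -> tperm x y * tperm y z \in N) ->
  A \subset N.
Proof.
move=> H.
have H2 (x y z t : 'I_m) : x != y -> z != t -> tperm x y * tperm z t \in N.
  move=> xy zt.
  have H1 (u v w : 'I_m) : u != v -> v != w -> tperm u v * tperm v w \in N.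
    move=> uv vw; have [<-|uw] := eqVneq u w; last exact: H.
    by rewrite [tperm v u]tpermC tperm2 group1.
  have [e|yz] := eqVneq y z; first by rewrite -e in zt *; apply: H1.
  have -> : tperm x y * tperm z t = (tperm x y * tperm y z) * (tperm y z * tperm z t).
    by rewrite -!mulgA; congr (_ * _); rewrite mulgA tperm2 mul1g.
  by rewrite groupM // H1.
apply/subsetP=> s; rewrite Alt_even; have [ts -> /=] := prod_tpermP s.
have [k] := ubnP (size ts); elim: k ts => // k IH [|[x y] [|[z t] ts]] /=; rewrite ?big_nil ?group1 //.
  by rewrite big_seq1 => _ /andP[/= xy _]; rewrite odd_tperm xy.
rewrite ltnS => sz /and3P[/= xy zt dts].
rewrite !big_cons /= mulgA odd_permM odd_permM !odd_tperm xy zt /= => ev.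
by rewrite groupM ?H2 // IH //; apply: ltnW.
Qed.

Lemma index_Alt_inter N : ~~ (N \subset A) -> #|N| = (2 * #|N :&: A|)%N.
Proof.
move=> nNA; have ind2 := @Alt_index 'I_m; rewrite card_ord (ltnW m3) in ind2.
rewrite -(Lagrange (subsetIl N A)) mulnC; congr (_ * _)%N.
rewrite indexgI; apply/eqP; rewrite eqn_leq indexg_gt1 nNA andbT -(ind2 isT).
by apply: subset_leq_card; rewrite imsetS //; apply/subsetP=> s _; rewrite inE.
Qed.

Lemma normal_simple N : simple A -> N <| S -> N = 1%G \/ A \subset N.
Proof.
move=> /simpleP[_ simA] nN.
have nNA : N :&: A <| A.
  apply: normalS (normalI nN (Alt_normal _)); rewrite ?subsetIr //.
  exact: normal_sub (Alt_normal _).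
case: (simA [group of N :&: A] nNA) => /= e; last by right; rewrite -e subsetIl.
left; apply: small_normal => //.
have [sNA|/index_Alt_inter ->] := boolP (N \subset A); last by rewrite e cards1.
by move/setIidPl: sNA => <-; rewrite e cards1.
Qed.

(** If 3 divides the order of [N], the index is prime to 3 and [N] contains all
   3-cycles. Otherwise the order divides 8. It cannot be 8, as the index would be 3
   and all transpositions, hence a 3-cycle, would lie in [N]; and [N] of order 4 with
   an odd element would meet the alternating group in a normal subgroup of order
   2. *)
Lemma normal4 N : m = 4 -> N <| S -> [\/ N = 1%G, #|N| = 4 /\ N \subset A | A \subset N].
Proof.
move=> m4 nN; have cS : #|S| = 24 by rewrite card_Sym card_ord m4.
have dN : #|N| %| 24 by rewrite -cS cardSg ?normal_sub.
have LN : (#|N| * #|S : N|)%N = 24 by rewrite Lagrange ?normal_sub.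
have [d3|nd3] := boolP (3 %| #|N|).
  constructor 3; apply: Alt_sub_of_cycle3 => x y z xy yz xz.
  apply: (coprime_index_mem nN); rewrite ?inE //.
  have : #[tperm x y * tperm y z] %| 3 by rewrite order_dvdn cycle3_cube.
  have {LN d3} : coprime 3 #|S : N|.
    rewrite prime_coprime //; apply/negP => d3'; have := dvdn_mul d3 d3'.
    by rewrite LN.
  by move=> co /coprime_dvdl; apply.
have dN8 : #|N| %| 8.
  by rewrite -(@Gauss_dvdr _ 3) // coprime_sym prime_coprime.
have n8 : #|N| != 8.
  apply/eqP => e8; case/negP: nd3; move: LN; rewrite e8 => /eqP; rewrite -[24]/(8 * 3)%N eqn_mul2l /= => /eqP ind3.
  have tN (x y : 'I_m) : tperm x y \in N.
    apply: (coprime_index_mem nN); rewrite ?inE // ind3.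
    have : #[tperm x y] %| 2 by rewrite order_dvdn expgS expg1 tperm2.
    by move/coprime_dvdl; apply.
  pose x : 'I_m := cast_ord (esym m4) ord0.
  have [y [yx _]] := third_point x x; have [z [zx zy]] := third_point x y.
  have c3 : #[tperm x y * tperm y z] = 3.
    have : #[tperm x y * tperm y z] %| 3 by rewrite order_dvdn cycle3_cube // eq_sym.
    case/primeP: (isT : prime 3) => _ /[apply] /orP[|/eqP//].
    rewrite order_eq1 => /eqP/permP/(_ x); rewrite permM tpermL tpermL perm1 => e.
    by rewrite e eqxx in zx.
  by rewrite -e8 -c3 order_dvdG // groupM.
have : #|N| \in divisors 8 by rewrite -dvdn_divisors.
rewrite !inE (negbTE n8) orbF => /or3P[/eqP e|/eqP e|/eqP e].
- by constructor 1; apply: small_normal; rewrite ?e.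
- by constructor 1; apply: small_normal; rewrite ?e.
constructor 2; split=> //; apply/negPn/negP => /index_Alt_inter h.
have e2 : #|N :&: A| = 2 by apply/eqP; rewrite -(eqn_pmul2l (isT : 0 < 2)) -h e.
have : [group of N :&: A] = 1%G.
  by apply: small_normal; rewrite /= ?e2 //; apply: normalI nN (Alt_normal _).
by move/(congr1 (fun G : {group _} => #|G|)); rewrite /= e2 cards1.
Qed.

(** In degree 4, two normal subgroups of order 4 generate a normal 2-group, which has
   order 4 by [normal4], so they are equal. *)
Lemma normal_chain N M : N <| S -> M <| S -> N \subset M \/ M \subset N.
Proof.
move=> nN nM; have sS (K : {group 'S_m}) : K \subset S by apply/subsetP=> s _; rewrite inE.
have [m4|nm4] := eqVneq m 4; last first.
  have simA : simple A.
    have := m3; rewrite leq_eqVlt => /orP[/eqP m_3|].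
      by apply: simple_Alt_3; rewrite card_ord.
    by rewrite leq_eqVlt eq_sym (negbTE nm4) => m5; apply: simple_Alt5; rewrite card_ord.
  case: (normal_simple simA nN) => [->|sAN]; first by left; apply: sub1G.
  case: (normal_simple simA nM) => [->|sAM]; first by right; apply: sub1G.
  case: (over_Alt sAN) => ->; first by left.
  by right; apply: sS.
case: (normal4 m4 nN) => [->|[N4 sNA]|sAN]; first by left; apply: sub1G.
  case: (normal4 m4 nM) => [->|[M4 sMA]|sAM]; first by right; apply: sub1G.
    have nNM : N * M <| S by apply: normalM.
    pose K := [group of N <*> M].
    have eK : K = N * M :> {set _}.
      by rewrite /= norm_joinEr // (subset_trans (sS M)) // normal_norm.
    have nK : K <| S by rewrite eK.
    have p2 : 2.-nat #|K|.
      by rewrite eK; apply: pnat_dvd (dvdn_cardMg N M) _; rewrite N4 M4.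
    left; have [e|[K4 _]|sAK] := normal4 m4 nK.
    - by have := joing_subl N M; rewrite -[N <*> M]/(K : {set _}) e => /trivGP ->; apply: sub1G.
    - have eN : N :=: K by apply/eqP; rewrite eqEcard joing_subl K4 N4.
      have eM : M :=: K by apply/eqP; rewrite eqEcard joing_subr K4 M4.
      by rewrite eN -eM.
    have : 3 %| #|K|.
      apply: dvdn_trans (cardSg sAK).
      have := @card_Alt 'I_m; rewrite card_ord m4 => /(_ isT) /eqP.
      by rewrite -[4`!]/(2 * 12)%N eqn_mul2l /= => /eqP ->.
    by move/(pnatP _ (cardG_gt0 K)): p2 => /(_ 3 isT) H /H.
  by left; apply: subset_trans sNA sAM.
case: (normal4 m4 nM) => [->|[M4 sMA]|sAM]; first by right; apply: sub1G.
  by right; apply: subset_trans sMA sAN.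
case: (over_Alt sAN) => ->; first by left.
by right; apply: sS.
Qed.

Lemma Alt_ntriv : A != 1 :> {set 'S_m}.
Proof.
rewrite trivg_card1; apply/eqP => A1.
have := @card_Alt 'I_m; rewrite card_ord (ltnW m3) A1 => /(_ isT) /= e.
by have := fact_geq m; rewrite -e leqNgt m3.
Qed.

Lemma Alt_proper : A \proper S.
Proof.
rewrite properEneq Alt_subset andbT; apply/eqP => e.
have := @Alt_index 'I_m; rewrite card_ord (ltnW m3) => /(_ isT).
by rewrite -e indexgg.
Qed.

End NormalChain.

(** * The lattice of congruences *)

Section Covers.
Variables (T : finType) (mul : T -> T -> T).
Implicit Types th c : {set T * T}.

(** Covers are found by locating the minimal elements of the congruences strictly
   above. *)
Lemma covered_two th1 c1 c2 :
    congruence mul th1 -> congruence mul c1 -> congruence mul c2 ->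
    th1 \proper c1 -> th1 \proper c2 -> ~~ (c1 \subset c2) -> ~~ (c2 \subset c1) ->
    (forall th, congruence mul th -> th1 \proper th -> c1 \subset th \/ c2 \subset th) ->
  forall th, covered_by mul th1 th <-> th = c1 \/ th = c2.
Proof.
move=> k1 kc1 kc2 p1 p2 n12 n21 least th; split.
  have up c : congruence mul c -> th1 \proper c -> c \subset th ->
      covered_by mul th1 th -> th = c.
    move=> kc pc sc [_ _ _ none]; apply/eqP; rewrite eqEsubset sc andbT.
    apply: contra_notT (none c kc) => nsub; split=> //.
    by rewrite properE sc nsub.
  move=> cov; have [_ kth pth _] := cov.
  by case: (least _ kth pth) => sc; [left|right]; apply: up.
have low c c' : congruence mul c -> th1 \proper c -> ~~ (c' \subset c) ->
    (forall th, congruence mul th -> th1 \proper th -> c \subset th \/ c' \subset th) ->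
    covered_by mul th1 c.
  move=> kc pc nc' lst; split=> // th' kth' [p p'].
  have [sub|sub] := lst _ kth' p; first by move: p'; rewrite properE sub andbF.
  by case/negP: nc'; apply: subset_trans sub (proper_sub p').
case=> ->; first exact: low n21 least.
by apply: low n12 _ => // th' kth' p; case: (least _ kth' p); [right|left].
Qed.

Lemma covered_one th1 c : congruence mul th1 -> congruence mul c -> th1 \proper c ->
    (forall th, congruence mul th -> th1 \proper th -> c \subset th) ->
  forall th, covered_by mul th1 th <-> th = c.
Proof.
move=> k1 kc pc least th; split=> [[_ kth pth none]|->]; last first.
  split=> // th' kth' [p p'].
  by move: p'; rewrite properE (least _ kth' p) andbF.
have sc := least _ kth pth; apply/eqP; rewrite eqEsubset sc andbT.
apply: contra_notT (none c kc) => nsub; split=> //.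
by rewrite properE sc nsub.
Qed.

End Covers.

Section Lattice.
Variable n : nat.
Implicit Types (a b c d g : part n) (X Y Z : tpart n) (th : {set tpart n * tpart n}).

Lemma extR_zero q (r : rel (part n)) a : (Some a, None) \in extR q r -> rank a <= q.
Proof. by case/extRP=> [//|[]//|/lift_relP[? [? []]]]. Qed.

Lemma extR_not_ideal q (r : rel (part n)) : q < n -> ~ ideal_in (extR q r) q.+1.
Proof.
move=> qn Z; suff: rank (std n (1%g : 'S_q.+1)) <= q by rewrite (std_rank qn) ltnn.
by apply: (@extR_zero q r); apply: Z; rewrite /= (std_rank qn).
Qed.

Lemma sub_ideal th1 th2 r : th1 \subset th2 ->
  ideal_in th1 r -> ideal_in th2 r.
Proof. by move=> /subsetP sub Z X lX; apply/sub/Z. Qed.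

Lemma extR_ideal q (r : rel (part n)) : ideal_in (extR q r) q.
Proof. by move=> X lX; apply: extR_low. Qed.

Lemma extR_lt_Rees q (r : rel (part n)) : (forall a b, r a b -> rank a = q.+1 /\ rank b = q.+1) ->
  extR q r \subset Rees n (Some q.+1).
Proof.
move=> H; apply/subsetP=> -[X Y]; rewrite ReesE.
case/extRP=> [->|[lX lY]|/lift_relP[a [b [-> -> /H[ra rb]]]]]; first by rewrite eqxx.
  by rewrite (lowW _ lX) ?(lowW _ lY) ?orbT.
by rewrite /= ra rb !leqnn orbT.
Qed.

Lemma extR_proper_Rees q (r : rel (part n)) : q < n ->
    (forall a b, r a b -> rank a = q.+1 /\ rank b = q.+1) ->
  extR q r \proper Rees n (Some q.+1).
Proof.
move=> qn H; rewrite properE extR_lt_Rees //=; apply/negP => sub.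
apply: (@extR_not_ideal q r qn); apply: sub_ideal sub _.
by rewrite Rees_extR; apply: extR_ideal.
Qed.

Lemma Rees_sub_extR q (r : rel (part n)) : Rees n (Some q) \subset extR q r.
Proof. by rewrite Rees_extR; apply: extR_sub. Qed.

Lemma Rees_sub q q' : q <= q' -> Rees n (Some q) \subset Rees n (Some q').
Proof.
move=> qq; apply/(ideal_in_Rees (Rees_congruence _ _))/(ideal_inW qq).
by rewrite Rees_extR; apply: extR_ideal.
Qed.

Lemma mu_ranks a b : mu_rel a b -> rank a = 1 /\ rank b = 1.
Proof. by case/muP. Qed.

Lemma nu_ranks q (N : {set 'S_q}) a b : nu_rel N a b -> rank a = q /\ rank b = q.
Proof. by move=> ab; rewrite (nu_rank ab) (nu_rankr ab). Qed.

(** ** The relations [RN] *)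

(** Going from [a] to [b] by [s] and back by the inverse of [t] is going from [a] to
   [a], in representatives that differ by [u]. *)
Lemma twisted_conj q (s t : 'S_q) a b x y x' y' : same_pattern a b ->
  twisted s a b x y -> twisted t a b x' y' -> exists u, s = (t ^ u)%g.
Proof.
move=> pab ts tt; have pba := same_pattern_sym pab.
have [u [[xy inj _] tw]] := twisted_trans pab pba ts (twisted_sym pab tt).
exists u; have w1 : ((t ^ u)^-1 * s = 1)%g.
  apply/permP=> i; rewrite perm1 -conjVg; apply/esym/inj.
  by rewrite tw xy.
by rewrite -[LHS](mulKVg (t ^ u)%g) w1 mulg1.
Qed.

Section RNfacts.
Variable q : nat.
Hypothesis qn : q < n.
Implicit Types N M : {group 'S_q.+1}.

(** The models see every permutation of [N]. *)
Lemma RN_subset N M : (M <| 'Sym_('I_q.+1))%g -> (RN n N \subset RN n M) = (N \subset M).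
Proof.
move=> /normal_norm/subsetP nM; apply/idP/idP => [/subsetP sub|sNM]; last first.
  apply: extR_sub => a b /nuP[pab [s sN tw]]; apply/nuP; split=> //.
  by exists s => //; apply: (subsetP sNM).
apply/subsetP=> s sN.
have st := std_twisted1 qn s; have pst := std_pat qn 1 s.
have : (Some (std n (1%g : 'S_q.+1)), Some (std n s)) \in RN n M.
  by apply: sub; apply/extRP; constructor 3; rewrite lift_relE; apply: nu_std.
case/extRP=> [/Some_inj e|[]|].
- have : twisted 1%g (std n (1%g : 'S_q.+1)) (std n 1%g) (unsqueeze qn) (unsqueeze qn) := std_twisted1 qn 1.
  rewrite {2}e => t1; have [u ->] := twisted_conj pst st t1.
  by rewrite conj1g group1.
- by rewrite /= (std_rank qn) ltnn.
rewrite lift_relE => /nuP[_ [t tM [x [y tt]]]].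
have [u ->] := twisted_conj pst st tt.
by rewrite memJ_norm // nM ?inE.
Qed.

Lemma RN_proper N M : (N <| 'Sym_('I_q.+1))%g -> (M <| 'Sym_('I_q.+1))%g ->
  (RN n N \proper RN n M) = (N \proper M).
Proof. by move=> nN nM; rewrite !properE !RN_subset. Qed.

Lemma Rees_proper_RN N : (N <| 'Sym_('I_q.+1))%g -> (N :!=: 1)%g ->
  Rees n (Some q) \proper RN n N.
Proof.
move=> nN n1; rewrite -RN1 RN_proper ?normal1 //.
by rewrite proper1G.
Qed.

Lemma RN_proper_Rees N : RN n N \proper Rees n (Some q.+1).
Proof. by apply: extR_proper_Rees => // a b; apply: nu_ranks. Qed.

End RNfacts.

(** Take for [q] the rank of the largest Rees congruence inside [th]. *)
Lemma ideal_level th r : congruence (@tmul n) th -> 0 < r <= n -> ideal_in th r ->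
  exists2 q, r <= q <= n & th = Rees n (Some q) /\ q = n \/
    exists2 qn : q < n, ~ ideal_in th q.+1 &
    exists2 N : {group 'S_q.+1}, (N <| 'Sym_('I_q.+1))%g & th = RN n N.
Proof.
move=> cth /andP[r0 rn]; have [k] := ubnP (n - r); elim: k r r0 rn => // k IH r r0 rn.
rewrite ltnS => nr Zr; have [Zr1|nZ] := ideal_dec th r.+1; last first.
  have [rn'|nr'] := ltnP r n; last first.
    have e : r = n by apply/eqP; rewrite eqn_leq rn.
    exists n; rewrite ?leqnn ?rn //; left; split=> //.
    by apply: ideal_n => //; move: Zr; rewrite e.
  exists r; rewrite ?leqnn //; right; exists rn' => //.
  exact: RN_of_ideal.
have [rn'|nr'] := ltnP r n; last first.
  have e : r = n by apply/eqP; rewrite eqn_leq rn.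
  exists n; rewrite ?leqnn ?rn //; left; split=> //.
  by apply: ideal_n => //; move: Zr; rewrite e.
have [|q /andP[rq qn] H] := IH r.+1 isT rn' _ Zr1.
  by apply: leq_trans nr; rewrite ltn_sub2l.
by exists q; rewrite ?(ltnW rq).
Qed.

Hypothesis n2 : 1 < n.
Let n1 : 0 < n := ltnW n2.
Local Notation R q := (Rees n (Some q)).
Local Notation congr th := (congruence (@tmul n) th).
Local Notation R_S2 := (RN n ('Sym_('I_2))%g).

(** ** Elements telling the small congruences apart *)

(** A single transversal, joining [i] to [j], and singletons otherwise: moving its
   ends changes no kernel. *)
Definition pin (i j : 'I_n) : part n := of_lab (fun v => match v with
  | inl x => if x == i then None else Some (inl x : 'I_n + 'I_n)
  | inr y => if y == j then None else Some (inr y) end).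

Lemma pin_ul i j x y : up (pin i j) x = lo (pin i j) y <-> x = i /\ y = j.
Proof.
rewrite cls_of_lab; split=> [|[-> ->]]; last by rewrite !eqxx.
by case: eqP => [->|_]; case: eqP => [->|_].
Qed.

Lemma pin_up i j x y : up (pin i j) x = up (pin i j) y <-> x = y.
Proof.
rewrite cls_of_lab; split=> [|-> //].
by case: eqP => [->|_]; case: eqP => [->|_] // [].
Qed.

Lemma pin_lo i j x y : lo (pin i j) x = lo (pin i j) y <-> x = y.
Proof.
rewrite cls_of_lab; split=> [|-> //].
by case: eqP => [->|_]; case: eqP => [->|_] // [].
Qed.

Lemma pin_rank i j : rank (pin i j) = 1.
Proof.
apply: (@reps_rank _ _ _ (fun=> i) (fun=> j)); split=> [_|k l _|z /udomP[y /pin_ul[-> _]]].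
- exact/pin_ul.
- by rewrite !ord1.
- by exists ord0.
Qed.

Lemma pin_mu i j k l : mu_rel (pin i j) (pin k l).
Proof.
apply/muP; rewrite !pin_rank; split=> // x y.
  by rewrite !pin_up.
by rewrite !pin_lo.
Qed.

Lemma pin_dom i j x : udom (pin i j) x = (x == i).
Proof.
apply/udomP/eqP => [[y /pin_ul[]] //|->].
by exists j; apply/pin_ul.
Qed.

Lemma pin_cod i j y : udom (flip (pin i j)) y = (y == j).
Proof.
apply/codP/eqP => [[x /pin_ul[]] //|->].
by exists i; apply/pin_ul.
Qed.

Let i0 : 'I_n := Ordinal n1.
Let i1 : 'I_n := Ordinal n2.

Lemma pair_in q (r : rel (part n)) a b : q < rank a ->
  (Some a, Some b) \in extR q r -> a = b \/ r a b.
Proof.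
move=> ra /extRP[[->]|[/=]|]; [by left|by rewrite ltnNge ra|].
by rewrite lift_relE; right.
Qed.

Lemma in_ext q (r : rel (part n)) a b : r a b -> (Some a, Some b) \in extR q r.
Proof. by move=> ab; apply/extRP; constructor 3; rewrite lift_relE. Qed.

Lemma pin_up_pair : mu_greenR (pin i0 i0) (pin i0 i1).
Proof. by apply/mu_greenRP; split=> [|x]; [apply: pin_mu|rewrite !pin_dom]. Qed.

Lemma pin_down_pair : mu_greenL (pin i0 i0) (pin i1 i0).
Proof. by apply/mu_greenLP; split=> [|x]; [apply: pin_mu|rewrite !pin_cod]. Qed.

Lemma up_not_down : ~~ (mu_up n \subset mu_down n).
Proof.
apply/negP => /subsetP/(_ _ (in_ext 0 pin_up_pair)) h.
have [|e|/mu_greenLP[_ /(_ i1)]] := pair_in _ h; first by rewrite pin_rank.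
  by have := pin_cod i0 i1 i1; rewrite -e pin_cod eqxx.
by rewrite !pin_cod eqxx.
Qed.

Lemma down_not_up : ~~ (mu_down n \subset mu_up n).
Proof.
apply/negP => /subsetP/(_ _ (in_ext 0 pin_down_pair)) h.
have [|e|/mu_greenRP[_ /(_ i1)]] := pair_in _ h; first by rewrite pin_rank.
  by have := pin_dom i1 i0 i1; rewrite -e pin_dom eqxx.
by rewrite !pin_dom eqxx.
Qed.

Lemma R0_up : R 0 \proper mu_up n.
Proof.
rewrite properE [_ \subset mu_up n]Rees_sub_extR /=; apply: contra up_not_down => sub.
exact: subset_trans sub (Rees_sub_extR _ _).
Qed.

Lemma R0_down : R 0 \proper mu_down n.
Proof.
rewrite properE [_ \subset mu_down n]Rees_sub_extR /=; apply: contra down_not_up => sub.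
exact: subset_trans sub (Rees_sub_extR _ _).
Qed.

Lemma up_sub_mu : mu_up n \subset mu n.
Proof. by apply: (@extR_sub n 0 (@mu_greenR n)) => a b /andP[]. Qed.

Lemma down_sub_mu : mu_down n \subset mu n.
Proof. by apply: (@extR_sub n 0 (@mu_greenL n)) => a b /andP[]. Qed.

Lemma up_mu : mu_up n \proper mu n.
Proof.
rewrite properE up_sub_mu /=; apply: contra down_not_up.
exact: subset_trans down_sub_mu.
Qed.

Lemma down_mu : mu_down n \proper mu n.
Proof.
rewrite properE down_sub_mu /=; apply: contra up_not_down.
exact: subset_trans up_sub_mu.
Qed.

Lemma mu_R1 : mu n \proper R 1.
Proof. by apply: extR_proper_Rees => // a b; apply: mu_ranks. Qed.

Lemma mu_sub_S2 : mu n \subset mu_S2 n. Proof. exact: subsetUl. Qed.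

Lemma R1_not_S2 : ~~ (R 1 \subset mu_S2 n).
Proof.
apply/negP => sub; apply: (@extR_not_ideal 0 (@muS2 n) n1).
rewrite -mu_S2E; apply: sub_ideal sub _.
by rewrite Rees_extR; apply: extR_ideal.
Qed.

Let tau : 'S_2 := tperm ord0 ord_max.

Lemma swap_pair : nu_rel ('Sym_('I_2))%g (std n (1%g : 'S_2)) (std n tau).
Proof. by apply: (nu_std n2); rewrite inE. Qed.

Lemma swap_S2 : (Some (std n (1%g : 'S_2)), Some (std n tau)) \in mu_S2 n.
Proof. by rewrite mu_S2E; apply: in_ext; rewrite /muS2 swap_pair orbT. Qed.

Lemma std_tau : std n (1%g : 'S_2) <> std n tau.
Proof.
move=> e; have := std_ul (1%g : 'S_2) i0 i0; rewrite e std_ul perm1 => -[_ /(_ erefl)].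
have -> : squeeze 1 i0 = ord0 by apply: val_inj; rewrite /= inordK.
by rewrite tpermL.
Qed.

(** A pair of rank 2 distinguishing [mu_S2] from the congruences that relate only
   elements of rank at most 1. *)
Lemma swap_notin q (r : rel (part n)) : q <= 1 -> (forall a b, r a b -> rank a <= 1) ->
  (Some (std n (1%g : 'S_2)), Some (std n tau)) \notin extR q r.
Proof.
move=> q1 H; apply/negP => h; have [|/std_tau//|/H] := pair_in _ h; by rewrite (std_rank n2).
Qed.

Lemma S2_not_R1 : ~~ (mu_S2 n \subset R 1).
Proof.
apply/negP => /subsetP/(_ _ swap_S2); apply/negP.
by rewrite Rees_extR swap_notin.
Qed.

Lemma mu_S2_proper : mu n \proper mu_S2 n.
Proof.
rewrite properE mu_sub_S2; apply/negP => /subsetP/(_ _ swap_S2); apply/negP.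
by apply: (swap_notin (r := @mu_rel n)) => // a b /mu_ranks[->].
Qed.

Lemma Sym_nt q : (('Sym_('I_q.+2))%G :!=: 1)%g.
Proof.
apply/eqP => e; have : tperm (ord0 : 'I_q.+2) ord_max \in ('Sym_('I_q.+2))%g by rewrite inE.
by rewrite e inE => /eqP/permP/(_ ord0); rewrite tpermL perm1.
Qed.

Lemma R1_RS2 : R 1 \proper R_S2.
Proof. by apply: (@Rees_proper_RN 1 n2 'Sym_('I_2)%G); [apply: normal_refl|apply: Sym_nt]. Qed.

Lemma S2_sub_RS2 : mu_S2 n \subset R_S2.
Proof.
rewrite mu_S2E; apply/subsetP=> -[X Y] /extRP[->|[lX lY]|/lift_relP[a [b [-> -> /orP[/mu_ranks[ra rb]|ab]]]]].
- by apply/extRP; constructor 1.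
- by apply: extR_low; apply: lowW (leqnSn _) _.
- by apply: extR_low; rewrite /= ?ra ?rb.
exact: in_ext.
Qed.

Lemma S2_RS2 : mu_S2 n \proper R_S2.
Proof.
rewrite properE S2_sub_RS2; apply: contra R1_not_S2.
exact/subset_trans/proper_sub/R1_RS2.
Qed.

Lemma RS2_congr : congr R_S2.
Proof. by apply: (@RN_congruence _ 2 'Sym_('I_2)%G) => //; apply: normal_refl. Qed.

Lemma RS2_R2 : R_S2 \proper R 2.
Proof. exact: (@RN_proper_Rees 1 n2 'Sym_('I_2)%G). Qed.

(** ** Least congruences above a given one *)

Lemma above_Delta th : congr th -> Delta n \proper th -> R 0 \subset th.
Proof.
move=> cth p; apply/(ideal_in_Rees cth)/nonDelta_ideal0 => // e.
by rewrite e properxx in p.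
Qed.

Lemma proper_ideal q th : congr th -> R q \subset th -> ideal_in th q.
Proof. by move=> cth; move/(ideal_in_Rees cth). Qed.

Lemma above_R0 th : congr th -> R 0 \proper th ->
  mu_up n \subset th \/ mu_down n \subset th.
Proof.
move=> cth p; have Z0 := proper_ideal cth (proper_sub p).
have [/(ideal_in_Rees cth) s1|nZ] := ideal_dec th 1.
  by left; apply: subset_trans s1; apply/(subset_trans up_sub_mu)/proper_sub/mu_R1.
case: (small_congruences cth Z0 nZ) => [e|[->|->]|->|->]; [|by left|by right| |].
- by rewrite e properxx in p.
- by left; apply: up_sub_mu.
by left; apply: subset_trans mu_sub_S2; apply: up_sub_mu.
Qed.

Lemma above_up th : congr th -> mu_up n \proper th -> mu n \subset th.
Proof.
move=> cth p; have Z0 : ideal_in th 0.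
  by apply/proper_ideal/(subset_trans (proper_sub R0_up))/proper_sub.
have [/(ideal_in_Rees cth) s1|nZ] := ideal_dec th 1.
  by apply: subset_trans s1; apply/proper_sub/mu_R1.
case: (small_congruences cth Z0 nZ) => [e|[e|e]|->|->] //; last exact: mu_sub_S2.
- by case/andP: (proper_trans R0_up p); rewrite e subxx.
- by rewrite e properxx in p.
by case/negP: up_not_down; rewrite -e (proper_sub p).
Qed.

Lemma above_down th : congr th -> mu_down n \proper th -> mu n \subset th.
Proof.
move=> cth p; have Z0 : ideal_in th 0.
  by apply/proper_ideal/(subset_trans (proper_sub R0_down))/proper_sub.
have [/(ideal_in_Rees cth) s1|nZ] := ideal_dec th 1.
  by apply: subset_trans s1; apply/proper_sub/mu_R1.
case: (small_congruences cth Z0 nZ) => [e|[e|e]|->|->] //; last exact: mu_sub_S2.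
- by case/andP: (proper_trans R0_down p); rewrite e subxx.
- by case/negP: down_not_up; rewrite -e (proper_sub p).
by rewrite e properxx in p.
Qed.

Lemma above_mu th : congr th -> mu n \proper th -> R 1 \subset th \/ mu_S2 n \subset th.
Proof.
move=> cth p; have Z0 : ideal_in th 0.
  by apply/proper_ideal/(subset_trans (Rees_sub_extR _ _))/proper_sub/p.
have [/(ideal_in_Rees cth) s1|nZ] := ideal_dec th 1; first by left.
case: (small_congruences cth Z0 nZ) => [e|[e|e]|e|->]; last by right.
- by case/andP: (proper_trans (proper_trans R0_up up_mu) p); rewrite e subxx.
- by case/andP: (proper_trans up_mu p); rewrite e subxx.
- by case/andP: (proper_trans down_mu p); rewrite e subxx.
by rewrite e properxx in p.
Qed.

Lemma ideal1_cases th : congr th -> ideal_in th 1 ->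
  [\/ th = R 1, th = R_S2 | R 2 \subset th].
Proof.
move=> cth Z1; have [/(ideal_in_Rees cth) s2|nZ] := ideal_dec th 2; first by constructor 3.
have [N nN ->] := @RN_of_ideal n th 1 cth isT Z1 nZ.
have [->|/trivgPn[s sN s1]] := eqVneq (N : {set _}) 1%g; first by constructor 1; apply: RN1.
constructor 2; congr RN; apply/setP=> t; rewrite [RHS]inE.
have [->|nt] := eqVneq t 1%g; first exact: group1.
by rewrite (perm_I2 nt s1).
Qed.

Lemma above_R1 th : congr th -> R 1 \proper th -> R_S2 \subset th.
Proof.
move=> cth p; have Z1 := proper_ideal cth (proper_sub p).
case: (ideal1_cases cth Z1) => [e|->//|]; first by rewrite e properxx in p.
exact/subset_trans/proper_sub/RS2_R2.
Qed.

Lemma above_S2 th : congr th -> mu_S2 n \proper th -> R_S2 \subset th.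
Proof.
move=> cth p; have pm := proper_trans mu_S2_proper p.
have Z0 : ideal_in th 0.
  by apply/proper_ideal/(subset_trans (Rees_sub_extR _ _))/proper_sub/pm.
have [/(ideal_in_Rees cth) s1|nZ] := ideal_dec th 1.
  apply: above_R1 => //; rewrite properE s1; apply: contra S2_not_R1.
  exact/subset_trans/proper_sub.
case: (small_congruences cth Z0 nZ) => [e|[e|e]|e|e].
- by case/andP: (proper_trans (proper_trans R0_up up_mu) pm); rewrite e subxx.
- by case/andP: (proper_trans up_mu pm); rewrite e subxx.
- by case/andP: (proper_trans down_mu pm); rewrite e subxx.
- by rewrite e properxx in pm.
by rewrite e properxx in p.
Qed.

Lemma above_RS2 th : congr th -> R_S2 \proper th -> R 2 \subset th.
Proof.
move=> cth p; have Z1 : ideal_in th 1.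
  by apply/proper_ideal/(subset_trans (proper_sub R1_RS2))/proper_sub.
case: (ideal1_cases cth Z1) => [e|e|//].
  by case/andP: (proper_trans R1_RS2 p); rewrite e subxx.
by rewrite e properxx in p.
Qed.

Lemma above_RS2_chain th1 th2 : congr th1 -> congr th2 ->
  R_S2 \subset th1 -> R_S2 \subset th2 -> th1 \subset th2 \/ th2 \subset th1.
Proof.
move=> c1 c2 s1 s2.
have Z th : congr th -> R_S2 \subset th -> ideal_in th 1.
  by move=> cth s; apply/proper_ideal/(subset_trans (proper_sub R1_RS2)).
have top th : th \subset R n.
  by apply/subsetP=> -[[a|] [b|]] _; rewrite ReesE /= ?ltnS ?rank_leqn ?orbT.
have [//|q1 _ [[-> ->]|[q1n nZ1 [N1 nN1 e1]]]] := ideal_level c1 _ (Z _ c1 s1); first by right.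
have [//|q2 _ [[-> ->]|[q2n nZ2 [N2 nN2 e2]]]] := ideal_level c2 _ (Z _ c2 s2); first by left.
have lt_sub p p' (M : {group 'S_p.+1}) (M' : {group 'S_p'.+1}) : p < n -> p < p' ->
    RN n M \subset RN n M'.
  move=> pn pp; apply: subset_trans (proper_sub (RN_proper_Rees pn M)) _.
  exact: subset_trans (Rees_sub pp) (Rees_sub_extR _ _).
case: (ltngtP q1 q2) => [lt|lt|eq]; first by left; rewrite e1 e2; apply: lt_sub.
  by right; rewrite e1 e2; apply: lt_sub.
case: _ / eq N2 nN2 e2 q2n {nZ2} => N2 nN2 e2 q2n; rewrite e1 e2 !RN_subset //.
have [q3|q3] := ltnP 1 q1; first exact: normal_chain.
have q1_1 : q1 = 1.
  apply/eqP; rewrite eqn_leq q3 lt0n; apply/eqP => q0.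
  by apply: nZ1; rewrite q0; apply: Z.
case: _ / (esym q1_1) N1 N2 nN1 nN2 e1 e2 {nZ1 q1n q2n q3} => N1 N2 nN1 nN2 e1 e2.
left; apply: subset_trans (normal_sub nN1) _.
by rewrite -(@RN_subset 1 n2 'Sym_('I_2)%G) // -e2.
Qed.

End Lattice.

Theorem theorem7p6 (n : nat) (n_ge2 : 2 <= n) :
  let congr := congruence (@tmul n) in
  let covered := covered_by (@tmul n) in
  let normal_nontriv (q : nat) (N : {group 'S_q}) :=
    (N <| 'Sym_('I_q))%g /\ N != 1%G in
  let R (q : nat) := Rees n (Some q) in
  let R_S2 := RN n ('Sym_('I_2))%g in
  [/\ Rees n None = Delta n,
      R n = Nabla n
    & forall th : {set tpart n * tpart n},
        congr th <->
        [\/ exists2 q : option nat, le_rank q (Some n) & th = Rees n q,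
            exists (q : nat) (N : {group 'S_q}),
              [/\ 2 <= q <= n, normal_nontriv q N & th = RN n N]
          | [\/ th = mu_up n, th = mu_down n, th = mu n | th = mu_S2 n]]]
  /\
  [/\ forall th, covered (Delta n) th <-> th = R 0,
      mu_up n <> mu_down n /\
        (forall th, covered (R 0) th <-> th = mu_up n \/ th = mu_down n),
      (forall th, covered (mu_up n) th <-> th = mu n) /\
        (forall th, covered (mu_down n) th <-> th = mu n),
      R 1 <> mu_S2 n /\
        (forall th, covered (mu n) th <-> th = R 1 \/ th = mu_S2 n)
    & (forall th, covered (R 1) th <-> th = R_S2) /\
        (forall th, covered (mu_S2 n) th <-> th = R_S2)]
  /\
  [/\ forall th1 th2, congr th1 -> congr th2 ->
        R_S2 \subset th1 -> R_S2 \subset th2 ->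
        th1 \subset th2 \/ th2 \subset th1,
      forall th, covered R_S2 th <-> th = R 2
    & forall q : nat, 3 <= q <= n ->
        [/\ [/\ R q.-1 \proper RN n ('Alt_('I_q))%g,
                RN n ('Alt_('I_q))%g \proper RN n ('Sym_('I_q))%g
              & RN n ('Sym_('I_q))%g \proper R q],
            forall th, congr th ->
              (R q.-1 \proper th /\ th \proper R q <->
               exists2 N : {group 'S_q}, normal_nontriv q N & th = RN n N)
          & forall N1 N2 : {group 'S_q},
              normal_nontriv q N1 -> normal_nontriv q N2 ->
              (RN n N1 \subset RN n N2) = (N1 \subset N2)]].
Proof.
move=> congr covered normal_nontriv R R_S2.
have n0 : 0 < n by apply: ltnW.
have nR q : congr (R q) by apply: Rees_congruence.
have RSn : normal_nontriv 2 ('Sym_('I_2))%G.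
  by split; [apply: normal_refl|apply/eqP => e; have := Sym_nt 0; rewrite e eqxx].
have RNcase th q : congr th -> 0 < q <= n -> ideal_in th q -> 
    (exists2 p, le_rank p (Some n) & th = Rees n p) \/
    exists k (N : {group 'S_k}), [/\ 2 <= k <= n, normal_nontriv k N & th = RN n N].
  move=> cth qn Zq; have [p /andP[qp pn] [[-> _]|[p_n _ [N nN ->]]]] := ideal_level cth qn Zq.
    by left; exists (Some p).
  have [->|N1] := eqVneq N 1%G; first by left; exists (Some p); rewrite ?RN1.
  right; exists p.+1, N; split=> //.
  by rewrite p_n andbT ltnS; apply: leq_trans qp; case/andP: qn.
split; [split=> [||th]|split]; first exact: ReesNone.
- by apply/setP=> -[[a|] [b|]]; rewrite ReesE inE /= ?ltnS ?rank_leqn ?orbT.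
- split=> [cth|]; last first.
    case=> [[[q|] _ ->]|[q [N [/andP[q2 _] [nN _] ->]]]|[] ->].
    + exact: nR.
    + by rewrite ReesNone; apply: Delta_congruence.
    + by apply: RN_congruence nN; apply: ltnW.
    + exact: mu_up_congruence.
    + exact: mu_down_congruence.
    + exact: mu_congruence.
    + exact: mu_S2_congruence.
  have [->|/eqP nD] := eqVneq th (Delta n).
    by constructor 1; exists None; rewrite ?ReesNone.
  have Z0 := nonDelta_ideal0 n0 cth nD.
  have [Z1|nZ1] := ideal_dec th 1.
    by have [h|h] := RNcase th 1 cth n0 Z1; [constructor 1|constructor 2].
  case: (small_congruences cth Z0 nZ1) => [->|[->|->]|->|->].
  + by constructor 1; exists (Some 0).
  + by constructor 3; constructor 1.
  + by constructor 3; constructor 2.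
  + by constructor 3; constructor 3.
  by constructor 3; constructor 4.
- have Dr : Delta n \proper R 0.
    rewrite -ReesNone properE; apply/andP; split.
      by apply/subsetP=> -[X Y]; rewrite ReesNone inE ReesE => ->.
    have m0 : (Some (of_lab (@side n)), None) \in R 0.
      by rewrite ReesE /= andbT ltnS leqn0; apply/eqP/rank0P=> x y; rewrite cls_of_lab.
    by apply/negP => /subsetP/(_ _ m0); rewrite ReesNone inE.
  split.
  + by apply: covered_one; [exact: Delta_congruence|exact: nR|exact: Dr|exact: (above_Delta n_ge2)].
  + split; first by move=> e; have := up_not_down n_ge2; rewrite e subxx.
    apply: covered_two; [exact: nR|exact: mu_up_congruence|exact: mu_down_congruence|
      exact: R0_up|exact: R0_down|exact: up_not_down|exact: down_not_up|exact: (above_R0 n_ge2)].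
  + split; apply: covered_one; [exact: mu_up_congruence|exact: mu_congruence|exact: up_mu|
      exact: (above_up n_ge2)|exact: mu_down_congruence|exact: mu_congruence|exact: down_mu|exact: (above_down n_ge2)].
  + split; first by move=> e; have := R1_not_S2 n_ge2; rewrite -e subxx.
    apply: covered_two; [exact: mu_congruence|exact: nR|exact: mu_S2_congruence|exact: mu_R1|
      exact: mu_S2_proper|exact: R1_not_S2|exact: S2_not_R1|exact: (above_mu n_ge2)].
  split; apply: covered_one; [exact: nR|exact: RS2_congr|exact: R1_RS2|exact: (above_R1 n_ge2)|
    exact: mu_S2_congruence|exact: RS2_congr|exact: S2_RS2|exact: (above_S2 n_ge2)].
split.
- exact: (above_RS2_chain n_ge2).
- by apply: covered_one; [exact: RS2_congr|exact: nR|exact: RS2_R2|exact: (above_RS2 n_ge2)].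
case=> // q /andP[q2 qn]; have nA : ('Alt_('I_q.+1) <| 'Sym_('I_q.+1))%g := Alt_normal _.
have nS : ('Sym_('I_q.+1) <| 'Sym_('I_q.+1))%g := normal_refl _.
have pA : ('Alt_('I_q.+1) \proper 'Sym_('I_q.+1))%g by apply: Alt_proper.
split.
- split; first by apply: Rees_proper_RN => //; apply: Alt_ntriv.
    by rewrite (@RN_proper n q qn ('Alt_('I_q.+1))%G ('Sym_('I_q.+1))%G).
  exact: (@RN_proper_Rees n q qn ('Sym_('I_q.+1))%G).
- move=> th cth; split=> [[plo phi]|[N [nN N1] ->]].
    have Zq : ideal_in th q by apply/(ideal_in_Rees cth)/proper_sub.
    have nZq : ~ ideal_in th q.+1.
      by move/(ideal_in_Rees cth) => s; move: phi; rewrite properE s andbF.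
    have q0 : 0 < q by apply: ltnW.
    have [N nN e] := RN_of_ideal cth q0 Zq nZq; exists N => //; split=> //; apply/eqP => N1.
    by move: plo; rewrite e N1 RN1 properxx.
  by split; [apply: Rees_proper_RN => //; apply: contra N1 => /eqP e; apply/eqP/val_inj|apply: RN_proper_Rees].
by move=> N1 N2 _ [nN2 _]; apply: RN_subset.
Qed.
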